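(* Let $\rho$ be a probability measure on $(0,\infty)$, and set $$P_n^\rho(\Gamma):=\int_0^\infty P_n^r(\Gamma)\,\rho(dr),\qquad \Gamma\in\Pi_n .$$ Then, for any $\varepsilon>0$, $$\lim_{n\to\infty}P_n^\rho\{\Gamma\in\Pi_n: d_{\mathcal T}(\tilde\Gamma_n,\gamma^* )\le\varepsilon\}=1 .$$
   Context: A convex lattice polygonal line $\Gamma$ is a piecewise linear path in the plane with finitely many edges, starting at the origin $0=(0,0)$, with vertices in $\mathbb Z_+^2$ ($\mathbb Z_+=\{0,1,2,\dots\}$), such that the inclination angle of its consecutive edges strictly increases and stays in $[0,\pi/2]$. For $n=(n_1,n_2)\in\mathbb Z_+^2$, $\Pi_n$ is the (finite) set of convex lattice polygonal lines whose right endpoint is $n$. For $0<r<\infty$ and $k\in\mathbb Z_+$ put $b_k^r=\binom{r+k-1}{k}=\frac{r(r+1)\cdots(r+k-1)}{k!}$ (with $b_0^r=1$). For $\Gamma\in\Pi_n$ put $b^r(\Gamma)=\prod_{e_i\in\Gamma}b_{k_i}^r$, the product being over all edges $e_i$ of $\Gamma$, where $k_i$ is the number of lattice points on $e_i$ except its left endpoint. The probability measure $P_n^r$ on $\Pi_n$ is $P_n^r(\Gamma)=b^r(\Gamma)/\sum_{\Gamma'\in\Pi_n}b^r(\Gamma')$. The limit $n=(n_1,n_2)\to\infty$ means $n_1,n_2\to\infty$ in such a way that $0<c_1\le n_2/n_1\le c_2<\infty$ for some constants $c_1,c_2$. Scaling: $S_n(x_1,x_2)=(x_1/n_1,x_2/n_2)$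 and $\tilde\Gamma_n=S_n(\Gamma)$. For $t\in[0,\infty]$, $\tilde\xi_n(t)$ denotes the right endpoint of the part of $\tilde\Gamma_n$ where the tangent slope (wherever it exists) does not exceed $t$ (the origin if there is no such part). The limit curve $\gamma^*$ is the parabola arc $\sqrt{1-x_1}+\sqrt{x_2}=1$, $0\le x_1,x_2\le1$, with tangential parameterization $g^*(t)=\left(\frac{t^2+2t}{(1+t)^2},\frac{t^2}{(1+t)^2}\right)$, $0\le t\le\infty$ (with $g^*(\infty)=(1,1)$). The tangential distance is $d_{\mathcal T}(\tilde\Gamma_n,\gamma^* )=\sup_{0\le t\le\infty}|\tilde\xi_n(t)-g^*(t)|$, where $|\cdot|$ is the Euclidean norm on $\mathbb R^2$. *)

(* Defs.v *)
From HB Require Import structures.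
From mathcomp Require Import all_boot all_order all_algebra.
From mathcomp Require Import all_classical all_reals all_analysis.
From mathcomp Require Import ring.
Import Order.TTheory GRing.Theory Num.Theory.
Import numFieldNormedType.Exports.

Set Implicit Arguments.
Unset Strict Implicit.
Unset Printing Implicit Defensive.

Local Open Scope classical_set_scope.
Local Open Scope ring_scope.

Definition to_plane (R : realType) (e : nat * nat) : R * R :=
  (e.1%:R, e.2%:R).

(* Inclination angle and slope of a nonzero vector of the closed first
   quadrant. *)
Definition inclination (R : realType) (v : R * R) : R :=
  if v.1 == 0 then pi / 2 else atan (v.2 / v.1).

Definition slope (R : realType) (v : R * R) : \bar R :=
  if v.1 == 0 then +oo%E else (v.2 / v.1)%:E.

(* A line starting at the origin is the sequence of its edge vectors, from left
   to right.  Since the inclinations lie in [0, pi/2], the edges have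
   nonnegative coordinates, and conversely nonzero edges in nat * nat have
   inclination in [0, pi/2] and produce vertices in nat * nat. *)
Definition polyline := seq (nat * nat).

Definition convex_polyline (R : realType) (G : polyline) : Prop :=
  all (fun e => e != (0%N, 0%N)) G /\
  sorted (fun e f => inclination (to_plane R e) < inclination (to_plane R f)) G.

Definition Pi_lines (R : realType) (n : nat * nat) : set polyline :=
  [set G | convex_polyline R G /\ \sum_(e <- G) e = n].

(* The number of lattice points on the segment [0, e] other than 0: they are
   the points of the box [0, e.1] x [0, e.2] on the line through 0 and e.  By
   translation this is the number of lattice points of an edge with vector e,
   its left endpoint excluded. *)
Definition edge_points (e : nat * nat) : nat :=
  #|[pred p : 'I_e.1.+1 * 'I_e.2.+1 |
      ((p.1 : nat, p.2 : nat) != (0, 0)) && (p.1 * e.2 == p.2 * e.1)]|%N.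

Definition bcoef (R : realType) (r : R) (k : nat) : R :=
  (\prod_(i < k) (r + i%:R)) / (k`!)%:R.

Definition bweight (R : realType) (r : R) (G : polyline) : R :=
  \prod_(e <- G) bcoef r (edge_points e).

Definition Pn (R : realType) (n : nat * nat) (r : R) (G : polyline) : R :=
  bweight r G / \sum_(G' \in Pi_lines R n) bweight r G'.

Definition Pmix (R : realType) (rho : probability (measurableTypeR R) R)
    (n : nat * nat) (G : polyline) : \bar R :=
  (\int[rho]_(r in `]0%R, +oo[) (Pn n r G)%:E)%E.

Definition Pmix_event (R : realType) (rho : probability (measurableTypeR R) R)
    (n : nat * nat) (A : set polyline) : \bar R :=
  (\sum_(G \in Pi_lines R n `&` A) Pmix rho n G)%E.

Definition scaled_edges (R : realType) (n : nat * nat) (G : polyline)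
    : seq (R * R) :=
  [seq (e.1%:R / n.1%:R, e.2%:R / n.2%:R) | e <- G].

(* The slopes increase along the scaled line, so the edges of slope at most t
   form an initial part of it, whose right endpoint is the sum of its edges. *)
Definition xi (R : realType) (n : nat * nat) (G : polyline) (t : \bar R)
    : R * R :=
  \sum_(v <- scaled_edges R n G | (slope v <= t)%E) v.

Definition gamma_star (R : realType) : set (R * R) :=
  [set x | [/\ 0 <= x.1 <= 1, 0 <= x.2 <= 1 &
              Num.sqrt (1 - x.1) + Num.sqrt x.2 = 1]].

(* Only t in [0, +oo] is meant; the value at -oo is irrelevant. *)
Definition g_star (R : realType) (t : \bar R) : R * R :=
  if t is t'%:E then
    ((t' ^+ 2 + 2 * t') / (1 + t') ^+ 2, t' ^+ 2 / (1 + t') ^+ 2)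
  else (1, 1).

(* The norm of the library on R * R is the sup norm. *)
Definition euclidean_dist (R : realType) (x y : R * R) : R :=
  Num.sqrt ((x.1 - y.1) ^+ 2 + (x.2 - y.2) ^+ 2).

Definition tangential_dist (R : realType) (n : nat * nat) (G : polyline)
    : \bar R :=
  ereal_sup [set (euclidean_dist (xi n G t) (g_star t))%:E
            | t in [set t : \bar R | (0 <= t)%E]].

Definition to_infty (R : realType) (c1 c2 : R) : set_system (nat * nat) :=
  within [set n | c1 <= n.2%:R / n.1%:R <= c2] (filter_prod \oo \oo).

Lemma g_star_gamma_star (R : realType) (t : \bar R) :
  (0 <= t)%E -> gamma_star (g_star t).
Proof.
case: t => [t||] //= t0; last first.
  by split=> /=; rewrite ?subrr ?sqrtr0 ?sqrtr1 ?add0r ?ler01 ?lexx.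
move: t0; rewrite lee_fin => t0.
have p : 0 < 1 + t by rewrite ltr_pwDl.
have p2 : 0 < (1 + t) ^+ 2 by rewrite exprn_gt0.
have E : 1 - (t ^+ 2 + 2 * t) / (1 + t) ^+ 2 = ((1 + t)^-1) ^+ 2.
  by field; rewrite gt_eqF.
have E2 : t ^+ 2 / (1 + t) ^+ 2 = (t / (1 + t)) ^+ 2 by rewrite expr_div_n.
split => /=.
- apply/andP; split.
    by rewrite divr_ge0 ?addr_ge0 ?mulr_ge0 ?exprn_ge0// ltW.
  by rewrite -subr_ge0 E sqr_ge0.
- rewrite E2 sqr_ge0/= exprn_ile1// ?divr_ge0// ?(ltW p)//.
  by rewrite ler_pdivrMr// mul1r lerDr.
- rewrite E E2 !sqrtr_sqr !ger0_norm ?invr_ge0 ?divr_ge0 ?(ltW p)//.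
  by rewrite -{1}[(1 + t)^-1]mul1r -mulrDl divff ?gt_eqF.
Qed.

Lemma sum_pair (G : polyline) :
  \sum_(e <- G) e = (\sum_(e <- G) e.1, \sum_(e <- G) e.2)%N.
Proof. by elim: G => [|e G ih]; rewrite ?big_nil// !big_cons ih. Qed.

(* In particular the finitely supported sums over Pi_lines R n are genuine. *)
Lemma finite_Pi (R : realType) (n : nat * nat) : finite_set (Pi_lines R n).
Proof.
pose T := ((n.1 + n.2).-bseq ('I_n.1.+1 * 'I_n.2.+1))%type.
pose f (s : T) : polyline := 
  [seq (p.1 : nat, p.2 : nat) | p : 'I_n.1.+1 * 'I_n.2.+1 <- bseqval s].
apply: (@sub_finite_set _ _ (f @` [set: T])); last first.
  exact/finite_image/finite_finset.
move=> G [[nz _]]; rewrite sum_pair => En.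
have E1 : (\sum_(e <- G) e.1 = n.1)%N by rewrite -En.
have E2 : (\sum_(e <- G) e.2 = n.2)%N by rewrite -En.
have sz : (size G <= n.1 + n.2)%N.
  rewrite -E1 -E2 -big_split/= -sum1_size big_seq [leqRHS]big_seq.
  apply: leq_sum => -[a b] /(allP nz)/=.
  by rewrite xpair_eqE addn_gt0 !lt0n negb_and.
pose h (e : nat * nat) : 'I_n.1.+1 * 'I_n.2.+1 := (inord e.1, inord e.2).
have szh : (size (map h G) <= n.1 + n.2)%N by rewrite size_map.
exists (Bseq szh) => //; rewrite /f/= -map_comp; apply: map_id_in => e eG /=.
rewrite !inordK ?ltnS; first by case: e {eG}.
  by rewrite -E2 (big_rem e)//= leq_addr.
by rewrite -E1 (big_rem e)//= leq_addr.
Qed.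

(* Main.v *)
Require Import Defs.
From mathcomp Require Import all_boot all_order all_algebra.
From mathcomp Require Import all_classical all_reals all_analysis.
From mathcomp Require Import measurable_realfun.
From mathcomp Require Import ring lra.
Import Order.TTheory GRing.Theory Num.Theory.
Import numFieldNormedType.Exports.

Set Implicit Arguments.
Unset Strict Implicit.
Unset Printing Implicit Defensive.

Local Open Scope classical_set_scope.
Local Open Scope ring_scope.

(** The theorem rests on exponential bounds: the weights of all lines ending at
    n add up to exp(3 y + o(y)) for a scale y that tends to infinity with n, and
    the lines far from the parabola add up to at most exp(3 y - c y).

    A convex lattice polygonal line is the same as a multiplicity function on
    the primitive vectors: a direction is a primitive vector, and its
    multiplicity is the number of lattice points on the edge.  The weight b^r is
    then a product over directions of coefficients of the negative binomial
    series (1 - w)^-r, and summing b^r(Gamma) exp(- p . endpoint) over all lines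
    gives the product of (1 - exp(- p . x))^-r over the primitive x
    (generating_function).  Its logarithm is r times logsum, and the same holds
    for the directions of a cone C.

    As p tends to 0 within a sector, p.1 p.2 logsum C p tends to L V(p), where
    V(p) is the limit density of the cone and L > 0 is a constant
    (logsum_asymptotics).  For the sum over all lattice points of a cone this is
    a computation with geometric series (expsum_above_rate).  Every nonzero
    lattice point is in a unique way a multiple of a primitive one, and so
      sum_m logsum C (m p) = sum_k k^-1 expsum C (k p)      (logsum_multiples).
    Hence the deviation D(h) of the normalized logsum from its limit along a ray
    satisfies sum_m m^-2 D(m h) -> 0, and because the weights with m >= 2 sum to
    less than 1, D itself tends to 0 (contraction); this inverts the identity
    without the Moebius function.

    Let y be the cube root of r L n1 n2 and let p = (a1 y / n1, a2 y / n2).  Then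
    the logarithm of the generating function is close to y / (a1 a2)
    (near_logsum), while a line ending at n has p . n = (a1 + a2) y.

    Lower bound (near_total_weight_ge): for a1 = a2 slightly above 1 the tilted
    weight concentrates on lines that end slightly below n, and these are
    completed to lines ending at n by lengthening their horizontal and vertical
    edges, at polynomial cost.  The total weight of the lines ending at n is
    thus at least exp((3 - 22 d) y) for every small d > 0.

    Upper bound (near_deviation): give the edges of slope at most t the tilt
    (1 - s1, 1 - s2) and the others (1, 1).  With u = t / (1 + t), the logarithm
    of the generating function becomes y times
      1 - u + u / ((1 - s1) ((1 - u) (1 - s1) + u (1 - s2)))
        = 1 + s1 (2 u - u^2) + s2 u^2 + O(|s|^2),
    and (2 u - u^2, u^2) is the point g*(t) of the parabola.  By the exponential
    Chebyshev inequality the lines for which s . xi(t) exceeds s . g*(t) by a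
    multiple of |s|^2 have exponentially small relative weight.

    Since xi and g* are nondecreasing in t, finitely many slopes control the
    tangential distance (tangential_dist_grid), which proves the limit for each
    fixed r (near_far_weight).  As the probabilities are bounded by 1, dominated
    convergence carries it over to the mixture. *)

(** * Primitive vectors *)

Lemma coprime_multiples k l a b c d : (0 < k)%N -> (0 < l)%N ->
  coprime a b -> coprime c d -> (k * a = l * c)%N -> (k * b = l * d)%N ->
  [/\ k = l, a = c & b = d].
Proof.
move=> k0 l0 ab cd ea eb.
have kl : k = l.
  have : gcdn (k * a) (k * b) = gcdn (l * c) (l * d) by rewrite ea eb.
  by rewrite -!muln_gcdr (eqP ab) (eqP cd) !muln1.
move: ea eb; rewrite kl => /eqP; rewrite eqn_pmul2l// => /eqP-> /eqP.
by rewrite eqn_pmul2l// => /eqP->.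
Qed.

Lemma coprime_cross a b c d : coprime a b -> coprime c d ->
  (a * d = b * c)%N -> a = c /\ b = d.
Proof.
move=> ab cd h; split; apply/eqP; rewrite eqn_dvd; apply/andP; split.
- by rewrite -(Gauss_dvdr _ ab) -h dvdn_mulr.
- by rewrite -(Gauss_dvdl _ cd) h dvdn_mull.
- by rewrite -(Gauss_dvdr d (_ : coprime b a)) 1?coprime_sym// h dvdn_mulr.
- by rewrite -(Gauss_dvdl b (_ : coprime d c)) 1?coprime_sym// -h dvdn_mull.
Qed.

Lemma coprime_decomposition e : e != (0, 0)%N -> exists k c,
  [/\ (0 < k)%N, coprime c.1 c.2, e = (k * c.1, k * c.2)%N & k = gcdn e.1 e.2].
Proof.
case: e => a b; rewrite xpair_eqE negb_and -!lt0n => ab.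
have g0 : (0 < gcdn a b)%N by rewrite gcdn_gt0.
exists (gcdn a b), (a %/ gcdn a b, b %/ gcdn a b)%N.
have ea : (gcdn a b * (a %/ gcdn a b) = a)%N by rewrite mulnC divnK ?dvdn_gcdl.
have eb : (gcdn a b * (b %/ gcdn a b) = b)%N by rewrite mulnC divnK ?dvdn_gcdr.
split => //=; last by rewrite ea eb.
by rewrite /coprime -(eqn_pmul2l g0) muln_gcdr muln1 ea eb.
Qed.

(** * The negative binomial and logarithmic series *)

Section series.
Variable R : realType.
Implicit Types (r w q : R) (k K : nat).

Definition neglog w : R := - ln (1 - w).

Definition binomial_sum r K w : R := \sum_(k < K) bcoef r k * w ^+ k.

Lemma bcoef0 r : bcoef r 0 = 1.
Proof. by rewrite /bcoef big_ord0 fact0 divr1. Qed.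

Lemma bcoefS r k : k.+1%:R * bcoef r k.+1 = (r + k%:R) * bcoef r k.
Proof.
rewrite /bcoef big_ord_recr/= factS natrM.
have : k.+1%:R != 0 :> R by rewrite pnatr_eq0.
have : (k`!)%:R != 0 :> R by rewrite pnatr_eq0 -lt0n fact_gt0.
move: (k.+1%:R) (k`!%:R) => t f f0 t0; move: (\prod_(_ < _) _) => P.
by field; rewrite f0 t0.
Qed.

Lemma bcoef_gt0 r k : 0 < r -> 0 < bcoef r k.
Proof.
move=> r0; rewrite divr_gt0 ?ltr0n ?fact_gt0//.
by apply: prodr_gt0 => i _; rewrite ltr_pwDl.
Qed.

Lemma bcoef_ge0 r k : 0 < r -> 0 <= bcoef r k.
Proof. by move=> r0; apply/ltW/bcoef_gt0. Qed.

(** Turns the boundary term of the differential equation below into a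
    coefficient of exponent r + 1, which binomial_sum_cvg can bound. *)
Lemma bcoef_raise r k : (r + k%:R) * bcoef r k = r * bcoef (r + 1) k.
Proof.
rewrite /bcoef !mulrA; congr (_ / _).
transitivity (\prod_(i < k.+1) (r + i%:R)); first by rewrite big_ord_recr mulrC.
rewrite big_ord_recl/= addr0.
by congr (_ * _); apply: eq_bigr => i _; rewrite -addrA nat1r.
Qed.

(** The coefficients k b_k and (r + k) b_k of S' and w S' + r S are shifts of
    each other, so all but the last one cancel. *)
Lemma binomial_sum_deriv r K w :
  (1 - w) * (\sum_(k < K) (k%:R * bcoef r k) * w ^+ k.-1)
  = r * binomial_sum r K w - K%:R * bcoef r K * w ^+ K.-1 .
Proof.
rewrite /binomial_sum; case: K => [|K]; first by rewrite !big_ord0 !mul0r !mulr0 subr0.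
elim: K => [|K ih].
  by rewrite !big_ord1/= !mul0r bcoefS addr0 bcoef0 expr0 !mulr1 mulr0 subrr.
rewrite big_ord_recr/= mulrDr ih [in RHS]big_ord_recr/= (bcoefS r K.+1) [w ^+ K.+1]exprS.
ring.
Qed.

(** The derivative of (1 - w)^r S_K(w), up to sign: it is a single term
    because the partial sums nearly satisfy the equation (1 - w) S' = r S of
    (1 - w)^-r. *)
Lemma is_derive_binomial r K w : w < 1 ->
  is_derive w 1 (fun w => binomial_sum r K w * expR (r * ln (1 - w)))
    (- (K%:R * bcoef r K * w ^+ K.-1 * expR (r * ln (1 - w)) / (1 - w))).
Proof.
move=> w1; have d0 : 0 < 1 - w by rewrite subr_gt0.
pose p : {poly R} := \poly_(k < K) bcoef r k.
have pE x : p.[x] = binomial_sum r K x.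
  by rewrite horner_poly.
have dp : p^`().[w] = \sum_(k < K) (k%:R * bcoef r k) * w ^+ k.-1.
  rewrite /p poly_def (raddf_sum (@deriv R)) horner_sum; apply: eq_bigr => k _.
  rewrite (_ : _.[w] = (bcoef r k *: 'X^k)^`().[w])//.
  by rewrite derivZ derivXn hornerZ hornerMn hornerXn -mulr_natr mulrCA mulrC (mulrC (bcoef r k)).
have dl : is_derive w 1 (@ln R \o (cst 1 - id)) ((1 - w)^-1 * (0 - 1)).
  by apply: is_derive1_comp; apply: is_derive1_ln.
have de : is_derive w 1 (expR \o (cst r * (@ln R \o (cst 1 - id))))
    (expR (r * ln (1 - w)) * (r *: ((1 - w)^-1 * (0 - 1)) + ln (1 - w) *: 0)).
  have := is_deriveM (is_derive_cst (r : R^o) w (1 : R)) dl.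
  by apply: (@is_derive1_comp _ expR); exact: is_derive_expR.
have dS := is_deriveM (is_derive_poly p w) de.
have -> : (fun w => binomial_sum r K w * expR (r * ln (1 - w)))
   = horner p * (expR \o (cst r * (@ln R \o (cst 1 - id)))).
  by apply/funext => x /=; rewrite -pE.
apply: is_derive_eq; rewrite dp pE /=.
have := binomial_sum_deriv r K w.
move: (\sum_(_ < _) _) (binomial_sum _ _ _) => s1 s2 h.
rewrite /GRing.scale/=.
have {h} -> : s1 = (r * s2 - K%:R * bcoef r K * w ^+ K.-1) / (1 - w).
  by rewrite -h mulrC mulKf// gt_eqF.
by field; rewrite gt_eqF.
Qed.

Lemma continuous_binomial r K w : 0 <= w < 1 ->
  {within `[0, w], continuous (fun w => binomial_sum r K w * expR (r * ln (1 - w)))}.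
Proof.
move=> /andP[w0 w1]; apply/derivable_within_continuous => x.
rewrite in_itv/= => /andP[_ xw].
by case: (is_derive_binomial r K (le_lt_trans xw w1)).
Qed.

(** The mean value theorem on [0, w] for (1 - w)^r times the partial sum, which
    is 1 at 0. *)
Lemma binomial_defect r K w : 0 <= w < 1 ->
  exists2 c, 0 <= c <= w &
  1 - binomial_sum r K.+1 w * expR (r * ln (1 - w))
    = K.+1%:R * bcoef r K.+1 * c ^+ K * expR (r * ln (1 - c)) / (1 - c) * w.
Proof.
move=> w01; have /andP[w0 w1] := w01.
have [|c] := @MVT_segment _ _
  (fun w => - (K.+1%:R * bcoef r K.+1 * w ^+ K * expR (r * ln (1 - w)) / (1 - w)))
  0 w w0 _ (@continuous_binomial r K.+1 w w01).
- by move=> x; rewrite in_itv/= => /andP[_ xw]; apply/is_derive_binomial/(lt_trans xw).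
rewrite in_itv/= => /andP[c0 cw]; rewrite subr0 ln1 mulr0 expR0 mulr1.
have -> : binomial_sum r K.+1 0 = 1.
  rewrite /binomial_sum big_ord_recl expr0 bcoef0 mulr1 big1 ?addr0// => i _.
  by rewrite exprS mul0r mulr0.
move=> h; exists c; first by rewrite c0.
by rewrite -opprB h subr0 mulNr opprK.
Qed.

Lemma binomial_sum_ge0 r K w : 0 < r -> 0 <= w -> 0 <= binomial_sum r K w.
Proof.
by move=> r0 w0; apply: sumr_ge0 => k _; rewrite mulr_ge0 ?bcoef_ge0 ?exprn_ge0.
Qed.

(** The derivative of (1 - w)^r S_K(w) is nonpositive, so its values stay below
    its value 1 at 0. *)
Lemma binomial_sum_le r K w : 0 < r -> 0 <= w < 1 ->
  binomial_sum r K w <= expR (r * neglog w).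
Proof.
move=> r0 w01; have /andP[w0 w1] := w01.
have : binomial_sum r K w <= binomial_sum r K.+1 w.
  by rewrite /binomial_sum big_ord_recr/= lerDl mulr_ge0 ?bcoef_ge0 ?exprn_ge0.
move=> /le_trans; apply.
have [c /andP[c0 cw] h] := binomial_defect r K w01.
rewrite /neglog mulrN expRN -[leLHS]mulr1 -(@ler_pM2r _ (expR (r * ln (1 - w)))) ?expR_gt0//.
rewrite mulr1 mulVf ?gt_eqF ?expR_gt0// -subr_ge0 h.
have c1 : 0 < 1 - c by rewrite subr_gt0 (le_lt_trans cw).
rewrite mulr_ge0// divr_ge0 ?(ltW c1)//.
by do 3 rewrite mulr_ge0 ?expR_ge0 ?exprn_ge0 ?bcoef_ge0 ?ler0n//.
Qed.

(** Newton's series (1 - w)^-r = sum_k b_k w^k.  The term that remains in the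
    derivative is r b_K^(r+1) w^K, and a convergent series of exponent r + 1 at
    some q > w makes it decay like (w / q)^K. *)
Lemma binomial_sum_cvg r w : 0 < r -> 0 <= w < 1 ->
  binomial_sum r K w @[K --> \oo] --> expR (r * neglog w).
Proof.
move=> r0 w01; have /andP[w0 w1] := w01.
pose q := (w + 1) / 2.
have q01 : 0 < q < 1 by rewrite /q; apply/andP; split; lra.
have /andP[q0 q1] := q01.
have wq : w < q by rewrite /q; lra.
pose D := r * expR ((r + 1) * neglog q) / (1 - w).
have key K : `|expR (r * neglog w) - binomial_sum r K.+1 w|
    <= expR (r * neglog w) * (D * (w / q) ^+ K).
  have [c /andP[c0 cw] h] := binomial_defect r K w01.
  rewrite ger0_norm ?subr_ge0 ?binomial_sum_le//.
  have -> : expR (r * neglog w) - binomial_sum r K.+1 w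
      = expR (r * neglog w) * (1 - binomial_sum r K.+1 w * expR (r * ln (1 - w))).
    by rewrite /neglog mulrN expRN; field; rewrite expR_eq0.
  rewrite ler_pM2l ?expR_gt0//.
  rewrite [leLHS]h {h} bcoefS bcoef_raise.
  have c1 : c < 1 by apply: le_lt_trans w1.
  have cp : 0 < 1 - c by rewrite subr_gt0.
  have b1 : expR (r * ln (1 - c)) <= 1.
    by rewrite -[leRHS]expR0 ler_expR mulr_ge0_le0 ?(ltW r0)// ln_le0 ?gerBl.
  have b2 : (1 - c)^-1 <= (1 - w)^-1 by rewrite lef_pV2 ?posrE ?subr_gt0// lerB.
  have b3 : bcoef (r + 1) K * c ^+ K <= expR ((r + 1) * neglog q) * (w / q) ^+ K.
    apply: (@le_trans _ _ (bcoef (r + 1) K * q ^+ K * (w / q) ^+ K)).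
      rewrite -mulrA ler_pM2l ?bcoef_gt0 ?addr_gt0// -exprMn mulrC.
      by rewrite divfK ?gt_eqF// lerXn2r.
    apply: ler_wpM2r; first by rewrite exprn_ge0// divr_ge0 ?(ltW q0).
    have r1 : 0 < r + 1 by rewrite addr_gt0.
    have q2 : 0 <= q < 1 by rewrite q1 ltW.
    apply: le_trans (binomial_sum_le K.+1 r1 q2).
    rewrite /binomial_sum big_ord_recr/= lerDr.
    exact: (binomial_sum_ge0 _ r1 (ltW q0)).
  have b4 : 0 <= bcoef (r + 1) K * c ^+ K.
    by rewrite mulr_ge0 ?exprn_ge0// bcoef_ge0// addr_gt0.
  have b5 := expR_ge0 (r * ln (1 - c)).
  have b6 : 0 <= (1 - c)^-1 by rewrite invr_ge0 ltW.
  rewrite /D; move: b3 b4; set B := _ * c ^+ K; set B' := _ * (w / q) ^+ K => b3 b4.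
  have -> : r * bcoef (r + 1) K * c ^+ K * expR (r * ln (1 - c)) / (1 - c) * w
    = r * (B * (expR (r * ln (1 - c)) * ((1 - c)^-1 * w))) by rewrite /B; ring.
  have -> : r * expR ((r + 1) * neglog q) / (1 - w) * (w / q) ^+ K
    = r * (B' * (1 * ((1 - w)^-1 * 1))) by rewrite /B'; ring.
  rewrite ler_pM2l//; apply: ler_pM => //; first by rewrite !mulr_ge0.
  apply: ler_pM => //; first by rewrite !mulr_ge0.
  by apply: ler_pM => //; exact: ltW.
have wq1 : `|w / q| < 1.
  rewrite ger0_norm; last by rewrite divr_ge0// ltW.
  by rewrite ltr_pdivrMr// mul1r.
rewrite -cvg_shiftS; apply/cvgrPdist_le => e e0.
have /cvgrPdist_le/(_ e e0) := cvg_geometric (expR (r * neglog w) * D) wq1.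
apply: filterS => K /=; rewrite sub0r normrN /geometric/= -mulrA => /(le_trans _); apply.
by apply: le_trans (key K) _; exact: ler_norm.
Qed.

(** The difference of - ln (1 - w) and its partial sum vanishes at 0 and has the
    derivative w^K / (1 - w). *)
Lemma neglog_defect K w : 0 <= w < 1 ->
  exists2 c, 0 <= c <= w &
  neglog w - \sum_(k < K) w ^+ k.+1 / k.+1%:R = c ^+ K / (1 - c) * w.
Proof.
move=> /andP[w0 w1].
pose p : {poly R} := \sum_(k < K) (k.+1%:R^-1 *: 'X^(k.+1)).
have pE x : p.[x] = \sum_(k < K) x ^+ k.+1 / k.+1%:R.
  rewrite horner_sum; apply: eq_bigr => k _.
  by rewrite hornerZ hornerXn mulrC.
have dp x : p^`().[x] = \sum_(k < K) x ^+ k.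
  rewrite /p (raddf_sum (@deriv R)) horner_sum; apply: eq_bigr => k _.
  rewrite (_ : _.[x] = (k.+1%:R^-1 *: 'X^(k.+1))^`().[x])//.
  rewrite derivZ derivXn hornerZ hornerMn hornerXn/= -(mulr_natr (x ^+ k)) mulrCA mulVf ?mulr1 ?pnatr_eq0//.
pose f := - (@ln R \o (cst 1 - id)) - horner p.
have df (x : R) : x < 1 -> is_derive x 1 f (x ^+ K / (1 - x)).
  move=> x1; have d0 : 0 < 1 - x by rewrite subr_gt0.
  have dl : is_derive x 1 (@ln R \o (cst 1 - id)) ((1 - x)^-1 * (0 - 1)).
    by apply: is_derive1_comp; apply: is_derive1_ln.
  apply: is_derive_eq; rewrite dp.
  have -> : x ^+ K = (x - 1) * (\sum_(k < K) x ^+ k) + 1 by rewrite -subrX1 subrK.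
  by field; rewrite gt_eqF.
have [x||c] := @MVT_segment _ f (fun x => x ^+ K / (1 - x)) 0 w w0.
- by rewrite in_itv/= => /andP[_ xw]; apply/df/(lt_trans xw).
- apply/derivable_within_continuous => {}x; rewrite in_itv/= => /andP[_ xw].
  by case: (df _ (le_lt_trans xw w1)).
rewrite in_itv/= => /andP[c0 cw].
have E y : f y
    = neglog y - \sum_(k < K) y ^+ k.+1 / k.+1%:R by rewrite -pE.
have f0 : f 0 = 0.
  rewrite E /neglog subr0 ln1 oppr0 big1 ?subr0// => k _.
  by rewrite exprS !mul0r.
have wB : w - 0 = w by rewrite subr0.
rewrite f0 E wB subr0 => h.
by exists c => //; rewrite c0.
Qed.

Lemma neglog_series w : 0 <= w < 1 ->
  (fun K => \sum_(k < K) w ^+ k.+1 / k.+1%:R) @ \oo --> neglog w.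
Proof.
move=> w01; have /andP[w0 w1] := w01.
have w1' : `|w| < 1 by rewrite ger0_norm.
apply/cvgrPdist_le => e e0.
have /cvgrPdist_le/(_ e e0) := cvg_geometric ((1 - w)^-1) w1'.
apply: filterS => K /=; rewrite sub0r normrN /geometric/= => /(le_trans _); apply.
have [c /andP[c0 cw] ->] := neglog_defect K w01.
have c1 : 0 < 1 - c by rewrite subr_gt0 (le_lt_trans cw).
have b0 : 0 <= (1 - c)^-1 by rewrite invr_ge0 ltW.
apply: le_trans (ler_norm _); rewrite ger0_norm; last first.
  by rewrite !mulr_ge0 ?exprn_ge0.
rewrite mulrAC mulrC; apply: ler_pM => //; first by rewrite mulr_ge0 ?exprn_ge0.
  by rewrite lef_pV2 ?posrE ?(subr_gt0 w)// lerB.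
rewrite -[leRHS]mulr1; apply: ler_pM => //; [exact: exprn_ge0| |exact: ltW].
by rewrite lerXn2r.
Qed.

End series.

(** * Exponential sums over the lattice points of a cone *)

Section esum_complements.
Variable R : realType.

Lemma esumZl (T : choiceType) (I : set T) (a : T -> \bar R) (r : R) :
  0 < r -> (forall i, 0 <= a i)%E ->
  (\esum_(i in I) (r%:E * a i) = r%:E * \esum_(i in I) a i)%E.
Proof.
have le (s : R) (b : T -> \bar R) : 0 < s -> (forall i, 0 <= b i)%E ->
  (\esum_(i in I) (s%:E * b i) <= s%:E * \esum_(i in I) b i)%E.
  move=> s0 b0; apply: ge_ereal_sup => _ [X [finX XI] <-].
  rewrite -ge0_mule_fsumr//.
  by apply: lee_wpmul2l; [rewrite lee_fin ltW|apply: ereal_sup_ubound; exists X].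
move=> r0 a0; apply/eqP; rewrite eq_le le//=.
have rI : (r^-1%:E * (r%:E * \esum_(i in I) a i) <= r^-1%:E * \esum_(i in I) (r%:E * a i))%E.
  rewrite muleA -EFinM mulVf ?gt_eqF// mul1e.
  rewrite (eq_esum (b := fun i => r^-1%:E * (r%:E * a i))%E).
    apply: le; first by rewrite invr_gt0.
    by move=> i; rewrite mule_ge0 ?a0// lee_fin ltW.
  by move=> i Ii; rewrite muleA -EFinM mulVf ?gt_eqF// mul1e.
by move: rI; rewrite lee_pmul2l// lte_fin invr_gt0.
Qed.

Lemma esum_EFinZl (T : choiceType) (I : set T) (a : T -> R) (r s : R) :
  0 <= r -> (forall i, 0 <= a i) -> \esum_(i in I) (a i)%:E = s%:E ->
  \esum_(i in I) (r * a i)%:E = (r * s)%:E.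
Proof.
rewrite le_eqVlt => /predU1P[<-|r0] a0 E.
  by rewrite mul0r esum1// => i _; rewrite mul0r.
rewrite EFinM -E -esumZl//.
Qed.

Lemma subset_esum (T : choiceType) (I J : set T) (a : T -> \bar R) :
  I `<=` J -> (\esum_(i in I) a i <= \esum_(i in J) a i)%E.
Proof.
move=> IJ; apply: ge_ereal_sup => _ [X [finX XI] <-].
by apply: ereal_sup_ubound; exists X => //; split=> // x /XI/IJ.
Qed.

Lemma esum_geometric (q : R) : 0 < q ->
  \esum_(k in [set: nat]) (expR (- (q * k%:R)))%:E = ((1 - expR (- q))^-1)%:E.
Proof.
move=> q0; rewrite -nneseries_esumT; last by move=> n; rewrite lee_fin expR_ge0.
have q1 : `|expR (- q)| < 1 by rewrite ger0_norm ?expR_ge0// expR_lt1 oppr_lt0.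
apply/cvg_lim => //.
have := @cvg_geometric_series R 1 _ q1; rewrite mul1r => h.
have -> : (fun n => (\sum_(0 <= k < n) (expR (- (q * k%:R)))%:E)%E) =
    EFin \o series (geometric 1 (expR (- q))).
  apply/funext => n /=; rewrite sumEFin; congr (_%:E).
  by apply: eq_bigr => k _; rewrite /geometric/= mul1r -expRM_natl mulrN mulrC.
by apply: cvg_EFin => //; exact: nearW.
Qed.

End esum_complements.

Section lattice_sums.
Variable R : realType.
Implicit Types (p : R * R) (q t : R) (x : nat * nat).

Definition dotp p x : R := p.1 * x.1%:R + p.2 * x.2%:R.

Definition expsum (C : set (nat * nat)) p : \bar R :=
  \esum_(x in C `\ (0, 0)%N) (expR (- dotp p x))%:E.

(** The quadrant points strictly above the ray of slope t. *)
Definition above t : set (nat * nat) := [set x | t * x.1%:R < x.2%:R].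

Lemma esum_quadrant p : 0 < p.1 -> 0 < p.2 ->
  \esum_(x in setT) (expR (- dotp p x))%:E
  = ((1 - expR (- p.1))^-1 * (1 - expR (- p.2))^-1)%:E.
Proof.
move=> p1 p2.
have -> : [set: nat * nat] = setT `*`` (fun _ => setT) by apply/seteqP.
rewrite -(esum_esum (a := fun i j => (expR (- dotp p (i, j)))%:E)); last first.
  by move=> i j _ _; rewrite lee_fin expR_ge0.
rewrite mulrC -(esum_EFinZl _ _ (esum_geometric p1)); last 2 first.
- by rewrite invr_ge0 subr_ge0 expR_le1 oppr_le0 ltW.
- by move=> i; rewrite expR_ge0.
apply: eq_esum => i _; rewrite mulrC -(esum_EFinZl _ _ (esum_geometric p2)) ?expR_ge0//.
by apply: eq_esum => j _; rewrite -expRD -opprD.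
Qed.

(** In the column of abscissa i the points start at the least integer k i above
    t i.  Replacing k i by t i makes the sum a product of two geometric series,
    and t i < k i <= t i + 1 costs at most the factor exp(- p.2). *)
Lemma esum_above t p S : 0 <= t -> 0 < p.1 -> 0 < p.2 ->
  S = (1 - expR (- p.2))^-1 * (1 - expR (- (p.1 + t * p.2)))^-1 ->
  ((expR (- p.2) * S)%:E <= expsum (above t) p <= S%:E)%E.
Proof.
move=> t0 p1 p2 SE.
pose k (i : nat) := (Num.truncn (t * i%:R)).+1.
have kP i : t * i%:R < (k i)%:R /\ (k i)%:R <= t * i%:R + 1.
  have := truncn_itv (mulr_ge0 t0 (ler0n R i)); rewrite /k => /andP[h1 h2].
  by split => //; rewrite -natr1 lerD2r.
have e : expsum (above t) p = \esum_(i in setT)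
   (((1 - expR (- p.2))^-1 * expR (- p.2 * (k i)%:R)) * expR (- (p.1 * i%:R)))%:E.
  rewrite /expsum.
  have -> : above t `\ (0,0)%N = setT `*`` (fun i => addn (k i) @` setT).
    have ki i j : (k i <= j)%N = (t * i%:R < j%:R) by rewrite truncn_lt_nat ?mulr_ge0.
    apply/seteqP; split => [[i j] [/= h _]|[i j] [_ [l _ /= <-]]].
      by split => //; exists (j - k i)%N => //; rewrite subnKC// ki.
    split; first by rewrite /above/= -ki leq_addr.
    by move=> -[_]; rewrite /k addSn.
  rewrite -(esum_esum (a := fun i j => (expR (- dotp p (i, j)))%:E)); last first.
    by move=> i j _ _; rewrite lee_fin expR_ge0.
  apply: eq_esum => i _; rewrite esum_image; last by move=> a b _ _; exact: addnI.
  rewrite -mulrA [X in _ = X%:E]mulrC -(esum_EFinZl _ _ (esum_geometric p2)); last 2 first.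
  - by rewrite mulr_ge0 ?expR_ge0.
  - by move=> j; rewrite expR_ge0.
  apply: eq_esum => j _; rewrite -!expRD /dotp/= natrD; congr (expR _)%:E.
  ring.
have q0 : 0 < p.1 + t * p.2 by rewrite ltr_pwDl// mulr_ge0// ltW.
have c0 : 0 <= (1 - expR (- p.2))^-1 by rewrite invr_ge0 subr_ge0 expR_le1 oppr_le0 ltW.
have E i : expR (- p.2 * (t * i%:R)) * expR (- (p.1 * i%:R)) = expR (- ((p.1 + t * p.2) * i%:R)).
  by rewrite -expRD; congr expR; ring.
rewrite e; apply/andP; split.
  rewrite SE mulrA -(esum_EFinZl _ _ (esum_geometric q0)); last 2 first.
  - by rewrite mulr_ge0 ?expR_ge0.
  - by move=> i; rewrite expR_ge0.
  apply: le_esum => i _; rewrite lee_fin -E mulrA ler_wpM2r ?expR_ge0//.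
  rewrite [expR (- p.2) * _]mulrC -mulrA ler_wpM2l// -expRD ler_expR.
  rewrite !mulNr -opprD lerN2 -[X in X + _]mulr1 -mulrDr ler_wpM2l ?(ltW p2)//.
  by rewrite (addrC 1); case: (kP i).
rewrite SE -(esum_EFinZl _ _ (esum_geometric q0))//.
apply: le_esum => i _; rewrite lee_fin -E mulrA ler_wpM2r ?expR_ge0//.
rewrite ler_wpM2l// ler_expR !mulNr lerN2 ler_wpM2l ?(ltW p2)//.
by apply/ltW; case: (kP i).
Qed.

Lemma expsum_fin C p : 0 < p.1 -> 0 < p.2 -> expsum C p \is a fin_num.
Proof.
move=> p1 p2; rewrite ge0_fin_numE; last first.
  by apply: esum_ge0 => x _; rewrite lee_fin expR_ge0.
apply: (@le_lt_trans _ _ (\esum_(x in setT) (expR (- dotp p x))%:E)%E).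
  exact: subset_esum.
by rewrite esum_quadrant// ltry.
Qed.

Lemma expsumT p : 0 < p.1 -> 0 < p.2 ->
  fine (expsum setT p) = (1 - expR (- p.1))^-1 * (1 - expR (- p.2))^-1 - 1.
Proof.
move=> p1 p2; apply: EFin_inj; rewrite fineK ?expsum_fin//.
rewrite EFinB -esum_quadrant// (esumID [set (0, 0)%N] setT) ?setTI; last first.
  by move=> x _; rewrite lee_fin expR_ge0.
have -> : 1%:E = \esum_(x in [set (0, 0)%N]) (expR (- dotp p x))%:E.
  by rewrite esum_set1 ?lee_fin ?expR_ge0// /dotp/= !mulr0 addr0 oppr0 expR0.
rewrite /expsum setDE setTI addeAC subee ?add0e//.
by rewrite esum_set1 ?lee_fin ?expR_ge0.
Qed.

Lemma expsumC C p : 0 < p.1 -> 0 < p.2 ->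
  fine (expsum (~` C) p) = fine (expsum setT p) - fine (expsum C p).
Proof.
move=> p1 p2; apply: EFin_inj; rewrite EFinB !fineK ?expsum_fin//.
have -> : expsum setT p = (expsum C p + expsum (~` C) p)%E.
  rewrite /expsum (esumID C); last by move=> x _; rewrite lee_fin expR_ge0.
  by congr (_ + _)%E; congr esum; rewrite !setDE setTI setIC.
by rewrite addeAC subee ?add0e// expsum_fin.
Qed.

Lemma inv_1expRN_itv q : 0 < q -> 1 <= q * (1 - expR (- q))^-1 <= 1 + q.
Proof.
move=> q0; have d0 : 0 < 1 - expR (- q) by rewrite subr_gt0 expR_lt1 oppr_lt0.
rewrite ler_pdivlMr// mul1r ler_pdivrMr//; apply/andP; split.
  by have := expR_ge1Dx (- q); lra.
have := expR_ge1Dx q; have := expRxMexpNx_1 q; have := expR_gt0 (- q).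
move: (expR q) (expR (- q)) => a b; nra.
Qed.

(** A region of the quadrant that is a union of rays, with the limit V of its
    normalized exponential sums and a rate valid at every scale.  The constant 3
    is what the complement of a cone needs: 1 for the quadrant and 2 for the
    cone above a ray. *)
Definition has_density (C : set (nat * nat)) (V : R * R -> R) : Prop :=
  [/\ forall m x, C (m.+1 * x.1, m.+1 * x.2)%N <-> C x,
      forall p h, 0 < h -> V (h * p.1, h * p.2) = V p,
      forall p, 0 < p.1 -> 0 < p.2 -> 0 <= V p <= 1 &
      forall p, 0 < p.1 -> 0 < p.2 ->
        `|p.1 * p.2 * fine (expsum C p) - V p| <= 3 * (p.1 + p.2)].

Lemma expsum_ge0 C p : 0 <= fine (expsum C p).
Proof. by apply/fine_ge0/esum_ge0 => x _; rewrite lee_fin expR_ge0. Qed.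

Lemma expsum_le_T C p : 0 < p.1 -> 0 < p.2 ->
  fine (expsum C p) <= fine (expsum setT p).
Proof.
move=> p1 p2; rewrite fine_le ?expsum_fin//.
by apply: subset_esum => x []; split.
Qed.

Lemma expsumT_rate p : 0 < p.1 -> 0 < p.2 ->
  `|p.1 * p.2 * fine (expsum setT p) - 1| <= p.1 + p.2.
Proof.
move=> p1 p2; have := expsum_ge0 setT p; rewrite expsumT//.
have /andP[] := inv_1expRN_itv p1; have /andP[] := inv_1expRN_itv p2.
set a := (_ - _)^-1; set b := (_ - _)^-1 => b1 b2 a1 a2 h.
have : 0 <= p.1 * p.2 * (b * a - 1) by rewrite mulr_ge0// mulr_ge0// ltW.
have -> : p.1 * p.2 * (b * a - 1) = (p.1 * b) * (p.2 * a) - p.1 * p.2 by ring.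
move: (p.1 * b) (p.2 * a) b1 b2 a1 a2 => x y; rewrite ler_norml => *.
by apply/andP; split; nra.
Qed.

(** For small p the closed form decides; when both coordinates exceed 1 the
    product p.1 * p.2 is no longer of the size of the rate, and the bound by
    the sum over the whole quadrant takes over. *)
Lemma expsum_above_rate t p : 0 <= t -> 0 < p.1 -> 0 < p.2 ->
  `|p.1 * p.2 * fine (expsum (above t) p) - p.1 / (p.1 + t * p.2)|
    <= 2 * (p.1 + p.2).
Proof.
move=> t0 p1 p2; have q0 : 0 < p.1 + t * p.2 by rewrite ltr_pwDl// mulr_ge0// ltW.
have := esum_above t0 p1 p2 erefl.
rewrite -[X in (_ <= X <= _)%E]fineK ?expsum_fin// !lee_fin.
have := expsum_le_T (above t) p1 p2; have := expsumT_rate p1 p2.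
have /andP[] := inv_1expRN_itv q0; have /andP[] := inv_1expRN_itv p2.
have eb : expR (- p.2) * (1 - expR (- p.2))^-1 = (1 - expR (- p.2))^-1 - 1.
  have d0 : 1 - expR (- p.2) != 0 by rewrite gt_eqF// subr_gt0 expR_lt1 oppr_lt0.
  by field.
rewrite mulrA eb.
set b := (_ - _)^-1; set c := (_ - _)^-1; set q := p.1 + _.
set Y := fine _; set X := fine _ => b1 b2 c1 c2 YT XY /andP[X1 X2].
pose w := p.1 / q.
have w0 : 0 <= w by rewrite divr_ge0 ?ltW.
have w1 : w <= 1 by rewrite ler_pdivrMr// mul1r lerDl mulr_ge0// ltW.
have wq : w * q = p.1 by rewrite divfK// gt_eqF.
have p12 : 0 < p.1 * p.2 by rewrite mulr_gt0.
have E1 : p.1 * p.2 * (b * c) = w * (p.2 * b) * (q * c).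
  by rewrite -wq; ring.
have E2 : p.1 * p.2 * ((b - 1) * c) = w * (p.2 * b - p.2) * (q * c).
  by rewrite -wq; ring.
rewrite -/w ler_norml; apply/andP; split.
  have : p.1 * p.2 * ((b - 1) * c) <= p.1 * p.2 * X by rewrite ler_pM2l.
  rewrite E2; have : w * (p.2 * b - p.2) <= w * (p.2 * b - p.2) * (q * c).
    rewrite ler_peMr// mulr_ge0//.
    rewrite -[X in _ - X]mulr1 -mulrBr mulr_ge0 ?(ltW p2)//.
    by rewrite -eb mulr_ge0 ?expR_ge0// invr_ge0 subr_ge0 expR_le1 oppr_le0 ltW.
  have : w * (p.2 * b - p.2) >= w * (1 - p.2) by rewrite ler_wpM2l// lerB.
  have : w * p.2 <= p.2 by rewrite ler_piMl// ltW.
  by rewrite mulrBr mulr1; lra.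
have U1 : p.1 * p.2 * X <= w * (1 + p.2) * (1 + q).
  apply: (@le_trans _ _ (w * (p.2 * b) * (q * c))).
    by rewrite -E1 ler_pM2l.
  apply: ler_pM => //; [|lra|exact: ler_wpM2l].
  by rewrite mulr_ge0//; lra.
have U2 : p.1 * p.2 * X <= 1 + p.1 + p.2.
  have : p.1 * p.2 * X <= p.1 * p.2 * Y by rewrite ler_pM2l.
  by move: YT; rewrite ler_norml => /andP[_]; lra.
have U3 : w * (1 + p.2) * (1 + q) = w + p.1 + w * p.2 + p.1 * p.2.
  by rewrite -wq; ring.
have wp : w * p.2 <= p.2 by rewrite ler_piMl// ltW.
move: U1; rewrite U3 => U1.
have [p11|p11] := leP p.1 1; last have [p21|p21] := leP p.2 1.
- have : p.1 * p.2 <= p.2 by rewrite ler_piMl// ltW.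
  by lra.
- have : p.1 * p.2 <= p.1 by rewrite ler_piMr// ltW.
  by lra.
- by lra.
Qed.

Lemma has_densityT : has_density setT (fun=> 1).
Proof.
split=> // [_ _ _|p p1 p2]; first by rewrite ler01 lexx.
by apply: le_trans (expsumT_rate p1 p2) _; lra.
Qed.

Definition above_density t p : R := p.1 / (p.1 + t * p.2).

Lemma above_density_itv t p : 0 <= t -> 0 < p.1 -> 0 < p.2 ->
  0 <= above_density t p <= 1.
Proof.
move=> t0 p1 p2; have q0 : 0 < p.1 + t * p.2 by rewrite ltr_pwDl// mulr_ge0// ltW.
rewrite /above_density; apply/andP; split; first by rewrite divr_ge0 ?ltW.
by rewrite ler_pdivrMr// mul1r lerDl mulr_ge0// ltW.
Qed.

Lemma above_densityZ t p h : 0 < h -> above_density t (h * p.1, h * p.2) = above_density t p.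
Proof.
move=> h0; rewrite /above_density/= mulrCA -mulrDr invfM mulrACA mulfV ?mul1r//.
by rewrite gt_eqF.
Qed.

Lemma aboveZ t m x : above t (m.+1 * x.1, m.+1 * x.2)%N <-> above t x.
Proof. by rewrite /above/= !natrM mulrCA ltr_pM2l. Qed.

Lemma has_density_above t : 0 <= t -> has_density (above t) (above_density t).
Proof.
move=> t0; split=> [||p p1 p2|p p1 p2].
- exact: aboveZ.
- by move=> p h h0; exact: above_densityZ.
- exact: above_density_itv.
- by apply: le_trans (expsum_above_rate t0 p1 p2) _; lra.
Qed.

Lemma has_density_below t : 0 <= t ->
  has_density (~` above t) (fun p => 1 - above_density t p).
Proof.
move=> t0; split=> [m x|p h h0|p p1 p2|p p1 p2].
- by rewrite /setC/=; split; apply: contra_not => /aboveZ; apply.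
- by rewrite above_densityZ.
- by have := above_density_itv t0 p1 p2; lra.
- rewrite expsumC//; have := expsumT_rate p1 p2; have := expsum_above_rate t0 p1 p2.
  rewrite !ler_norml -/(above_density t p) mulrBr; lra.
Qed.

End lattice_sums.

(** * From all lattice points to primitive ones *)

Section primitive_sums.
Variable R : realType.
Implicit Types (p : R * R) (C : set (nat * nat)) (x : nat * nat) (h : R).

Definition primitive : set (nat * nat) := [set x | coprime x.1 x.2].

Definition scale h p : R * R := (h * p.1, h * p.2).

(** The logarithm of the product of (1 - exp(- p . x))^-1 over the primitive
    vectors x of C. *)
Definition logsum C p : \bar R :=
  \esum_(x in C `&` primitive) (neglog (expR (- dotp p x)))%:E.

Lemma dotp_scale h p x : dotp (scale h p) x = h * dotp p x.
Proof. by rewrite /dotp/= mulrDr !mulrA. Qed.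

Lemma dotp_mul p (m : nat) x : dotp p (m * x.1, m * x.2)%N = m%:R * dotp p x.
Proof. by rewrite /dotp/= !natrM; ring. Qed.

Lemma dotp_gt0 p x : 0 < p.1 -> 0 < p.2 -> x != (0, 0)%N -> 0 < dotp p x.
Proof.
move=> p1 p2; case: x => a b; rewrite xpair_eqE negb_and -!lt0n /dotp/=.
by case/orP => h; [rewrite ltr_pwDl|rewrite ltr_wpDl];
  rewrite ?mulr_gt0 ?mulr_ge0 ?ltr0n// ltW.
Qed.

Lemma primitive_neq0 x : primitive x -> x != (0, 0)%N.
Proof. by apply: contraTneq => ->. Qed.

Lemma neglog_ge0 (w : R) : 0 <= w -> 0 <= neglog w.
Proof. by move=> w0; rewrite oppr_ge0 ln_le0// gerBl. Qed.

Lemma exchange_esum (T1 T2 : choiceType) (I : set T1) (J : set T2)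
    (a : T1 -> T2 -> \bar R) : (forall i j, 0 <= a i j)%E ->
  \esum_(i in I) \esum_(j in J) a i j = \esum_(j in J) \esum_(i in I) a i j.
Proof.
move=> a0; rewrite !esum_esum//.
rewrite (reindex_esum (J `*`` fun=> I) _ (fun z => (z.2, z.1)))//.
split=> [[j i] [/= ? ?]|[j i] [j' i'] _ _ [-> ->]|[i j] [/= Ii Jj]] //.
by exists (j, i).
Qed.

Lemma neglog_esum (u : R) : 0 < u ->
  (neglog (expR (- u)))%:E
    = \esum_(k in [set: nat]) (k.+1%:R^-1 * expR (- (k.+1%:R * u)))%:E.
Proof.
move=> u0; have w01 : 0 <= expR (- u) < 1.
  by rewrite expR_ge0 expR_lt1 oppr_lt0.
rewrite -nneseries_esumT; last first.
  by move=> k; rewrite lee_fin mulr_ge0 ?expR_ge0// invr_ge0.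
apply/esym/cvg_lim => //.
have -> : (fun n => (\sum_(0 <= k < n) (k.+1%:R^-1 * expR (- (k.+1%:R * u)))%:E)%E)
   = EFin \o (fun K => \sum_(k < K) expR (- u) ^+ k.+1 / k.+1%:R).
  apply/funext => n /=; rewrite sumEFin big_mkord; congr (_%:E).
  by apply: eq_bigr => k _; rewrite -expRM_natl mulrN mulrC.
by apply: cvg_EFin; [exact: nearW|exact: neglog_series].
Qed.

(** Every nonzero lattice point is in a unique way a multiple of a primitive
    one; expanding the logarithm turns this into the identity below, which
    carries the asymptotics of expsum over to logsum. *)
Lemma logsum_multiples C p :
  (forall m x, C (m.+1 * x.1, m.+1 * x.2)%N <-> C x) -> 0 < p.1 -> 0 < p.2 ->
  \esum_(m in [set: nat]) logsum C (scale m.+1%:R p)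
  = \esum_(k in [set: nat]) ((k.+1%:R^-1)%:E * expsum C (scale k.+1%:R p))%E.
Proof.
move=> CZ p1 p2.
pose psi y := (neglog (expR (- dotp p y)))%:E.
have psi0 y : (0 <= psi y)%E by rewrite lee_fin neglog_ge0 ?expR_ge0.
transitivity (\esum_(y in C `\ (0, 0)%N) psi y).
  have -> : \esum_(m in [set: nat]) logsum C (scale m.+1%:R p) =
      \esum_(m in [set: nat]) \esum_(x in C `&` primitive)
        psi (m.+1 * x.1, m.+1 * x.2)%N.
    apply: eq_esum => m _; apply: eq_esum => x _.
    by rewrite dotp_scale /psi dotp_mul.
  rewrite esum_esum//.
  rewrite (reindex_esum (setT `*`` (fun=> C `&` primitive)) _
    (fun z => (z.1.+1 * z.2.1, z.1.+1 * z.2.2)%N))//.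
  split.
  - move=> [m [a b]] [/= _ [Cx px]]; split; first exact/(CZ m (a, b)).
    move=> [] /eqP; rewrite muln_eq0/= => /eqP a0 /eqP; rewrite muln_eq0/= => /eqP b0.
    by move: px; rewrite /primitive/= a0 b0.
  - move=> [m [a b]] [m' [a' b']]; rewrite !inE => -[/= _ [_ px]] [/= _ [_ px']] [/= ea eb].
    by have [[->] /= -> ->] := coprime_multiples (ltn0Sn m) (ltn0Sn m') px px' ea eb.
  - move=> x [Cx /= /eqP/coprime_decomposition[[|m] [c [// _ pc xE _]]]].
    exists (m, c); last by rewrite xE.
    by split=> //; split=> //; apply/(CZ m); rewrite -xE.
transitivity (\esum_(y in C `\ (0, 0)%N) \esum_(k in [set: nat])
    (k.+1%:R^-1 * expR (- dotp (scale k.+1%:R p) y))%:E).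
  apply: eq_esum => y [_ y0]; rewrite /psi neglog_esum.
    by apply: eq_esum => k _; rewrite dotp_scale.
  by apply: dotp_gt0 => //; apply/eqP.
rewrite exchange_esum; last first.
  by move=> y k; rewrite lee_fin mulr_ge0 ?expR_ge0// invr_ge0.
apply: eq_esum => k _; rewrite /expsum -esumZl ?invr_gt0//.
Qed.

(** Convergence is phrased through unordered sums, because the two series of
    logsum_multiples come as such. *)
Definition has_sum (a : nat -> R) (s : R) : Prop :=
  \esum_(k in [set: nat]) (a k)%:E = s%:E.

Lemma has_sum_le (a b : nat -> R) (s t : R) :
  (forall k, a k <= b k) -> has_sum a s -> has_sum b t -> s <= t.
Proof.
by move=> ab sa sb; rewrite -lee_fin -sa -sb; apply: le_esum => k _; rewrite lee_fin.
Qed.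

Lemma has_sum_exists (a b : nat -> R) (t : R) :
  (forall k, 0 <= a k <= b k) -> has_sum b t -> exists s, has_sum a s.
Proof.
move=> ab sb; exists (fine (\esum_(k in [set: nat]) (a k)%:E)).
rewrite /has_sum fineK// ge0_fin_numE; last first.
  by apply: esum_ge0 => k _; rewrite lee_fin; case/andP: (ab k).
apply: le_lt_trans (ltry t); rewrite -sb; apply: le_esum => k _.
by rewrite lee_fin; case/andP: (ab k).
Qed.

Lemma has_sumD (a b : nat -> R) (s t : R) :
  (forall k, 0 <= a k) -> (forall k, 0 <= b k) ->
  has_sum a s -> has_sum b t -> has_sum (fun k => a k + b k) (s + t).
Proof.
move=> a0 b0 sa sb; rewrite /has_sum EFinD -sa -sb -esumD// => k _;
  by rewrite lee_fin.
Qed.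

Lemma has_sumZ (a : nat -> R) (s r : R) : 0 <= r -> (forall k, 0 <= a k) ->
  has_sum a s -> has_sum (fun k => r * a k) (r * s).
Proof. by move=> r0 a0 sa; exact: esum_EFinZl. Qed.

Lemma has_sum_partial (a : nat -> R) (s : R) M : (forall k, 0 <= a k) ->
  has_sum a s -> \sum_(k < M) a k <= s.
Proof.
move=> a0; rewrite /has_sum -nneseries_esumT//.
move=> sa; rewrite -lee_fin -sa -sumEFin -(big_mkord xpredT (fun k => (a k)%:E)).
by apply: nneseries_lim_ge => k _ _; rewrite lee_fin.
Qed.

Lemma has_sum_ub (a : nat -> R) (s t : R) : (forall k, 0 <= a k) ->
  has_sum a s -> (forall M, \sum_(k < M) a k <= t) -> s <= t.
Proof.
move=> a0; rewrite /has_sum -nneseries_esumT//.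
move=> sa h; rewrite -lee_fin -sa; apply: lime_le.
  by apply: is_cvg_nneseries => k _ _; rewrite lee_fin.
by apply: nearW => M; rewrite big_mkord sumEFin lee_fin.
Qed.

(** The terms are below the telescoping differences 1 / k - 1 / (k + 1). *)
Lemma sum_inv_sq_tail M N : (0 < M)%N ->
  \sum_(M <= k < N) (k.+1%:R ^- 2 : R) <= M%:R^-1.
Proof.
move=> M0; have [NM|MN] := leqP N M.
  by rewrite big_geq// invr_ge0.
suff : \sum_(M <= k < N) (k.+1%:R ^- 2 : R) <= M%:R^-1 - N%:R^-1.
  by move/le_trans; apply; rewrite gerBl invr_ge0.
elim: N MN => // N ih; rewrite ltnS leq_eqVlt => /predU1P[<-|MN].
  rewrite big_nat1 -subr_ge0.
  have m0 : (0 : R) < M%:R by rewrite ltr0n.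
  rewrite -natr1; move: (M%:R) m0 => m m0.
  have -> : m^-1 - (m + 1)^-1 - (m + 1) ^- 2 = m^-1 * (m + 1) ^- 2.
    by field; rewrite !gt_eqF ?addr_gt0.
  by rewrite mulr_ge0 ?invr_ge0 ?exprn_ge0 ?addr_ge0// ltW.
rewrite big_nat_recr/=; last exact: ltnW.
have m0 : (0 : R) < N%:R by rewrite ltr0n (leq_trans _ MN).
have : N.+1%:R ^- 2 <= N%:R^-1 - N.+1%:R^-1 :> R.
  rewrite -subr_ge0 -natr1; move: (N%:R) m0 => m m0.
  have -> : m^-1 - (m + 1)^-1 - (m + 1) ^- 2 = m^-1 * (m + 1) ^- 2.
    by field; rewrite !gt_eqF ?addr_gt0.
  by rewrite mulr_ge0 ?invr_ge0 ?exprn_ge0 ?addr_ge0// ltW.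
have := ih MN; move: (N.+1%:R ^- 2) (N.+1%:R^-1) (N%:R^-1) (M%:R^-1) (\sum_(_ <= _ < _) _) => a b c d e.
lra.
Qed.

(** The first term 1/4 and the tail 1/2.  A bound below 1 is essential for the
    lemma contraction. *)
Lemma sum_inv_sq_lt1 M : \sum_(1 <= k < M) (k.+1%:R ^- 2 : R) <= 3 / 4.
Proof.
have [M1|M1] := leqP M 1; first by (rewrite big_geq//; lra).
rewrite big_ltn//; have := sum_inv_sq_tail M (isT : (0 < 2)%N).
have e : (2 ^- 2 : R) = 1 / 4 by field.
by rewrite e => h; lra.
Qed.

(** The sum over the quadrant at (q, q) is (1 - exp(- q))^-2 - 1, which is of
    order q^-2 for small q and of order exp(- q) for large q.  Writing
    exp(- q) = d^2, the inequality q / 2 * d <= 1 - d covers both regimes. *)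
Lemma expsum_bound C p q : 0 < q -> q <= p.1 -> q <= p.2 ->
  q ^+ 2 * fine (expsum C p) <= 8.
Proof.
move=> q0 qp1 qp2.
have p1 : 0 < p.1 by apply: lt_le_trans qp1.
have p2 : 0 < p.2 by apply: lt_le_trans qp2.
apply: (@le_trans _ _ (q ^+ 2 * fine (expsum setT (q, q)))).
  rewrite ler_pM2l ?exprn_gt0//.
  apply: le_trans (expsum_le_T C p1 p2) _.
  rewrite fine_le ?expsum_fin//; apply: le_esum => x _.
  by rewrite lee_fin ler_expR lerN2 lerD// ler_wpM2r.
rewrite expsumT//=.
pose d := expR (- (q / 2)).
have -> : expR (- q) = d ^+ 2.
  by rewrite /d -expRM_natl; congr expR; rewrite mulrN mulrC divfK.
have d0 : 0 < d by exact: expR_gt0.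
have d1 : d < 1 by rewrite expR_lt1 oppr_lt0 divr_gt0.
have sd : q / 2 * d <= 1 - d.
  have := ler_wpM2r (ltW d0) (expR_ge1Dx (q / 2)).
  by rewrite {2}/d expRxMexpNx_1 mulrDl mul1r; lra.
have e0 : 0 < 1 - d ^+ 2 by rewrite subr_gt0 expr_lt1// ltW.
have -> : q ^+ 2 * ((1 - d ^+ 2)^-1 / (1 - d ^+ 2) - 1) =
    (4 * (q / 2 * d) ^+ 2 * (2 - d ^+ 2)) / (1 - d ^+ 2) ^+ 2.
  by field; rewrite gt_eqF.
rewrite ler_pdivrMr ?exprn_gt0//.
have : (q / 2 * d) ^+ 2 <= (1 - d ^+ 2) ^+ 2.
  rewrite lerXn2r ?nnegrE ?(ltW e0)//; first by rewrite !mulr_ge0 ?ltW.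
  by apply: le_trans sd _; rewrite lerD2l lerN2 expr2 ger_pMl// ltW.
have : 0 <= d ^+ 2 by rewrite sqr_ge0.
have : 0 <= (q / 2 * d) ^+ 2 by rewrite sqr_ge0.
move: ((q / 2 * d) ^+ 2) ((1 - d ^+ 2) ^+ 2) (d ^+ 2) => x y z; nra.
Qed.

End primitive_sums.

Section contraction.
Variable R : realType.

(** The hypothesis says that the averages of D along the multiples of h, with
    weights 1/m^2, tend to 0 with h.  As the weights with m >= 2 sum to at most
    3/4 < 1, the first term is controlled by the others: each pass through the
    inequality improves a bound on D near 0 by the factor 7/8. *)
Lemma contraction (B K eta : R) : 0 <= B -> 0 <= K -> 0 < eta ->
  exists2 h0 : R, 0 < h0 & forall D : R -> R,
    (forall h : R, 0 < h -> `|D h| <= B) ->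
    (forall (h : R) M, 0 < h -> (0 < M)%N ->
      `|\sum_(m < M) D (m.+1%:R * h) / m.+1%:R ^+ 2| <= K * h + K / M%:R) ->
  forall h : R, 0 < h < h0 -> `|D h| <= eta.
Proof.
move=> B0 K0 eta0.
pose hyp (D : R -> R) := (forall h : R, 0 < h -> `|D h| <= B) /\
    (forall (h : R) M, 0 < h -> (0 < M)%N ->
      `|\sum_(m < M) D (m.+1%:R * h) / m.+1%:R ^+ 2| <= K * h + K / M%:R).
have step (j : nat) : exists2 h0 : R, 0 < h0 & forall D, hyp D ->
    forall h : R, 0 < h < h0 -> `|D h| <= (B + 1) * (7 / 8) ^+ j.
  elim: j => [|j [h1 h10 ih]].
    exists 1 => // D [DB _] h /andP[h0 _]; rewrite expr0 mulr1.
    by apply: le_trans (DB h h0) _; lra.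
  set b := (B + 1) * (7 / 8) ^+ j in ih *.
  have b0 : 0 < b by rewrite mulr_gt0// ?exprn_gt0//; lra.
  (* Both errors K / M and K h are made at most b / 16, and
     3/4 + 1/16 + 1/16 = 7/8. *)
  pose M := (Num.truncn (16 * K / b)).+1.
  have MK : K / M%:R <= b / 16.
    have : 16 * K / b < M%:R by exact: truncnS_gt.
    rewrite ltr_pdivrMr// => h; rewrite ler_pdivrMr ?ltr0n//.
    by move: h; move: (M%:R) => m; lra.
  exists (Num.min (h1 / M%:R) (b / (16 * (K + 1)))).
    by rewrite lt_min !divr_gt0 ?mulr_gt0 ?ltr0n//; lra.
  move=> D hD h /andP[h0]; rewrite lt_min => /andP[hh1 hb].
  have [_ hD2] := hD.
  have Kh : K * h <= b / 16.
    move: hb; rewrite ltr_pdivlMr ?mulr_gt0//; last by lra.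
    by nra.
  have := hD2 h M h0 isT; rewrite big_ord_recl/= mul1r expr1n divr1 => hM.
  have tail : `|\sum_(i < M.-1) D ((bump 0 i).+1%:R * h) / (bump 0 i).+1%:R ^+ 2|
      <= b * (3 / 4).
    apply: le_trans (ler_norm_sum _ _ _) _.
    apply: (@le_trans _ _ (\sum_(i < M.-1) b * (i.+2%:R ^- 2))).
      apply: ler_sum => i _; rewrite /bump/= add1n normrM.
      rewrite [X in _ * X]ger0_norm ?invr_ge0 ?exprn_ge0//.
      rewrite ler_wpM2r ?invr_ge0 ?exprn_ge0// ih// mulr_gt0//=.
      move: hh1; rewrite ltr_pdivlMr ?ltr0n// mulrC; apply: le_lt_trans.
      by rewrite ler_pM2r// ler_nat; case: i => i /= iM; rewrite !ltnS in iM *.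
    rewrite -mulr_sumr ler_pM2l//.
    have := sum_inv_sq_lt1 R M.
    by rewrite big_add1/= big_mkord.
  have -> : (B + 1) * (7 / 8) ^+ j.+1 = b * (7 / 8) by rewrite /b exprSr; ring.
  move: hM tail; set T := \sum_(i < _) _; rewrite !ler_norml => /andP[? ?] /andP[? ?].
  by apply/andP; split; lra.
have [j hj] : exists j, (B + 1) * (7 / 8) ^+ j <= eta.
  have q1 : `|7 / 8 : R| < 1 by rewrite ger0_norm; lra.
  have /cvgrPdist_le/(_ eta eta0)[j _ /(_ j (leqnn j))/=] := @cvg_geometric R (B + 1) _ q1.
  rewrite sub0r normrN => h; exists j; apply: le_trans h; exact: ler_norm.
have [h0 h00 hh] := step j; exists h0 => // D h1 h2 h h3.
by apply: le_trans hj; apply: hh.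
Qed.

End contraction.

Section logsum_asymptotics.
Variable R : realType.
Implicit Types (p : R * R) (C : set (nat * nat)) (h : R).

Lemma has_sum_bounded (a : nat -> R) (t : R) : (forall k, 0 <= a k) ->
  (forall M, \sum_(k < M) a k <= t) -> exists s, has_sum a s.
Proof.
move=> a0 at_; exists (fine (\esum_(k in [set: nat]) (a k)%:E)).
rewrite /has_sum fineK// ge0_fin_numE; last by apply: esum_ge0 => k _; rewrite lee_fin.
apply: le_lt_trans (ltry t); rewrite -nneseries_esumT//; apply: lime_le.
  by apply: is_cvg_nneseries => k _ _; rewrite lee_fin.
by apply: nearW => M; rewrite big_mkord sumEFin lee_fin.
Qed.

Lemma has_sum_head (a : nat -> R) (s : R) : (forall k, 0 <= a k) ->
  has_sum a s -> a 0%N <= s.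
Proof. by move=> a0 sa; have := has_sum_partial 1 a0 sa; rewrite big_ord1. Qed.

Lemma inv_pow_ge0 j k : 0 <= k.+1%:R ^- j :> R.
Proof. by rewrite invr_ge0 exprn_ge0. Qed.

Lemma has_sum_tail (a : nat -> R) (s B : R) M : (0 < M)%N -> 0 <= B ->
  (forall k, 0 <= a k <= B * k.+1%:R ^- 2) -> has_sum a s ->
  s <= \sum_(k < M) a k + B / M%:R.
Proof.
move=> M0 B0 aB sa; have a0 k : 0 <= a k by case/andP: (aB k).
apply: (has_sum_ub a0 sa) => N.
have sub m n : (m <= n)%N -> \sum_(k < m) a k <= \sum_(k < n) a k.
  move=> mn; rewrite -!(big_mkord xpredT a) (big_cat_nat (leq0n m) mn)/= lerDl.
  by apply: sumr_ge0.
have [NM|/ltnW MN] := leqP N M.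
  by rewrite -[leLHS]addr0 lerD ?sub// divr_ge0.
rewrite -!(big_mkord xpredT a) (big_cat_nat (leq0n M) MN)/= lerD2l.
apply: (@le_trans _ _ (\sum_(M <= k < N) B * k.+1%:R ^- 2)).
  by apply: ler_sum => k _; case/andP: (aB k).
by rewrite -mulr_sumr ler_wpM2l// sum_inv_sq_tail.
Qed.

Lemma inv_sq_has_sum : exists z2 : R, has_sum (fun k => k.+1%:R ^- 2) z2.
Proof.
apply: (@has_sum_bounded _ 2) => [k|[|M]]; first by rewrite invr_ge0 exprn_ge0.
  by rewrite big_ord0.
rewrite -(big_mkord xpredT (fun k => k.+1%:R ^- 2 : R)) big_ltn// expr1n invr1.
by have := sum_inv_sq_lt1 R M.+1; lra.
Qed.

Lemma inv_cube_has_sum : exists z3 : R, has_sum (fun k => k.+1%:R ^- 3) z3.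
Proof.
have [z2 hz2] := inv_sq_has_sum.
apply: (has_sum_exists _ hz2) => k; rewrite invr_ge0 exprn_ge0//=.
by rewrite lef_pV2 ?posrE ?exprn_gt0 ?ltr0n// ler_weXn2l ?ler1n.
Qed.

Lemma scaleM (r h : R) p : scale r (scale h p) = scale (r * h) p.
Proof. by rewrite /scale/= !mulrA. Qed.

Lemma logsum_ge0 C p : (0 <= logsum C p)%E.
Proof. by apply: esum_ge0 => y _; rewrite lee_fin neglog_ge0 ?expR_ge0. Qed.

Section fixed_ray.
Variables (C : set (nat * nat)) (V : R * R -> R) (c z2 z3 : R) (p : R * R).
Hypothesis CV : has_density C V.
Hypothesis hz2 : has_sum (fun k => k.+1%:R ^- 2) z2.
Hypothesis hz3 : has_sum (fun k => k.+1%:R ^- 3) z3.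
Hypothesis p1 : 0 < p.1.
Hypothesis p2 : 0 < p.2.
Hypothesis p12 : p.1 + p.2 = 1.
Hypothesis c0 : 0 < c.
Hypothesis pc1 : p.1 <= c * p.2.
Hypothesis pc2 : p.2 <= c * p.1.

(** The two sums at the point h p of a ray, normalized by the inverse of their
    order of magnitude; nexp h tends to V p, and nlog h will be shown to tend to
    z3 / z2 * V p. *)
Let nexp h := h ^+ 2 * p.1 * p.2 * fine (expsum C (scale h p)).
Let nlog h := h ^+ 2 * p.1 * p.2 * fine (logsum C (scale h p)).

Let nexp_rate h : 0 < h -> `|nexp h - V p| <= 3 * h.
Proof.
move=> h0; have [_ VZ _ /(_ (scale h p))] := CV.
rewrite VZ//= -mulrDr p12 mulr1 => /(_ (mulr_gt0 h0 p1) (mulr_gt0 h0 p2)).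
by rewrite /nexp; congr (`|_ * _ - _| <= _); ring.
Qed.

Let nexp_ge0 h : 0 <= nexp h.
Proof. by do 3 rewrite mulr_ge0 ?expsum_ge0 ?sqr_ge0 ?(ltW p1) ?(ltW p2)//. Qed.

Let nexp_bound h : 0 < h -> nexp h <= 8 * c.
Proof.
move=> h0; pose q := Num.min p.1 p.2.
have q0 : 0 < q by rewrite lt_min p1 p2.
have hq : 0 < h * q by rewrite mulr_gt0.
have h8 : (h * q) ^+ 2 * fine (expsum C (scale h p)) <= 8.
  by apply: expsum_bound => //=; rewrite ler_pM2l// ge_min lexx ?orbT.
have pq : p.1 * p.2 <= c * q ^+ 2.
  by rewrite /q; case: (leP p.1 p.2) => _; rewrite expr2 mulrA; [rewrite mulrC|]; rewrite ler_pM2r.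
apply: (@le_trans _ _ (h ^+ 2 * (c * q ^+ 2) * fine (expsum C (scale h p)))).
  by rewrite /nexp ler_wpM2r ?expsum_ge0// -mulrA ler_wpM2l// sqr_ge0.
have -> : h ^+ 2 * (c * q ^+ 2) * fine (expsum C (scale h p))
   = c * ((h * q) ^+ 2 * fine (expsum C (scale h p))) by ring.
by rewrite mulrC ler_pM2r.
Qed.

(** The identity logsum_multiples for the normalized sums: multiplying it by
    h^2 turns 1 / k into k^-3 on one side and 1 into m^-2 on the other. *)
Let sums h : 0 < h -> exists g,
  has_sum (fun k => k.+1%:R ^- 3 * nexp (k.+1%:R * h)) g /\
  has_sum (fun k => k.+1%:R ^- 2 * nlog (k.+1%:R * h)) g.
Proof.
move=> h0; have [CZ _ _ _] := CV.
have hp1 : 0 < (scale h p).1 by rewrite mulr_gt0.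
have hp2 : 0 < (scale h p).2 by rewrite mulr_gt0.
have N0 : 0 < h ^+ 2 * p.1 * p.2 by rewrite !mulr_gt0 ?exprn_gt0.
pose a k := k.+1%:R^-1 * fine (expsum C (scale (k.+1%:R * h) p)).
have aE k : h ^+ 2 * p.1 * p.2 * a k = k.+1%:R ^- 3 * nexp (k.+1%:R * h).
  rewrite /a /nexp; move: (fine _) => f; move: (k.+1%:R) (pnatr_eq0 R k.+1) => t /negbT t0.
  by field.
have a0 k : 0 <= a k by rewrite /a mulr_ge0 ?expsum_ge0 ?invr_ge0.
have [g ag] : exists g, has_sum a g.
  have := has_sumZ (_ : 0 <= (h ^+ 2 * p.1 * p.2)^-1 * (8 * c)) _ hz3.
  have r0 : 0 <= (h ^+ 2 * p.1 * p.2)^-1 * (8 * c).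
    by rewrite mulr_ge0 ?invr_ge0 ?mulr_ge0// ltW.
  move=> /(_ r0) hs; apply: (has_sum_exists _ (hs _)) => k; last first.
    by rewrite invr_ge0 exprn_ge0.
  rewrite a0 /= -[leRHS]mulrA ler_pdivlMl// aE mulrC ler_wpM2r ?invr_ge0 ?exprn_ge0//.
  by rewrite nexp_bound// mulr_gt0.
have := logsum_multiples CZ hp1 hp2.
rewrite [RHS](_ : _ = g%:E); last first.
  rewrite -ag; apply: eq_esum => k _; rewrite EFinM; congr (_ * _)%E.
  by rewrite scaleM fineK// expsum_fin//= !mulr_gt0.
move=> lg; have lg' : has_sum (fun m => fine (logsum C (scale (m.+1%:R * h) p))) g.
  rewrite /has_sum -lg; apply: eq_esum => m _; rewrite scaleM fineK//.
  rewrite ge0_fin_numE ?logsum_ge0//; apply: le_lt_trans (ltry g); rewrite -lg -scaleM.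
  rewrite -[leLHS](esum_set1 (a := fun m => logsum C (scale m.+1%:R (scale h p)))) ?logsum_ge0//.
  exact: subset_esum.
exists (h ^+ 2 * p.1 * p.2 * g); split.
  rewrite (_ : (fun _ => _) = fun k => h ^+ 2 * p.1 * p.2 * a k).
    by apply: has_sumZ => //; exact: ltW.
  by apply/funext => k; rewrite aE.
rewrite (_ : (fun _ => _) =
    fun k => h ^+ 2 * p.1 * p.2 * fine (logsum C (scale (k.+1%:R * h) p))).
  by apply: has_sumZ => //; [exact: ltW|move=> k; rewrite fine_ge0 ?logsum_ge0].
apply/funext => k; rewrite /nlog; move: (fine _) => f; move: (k.+1%:R) (pnatr_eq0 R k.+1) => t /negbT t0.
by field.
Qed.

Let nlog_ge0 h : 0 <= nlog h.
Proof.
by do 3 rewrite mulr_ge0 ?fine_ge0 ?logsum_ge0 ?sqr_ge0 ?(ltW p1) ?(ltW p2)//.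
Qed.

(** Since nexp (k h) = V p + O(k h), the common value is z3 V p + O(h). *)
Let sums_itv h g : 0 < h ->
  has_sum (fun k => k.+1%:R ^- 3 * nexp (k.+1%:R * h)) g ->
  [/\ g <= 8 * c * z3, g <= V p * z3 + 3 * h * z2 & V p * z3 <= g + 3 * h * z2].
Proof.
move=> h0 hg; have [_ _ V01 _] := CV; have /andP[V0 V1] := V01 p p1 p2.
have i2 k : 0 <= k.+1%:R ^- 2 :> R by rewrite invr_ge0 exprn_ge0.
have i3 k : 0 <= k.+1%:R ^- 3 :> R by rewrite invr_ge0 exprn_ge0.
have h30 : 0 <= 3 * h by rewrite mulr_ge0// ltW.
have c80 : 0 <= 8 * c by rewrite mulr_ge0// ltW.
have e k : 3 * h * k.+1%:R ^- 2 = k.+1%:R ^- 3 * (3 * (k.+1%:R * h)).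
  by move: (k.+1%:R) (pnatr_eq0 R k.+1) => t /negbT t0; field.
have kh k : 0 < k.+1%:R * h by rewrite mulr_gt0.
split.
- apply: (has_sum_le _ hg (has_sumZ c80 i3 hz3)) => k.
  by rewrite mulrC ler_wpM2r// nexp_bound.
- apply: (has_sum_le _ hg (has_sumD _ _ (has_sumZ V0 i3 hz3) (has_sumZ h30 i2 hz2))) => k.
  + rewrite e mulrC -[X in X + _]mulrC -mulrDr mulrC ler_wpM2l//.
    by have := nexp_rate (kh k); rewrite ler_norml; lra.
  + by rewrite mulr_ge0.
  + by rewrite mulr_ge0.
- apply: (has_sum_le _ (has_sumZ V0 i3 hz3) (has_sumD _ _ hg (has_sumZ h30 i2 hz2))) => k.
  + rewrite e mulrC -mulrDr ler_wpM2l//.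
    by have := nexp_rate (kh k); rewrite ler_norml; lra.
  + by rewrite mulr_ge0.
  + by rewrite mulr_ge0.
Qed.

Let z2_ge1 : 1 <= z2.
Proof. by have := has_sum_head (inv_pow_ge0 2) hz2; rewrite expr1n invr1. Qed.

Let z3_ge1 : 1 <= z3.
Proof. by have := has_sum_head (inv_pow_ge0 3) hz3; rewrite expr1n invr1. Qed.

Let nlog_sum_itv h M : 0 < h -> (0 < M)%N -> exists g,
  [/\ g <= 8 * c * z3, g <= V p * z3 + 3 * h * z2, V p * z3 <= g + 3 * h * z2,
    \sum_(m < M) m.+1%:R ^- 2 * nlog (m.+1%:R * h) <= g &
    g <= \sum_(m < M) m.+1%:R ^- 2 * nlog (m.+1%:R * h) + 8 * c * z3 / M%:R].
Proof.
move=> h0 M0; have [g [g3 g2]] := sums h0; exists g.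
have [G1 G2 G3] := sums_itv h0 g3.
have b0 k : 0 <= k.+1%:R ^- 2 * nlog (k.+1%:R * h).
  by rewrite mulr_ge0// invr_ge0 exprn_ge0.
split=> //; first exact: (has_sum_partial M b0 g2).
apply: (has_sum_tail M0 _ _ g2) => [|k].
  by rewrite !mulr_ge0 ?(ltW c0)// (le_trans ler01).
rewrite b0/= mulrC ler_wpM2r ?invr_ge0 ?exprn_ge0//.
have kh : 0 < k.+1%:R * h by rewrite mulr_gt0.
have [g' [g3' g2']] := sums kh; have [le_g' _ _] := sums_itv kh g3'.
apply: le_trans le_g'.
have b0' j : 0 <= j.+1%:R ^- 2 * nlog (j.+1%:R * (k.+1%:R * h)).
  by rewrite mulr_ge0 ?inv_pow_ge0.
by have := has_sum_head b0' g2'; rewrite expr1n invr1 !mul1r.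
Qed.

(** This bound and the next one are the hypotheses of contraction for
    D h = nlog h - z3 / z2 * V p. *)
Lemma nlog_bound h : 0 < h ->
  `|h ^+ 2 * p.1 * p.2 * fine (logsum C (scale h p)) - z3 / z2 * V p|
    <= 8 * c * z3 + z3 / z2.
Proof.
move=> h0; rewrite -/(nlog h).
have [_ _ V01 _] := CV; have /andP[V0 V1] := V01 p p1 p2.
have [g [g1 _ _ + _]] := nlog_sum_itv h0 (isT : (0 < 1)%N).
rewrite big_ord1 expr1n invr1 !mul1r => lg.
have z20 := le_trans ler01 z2_ge1; have z30 := le_trans ler01 z3_ge1.
have L0 : 0 <= z3 / z2 by rewrite divr_ge0.
have LV : z3 / z2 * V p <= z3 / z2 by rewrite ler_piMr.
have LV0 : 0 <= z3 / z2 * V p by rewrite mulr_ge0.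
have c83 : 0 <= 8 * c * z3 by rewrite !mulr_ge0// ltW.
have := nlog_ge0 h; rewrite ler_norml; lra.
Qed.

Lemma nlog_average h M K : 0 < h -> (0 < M)%N ->
  K = 3 * z2 + 8 * c * z3 + z3 / z2 ->
  `|\sum_(m < M) ((m.+1%:R * h) ^+ 2 * p.1 * p.2 * fine (logsum C (scale (m.+1%:R * h) p))
      - z3 / z2 * V p) / m.+1%:R ^+ 2| <= K * h + K / M%:R.
Proof.
move=> h0 M0 KE.
have [_ _ V01 _] := CV; have /andP[V0 V1] := V01 p p1 p2.
have [g [g1 g2 g3 g4 g5]] := nlog_sum_itv h0 M0.
pose s2 := \sum_(m < M) (m.+1%:R ^- 2 : R).
have -> : \sum_(m < M) ((m.+1%:R * h) ^+ 2 * p.1 * p.2 * fine (logsum C (scale (m.+1%:R * h) p))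
      - z3 / z2 * V p) / m.+1%:R ^+ 2
  = \sum_(m < M) m.+1%:R ^- 2 * nlog (m.+1%:R * h) - z3 / z2 * V p * s2.
  rewrite /s2 mulr_sumr -sumrB; apply: eq_bigr => m _.
  by rewrite mulrBl mulrC.
have i2 k : 0 <= k.+1%:R ^- 2 :> R by rewrite invr_ge0 exprn_ge0.
have s2l : s2 <= z2 by exact: (has_sum_partial M (inv_pow_ge0 2) hz2).
have s2u : z2 <= s2 + 1 / M%:R.
  by apply: (has_sum_tail M0 ler01 _ hz2) => k; rewrite i2 mul1r lexx.
have z2n0 : z2 != 0 by rewrite gt_eqF// (lt_le_trans ltr01).
have z20 := le_trans ler01 z2_ge1; have z30 := le_trans ler01 z3_ge1.
have L0 : 0 <= z3 / z2 by rewrite divr_ge0.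
have LV : z3 / z2 * V p <= z3 / z2 by rewrite ler_piMr.
have LV0 : 0 <= z3 / z2 * V p by rewrite mulr_ge0.
have a1 : z3 / z2 * V p * s2 <= V p * z3.
  have -> : V p * z3 = z3 / z2 * V p * z2 by field.
  by rewrite ler_wpM2l.
have a2 : V p * z3 <= z3 / z2 * V p * s2 + z3 / z2 / M%:R.
  have -> : V p * z3 = z3 / z2 * V p * z2 by field.
  apply: (@le_trans _ _ (z3 / z2 * V p * (s2 + 1 / M%:R))); first by rewrite ler_wpM2l.
  by rewrite mulrDr lerD2l mul1r ler_wpM2r ?invr_ge0.
have c83 : 0 <= 8 * c * z3 by rewrite !mulr_ge0// ltW.
have Mi : (0 : R) <= M%:R^-1 by rewrite invr_ge0.
have kM : 8 * c * z3 / M%:R <= K / M%:R.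
  by rewrite ler_wpM2r// KE; lra.
have kM2 : z3 / z2 / M%:R <= K / M%:R.
  by rewrite ler_wpM2r// KE; lra.
have kh : 3 * h * z2 <= K * h.
  by rewrite mulrAC ler_wpM2r ?(ltW h0)// KE; lra.
have KM0 : 0 <= K / M%:R by apply: le_trans kM; rewrite mulr_ge0.
have Kh0 : 0 <= K * h by apply: le_trans kh; rewrite !mulr_ge0// ltW.
move: g4 g5; move: (\sum_(_ < _) _) => S g4 g5.
rewrite ler_norml; apply/andP; split; lra.
Qed.

End fixed_ray.

(** The threshold h0 is uniform over all regions with a density: the slope that
    cuts the cone varies with the endpoint of the lines. *)
Definition logsum_constant (L : R) : Prop :=
  forall c eta : R, 0 < c -> 0 < eta ->
  exists2 h0 : R, 0 < h0 & forall C V, has_density C V ->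
  forall p, 0 < p.1 < h0 -> 0 < p.2 < h0 -> p.1 <= c * p.2 -> p.2 <= c * p.1 ->
  `|p.1 * p.2 * fine (logsum C p) - L * V p| <= eta.

(** The constant is zeta(3) / zeta(2).  A point p is written s q with
    q.1 + q.2 = 1, and contraction applies along the ray of q; its threshold
    depends on the bounds alone, hence neither on the ray nor on the region. *)
Theorem logsum_asymptotics : exists2 L : R, 0 < L & logsum_constant L.
Proof.
have [z2 hz2] := inv_sq_has_sum; have [z3 hz3] := inv_cube_has_sum.
have z21 : 1 <= z2 by have := has_sum_head (inv_pow_ge0 2) hz2; rewrite expr1n invr1.
have z31 : 1 <= z3 by have := has_sum_head (inv_pow_ge0 3) hz3; rewrite expr1n invr1.
have L0 : 0 < z3 / z2 by rewrite divr_gt0//; lra.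
exists (z3 / z2) => // c eta c0 eta0.
have c83 : 0 <= 8 * c * z3 by rewrite !mulr_ge0//; lra.
have [||h0 h00 H] := @contraction R (8 * c * z3 + z3 / z2)
  (3 * z2 + 8 * c * z3 + z3 / z2) eta _ _ eta0; [by lra|by lra|].
exists (h0 / 2); first by rewrite divr_gt0.
move=> C V CV p /andP[p1 p1h] /andP[p2 p2h] pc1 pc2.
pose s := p.1 + p.2.
have s0 : 0 < s by rewrite addr_gt0.
pose q := scale s^-1 p.
have q1 : 0 < q.1 by rewrite mulr_gt0 ?invr_gt0.
have q2 : 0 < q.2 by rewrite mulr_gt0 ?invr_gt0.
have q12 : q.1 + q.2 = 1 by rewrite -mulrDr mulVf ?gt_eqF.
have qc1 : q.1 <= c * q.2 by rewrite mulrCA ler_pM2l ?invr_gt0.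
have qc2 : q.2 <= c * q.1 by rewrite mulrCA ler_pM2l ?invr_gt0.
have pE : p = scale s q.
  by rewrite /q /scale/= !mulVKf ?gt_eqF//; case: (p).
have [_ VZ _ _] := CV.
have Vp : V p = V q by rewrite pE VZ.
have sh : 0 < s < h0 by rewrite s0/= /s; lra.
have := H (fun h => h ^+ 2 * q.1 * q.2 * fine (logsum C (scale h q)) - z3 / z2 * V q)
  _ _ s sh.
rewrite -pE -Vp.
have -> : s ^+ 2 * q.1 * q.2 = p.1 * p.2 by rewrite {2}pE {1}pE/=; ring.
apply.
- by move=> h hp; rewrite Vp; apply: (nlog_bound (c := c)).
- by move=> h M hp M0; rewrite Vp; apply: (nlog_average (c := c)).
Qed.

End logsum_asymptotics.

(** * Polygonal lines as multiplicity functions on primitive vectors *)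

Section lines.
Variable R : realType.
Implicit Types (e f : nat * nat).

Definition incl e : R := inclination (to_plane R e).

Lemma incl_cross e f : e != (0, 0)%N -> f != (0, 0)%N -> incl e = incl f ->
  (e.1 * f.2 = e.2 * f.1)%N.
Proof.
case: e f => [a b] [c d]; rewrite !xpair_eqE /incl /inclination /= !pnatr_eq0.
have [->|a0] := eqVneq a 0%N; have [->|c0] := eqVneq c 0%N => //=.
- by rewrite mul0n muln0.
- by move=> _ _ /esym h; have := atan_ltpi2 (d%:R / c%:R : R); rewrite h ltxx.
- by move=> _ _ h; have := atan_ltpi2 (b%:R / a%:R : R); rewrite h ltxx.
move=> _ _ /(can_inj (@atanK R))/eqP; rewrite eqr_div ?pnatr_eq0// -!natrM eqr_nat => /eqP.
by rewrite (mulnC d) => ->.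
Qed.

(** The lattice points of the segment are the first k multiples of (a, b): a
    point (j c, j d) with c and d coprime is collinear with (a, b) only when
    (c, d) = (a, b). *)
Lemma edge_pointsM k a b : coprime a b -> edge_points (k * a, k * b)%N = k.
Proof.
move=> ab; pose f (j : 'I_k) : 'I_(k * a).+1 * 'I_(k * b).+1 :=
  (inord (j.+1 * a), inord (j.+1 * b)).
have fE (j : 'I_k) : (f j).1 = (j.+1 * a)%N :> nat /\ (f j).2 = (j.+1 * b)%N :> nat.
  by rewrite /f /= !inordK ?ltnS ?leq_mul2r ?ltn_ord ?orbT.
have f_inj : injective f.
  move=> i j /(congr1 (fun p : 'I_(k * a).+1 * 'I_(k * b).+1 => (p.1 : nat, p.2 : nat))).
  rewrite !(fE _).1 !(fE _).2 => -[e1 e2].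
  have [[] e _ _] := coprime_multiples (ltn0Sn i) (ltn0Sn j) ab ab e1 e2.
  exact: val_inj.
transitivity #|codom f|; last by rewrite card_codom// card_ord.
apply: eq_card => p; apply/idP/idP => [|/codomP[j ->]]; last first.
  rewrite inE (fE j).1 (fE j).2 /=; apply/andP; split.
    rewrite xpair_eqE !muln_eq0/= -?negb_and.
    by apply: contraL ab => /andP[/eqP-> /eqP->].
  by rewrite mulnACA [X in _ == X]mulnACA (mulnC a).
rewrite inE => /andP[/coprime_decomposition[j [[c d] /= [j0 cd [e1 e2] _]]] /eqP h].
have k0 : (0 < k)%N.
  case: (posnP k) => // k0; have := ltn_ord p.1; have := ltn_ord p.2.
  rewrite e1 e2 k0 !mul0n !ltnS !leqn0 !muln_eq0 (gtn_eqF j0)/= => /eqP d0 /eqP c0.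
  by move: cd; rewrite c0 d0.
move: h; rewrite e1 e2 mulnACA [X in _ = X]mulnACA => /eqP.
rewrite eqn_pmul2l ?muln_gt0 ?j0// => /eqP /(coprime_cross cd ab)[ca db].
have jk : (j <= k)%N.
  have := ltn_ord p.1; have := ltn_ord p.2; rewrite e1 e2 !ltnS ca db.
  case: (posnP a) => [a0 + _|a0 _]; last by rewrite leq_pmul2r.
  rewrite leq_pmul2r// lt0n; apply/eqP => b0.
  by move: ab; rewrite a0 b0.
have jk' : (j.-1 < k)%N by rewrite prednK.
apply/codomP; exists (Ordinal jk').
have [f1 f2] := fE (Ordinal jk').
rewrite [LHS]surjective_pairing [RHS]surjective_pairing; congr pair; apply: val_inj => /=.
  by rewrite e1 f1/= prednK// ca.
by rewrite e2 f2/= prednK// db.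
Qed.

Section multiplicities.
Variables N K : nat.

(** The bounds N on the coordinates of the directions and K on the
    multiplicities make both types finite.  For the lines ending at n any bounds
    above the coordinates of n give the same sums. *)
Definition prim := {x : 'I_N.+1 * 'I_N.+1 | coprime x.1 x.2}.

Definition pvec (x : prim) : nat * nat := ((val x).1 : nat, (val x).2 : nat).

Definition mults := {ffun prim -> 'I_K.+1}.

Implicit Types (nu : mults) (x : prim).

Definition edge nu x : nat * nat := (nu x * (pvec x).1, nu x * (pvec x).2)%N.

Definition total nu : nat * nat :=
  (\sum_x nu x * (pvec x).1, \sum_x nu x * (pvec x).2)%N.

Definition line nu : polyline :=
  sort (relpre incl <=%R) [seq edge nu x | x <- index_enum prim & (0 < nu x)%N].

Lemma pvec_inj : injective pvec.
Proof.
move=> x y [] /val_inj e1 /val_inj e2; apply/val_inj.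
by rewrite [LHS]surjective_pairing e1 e2 -surjective_pairing.
Qed.

Lemma pvec_coprime x : coprime (pvec x).1 (pvec x).2.
Proof. exact: valP x. Qed.

Lemma pvec_neq0 x : pvec x != (0, 0)%N.
Proof. by apply/eqP => e; have := pvec_coprime x; rewrite e. Qed.

Lemma pvec_exists c : coprime c.1 c.2 -> (c.1 <= N)%N -> (c.2 <= N)%N ->
  exists x, pvec x = c.
Proof.
case: c => a b /= ab aN bN; rewrite -ltnS in aN; rewrite -ltnS in bN.
by exists (Sub (Ordinal aN, Ordinal bN) ab).
Qed.

Lemma edge_neq0 nu x : (0 < nu x)%N -> edge nu x != (0, 0)%N.
Proof.
move=> n0; have := pvec_neq0 x; rewrite !xpair_eqE !negb_and /edge/= !muln_eq0.
by rewrite -lt0n in n0 *; rewrite !negb_or -!lt0n n0.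
Qed.

Lemma edge_inj nu x y : (0 < nu x)%N -> (0 < nu y)%N ->
  incl (edge nu x) = incl (edge nu y) -> x = y.
Proof.
move=> nx ny /(incl_cross (edge_neq0 nx) (edge_neq0 ny)) /= /eqP.
rewrite mulnACA [X in _ == X]mulnACA eqn_pmul2l ?muln_gt0 ?nx// => /eqP.
move/(coprime_cross (pvec_coprime x) (pvec_coprime y)) => [e1 e2].
by apply: pvec_inj; rewrite [LHS]surjective_pairing e1 e2 -surjective_pairing.
Qed.

Lemma line_sorted nu : sorted (fun e f => incl e < incl f) (line nu).
Proof.
have -> : sorted (fun e f => incl e < incl f) (line nu) = sorted <%R (map incl (line nu)).
  by rewrite sorted_map.
rewrite /line -sort_map sort_lt_sorted -map_comp.
rewrite map_inj_in_uniq ?filter_uniq ?index_enum_uniq// => x y.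
by rewrite !mem_filter => /andP[nx _] /andP[ny _] /edge_inj; apply.
Qed.

Lemma mem_line nu e :
  reflect (exists2 x, (0 < nu x)%N & e = edge nu x) (e \in line nu).
Proof.
rewrite mem_sort; apply: (iffP mapP) => -[x].
  by rewrite mem_filter => /andP[nx _] ->; exists x.
by move=> nx ->; exists x => //; rewrite mem_filter nx mem_index_enum.
Qed.

Lemma line_convex nu : convex_polyline R (line nu).
Proof.
split; last exact: line_sorted.
by apply/allP => e /mem_line[x nx ->]; exact: edge_neq0.
Qed.

(** A direction of multiplicity 0 gives the zero edge on the right-hand side,
    where F is neutral. *)
Lemma big_line (T : Type) (idx : T) (op : Monoid.com_law idx) (F : nat * nat -> T) nu :
  F (0, 0)%N = idx ->
  \big[op/idx]_(e <- line nu) F e = \big[op/idx]_x F (edge nu x).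
Proof.
move=> F0; rewrite (perm_big _ (permEl (perm_sort _ _))) big_map big_filter/=.
rewrite [RHS](bigID (fun x => 0 < nu x)%N)/= [X in op _ X]big1 ?Monoid.mulm1//.
by move=> x; rewrite -eqn0Ngt /edge => /eqP ->; rewrite !mul0n.
Qed.

Lemma sum_line nu : \sum_(e <- line nu) e = total nu.
Proof.
by rewrite sum_pair (@big_line _ _ _ fst)// (@big_line _ _ _ snd).
Qed.

Lemma bweight_line (r : R) nu : bweight r (line nu) = \prod_x bcoef r (nu x).
Proof.
rewrite /bweight (@big_line _ _ _ (fun e => bcoef r (edge_points e))).
  by apply: eq_bigr => x _; rewrite edge_pointsM// pvec_coprime.
rewrite (_ : (0, 0)%N = (0 * 0, 0 * 1)%N)// edge_pointsM//.
by rewrite /bcoef big_ord0 fact0 divr1.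
Qed.

Lemma line_inj : injective line.
Proof.
move=> nu nu' h; apply/ffunP => x.
have key mu mu' : line mu = line mu' -> (0 < mu x)%N -> mu x = mu' x.
  move=> e mx; have : edge mu x \in line mu by apply/mem_line; exists x.
  rewrite e => /mem_line[y my [e1 e2]].
  have [e3 e4 e5] := coprime_multiples mx my (pvec_coprime x) (pvec_coprime y) e1 e2.
  have xy : x = y.
    by apply: pvec_inj; rewrite [LHS]surjective_pairing e4 e5 -surjective_pairing.
  by apply: val_inj; rewrite xy in e3 *.
have [nx|] := ltnP 0 (nu x); first exact: key.
rewrite leqn0 => /eqP nx; have [nx'|] := ltnP 0 (nu' x); first by rewrite (key nu' nu).
by rewrite leqn0 => /eqP nx'; apply: val_inj; rewrite /= nx nx'.
Qed.

(** The multiplicity of the direction x is read off the edge of G parallel to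
    x; there is at most one, since the inclinations increase strictly. *)
Lemma line_surj n (G : polyline) : (n.1 <= N)%N -> (n.2 <= N)%N ->
  (n.1 <= K)%N -> (n.2 <= K)%N -> Pi_lines R n G -> exists nu, line nu = G.
Proof.
move=> nN1 nN2 nK1 nK2 [[/allP Gn0 Gs] Gn].
have [Gn1 Gn2] : (\sum_(e <- G) e.1 = n.1)%N /\ (\sum_(e <- G) e.2 = n.2)%N.
  by rewrite -Gn sum_pair.
have Gle e : e \in G -> (e.1 <= n.1)%N /\ (e.2 <= n.2)%N.
  by move=> eG; rewrite -Gn1 -Gn2 !(big_rem e eG)/= !leq_addr.
have Ginj e f : e \in G -> f \in G -> incl e = incl f -> e = f.
  have U : uniq (map incl G) by apply: lt_sorted_uniq; rewrite sorted_map.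
  move=> /(nthP (0, 0)%N)[i iG <-] /(nthP (0, 0)%N)[j jG <-].
  rewrite -!(nth_map _ 0)// => /eqP; rewrite nth_uniq ?size_map// => /eqP->.
  by [].
have incl_mul k l (v : nat * nat) : (0 < k)%N -> (0 < l)%N ->
    incl (k * v.1, k * v.2)%N = incl (l * v.1, l * v.2)%N.
  move=> k0 l0; rewrite /incl /inclination/= !pnatr_eq0 !muln_eq0 (gtn_eqF k0) (gtn_eqF l0)/=.
  by case: ifP => // _; rewrite !natrM -!mulf_div !divff ?pnatr_eq0 -?lt0n.
pose sel x := [seq e <- G | e.1 * (pvec x).2 == e.2 * (pvec x).1]%N.
pose nu : mults := [ffun x => inord (gcdn (head (0, 0)%N (sel x)).1 (head (0, 0)%N (sel x)).2)].
have selP e x : e \in sel x -> e \in G /\ exists2 k, (0 < k <= K)%N /\ k = gcdn e.1 e.2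
    & e = (k * (pvec x).1, k * (pvec x).2)%N.
  rewrite mem_filter => /andP[/eqP ex eG]; split => //.
  have [k [c [k0 cc ee ke]]] := coprime_decomposition (Gn0 _ eG).
  move: ex; rewrite ee /= -!mulnA => /eqP; rewrite eqn_pmul2l// => /eqP.
  move=> /(coprime_cross cc (pvec_coprime x))[c1 c2].
  exists k; last by rewrite c1 c2.
  split; last by rewrite {1}ke ee.
  rewrite k0/=; have [e1 e2] := Gle _ eG.
  have : (0 < c.1)%N || (0 < c.2)%N.
    rewrite !lt0n -negb_and; apply/negP => /andP[/eqP z1 /eqP z2].
    by move: cc; rewrite z1 z2.
  case/orP => cp.
    by apply: leq_trans nK1; apply: leq_trans e1; rewrite ee/= leq_pmulr.
  by apply: leq_trans nK2; apply: leq_trans e2; rewrite ee/= leq_pmulr.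
have nuP x : (sel x = [::] /\ nu x = 0 :> nat) \/ ((0 < nu x)%N /\ edge nu x \in G).
  rewrite /edge ffunE; case E: (sel x) => [|e s]/=.
    by left; rewrite gcd0n inordK.
  have [|eG [k [/andP[k0 kK] kE] ee]] := selP e x; first by rewrite E mem_head.
  by right; rewrite -kE inordK ?ltnS// -ee.
exists nu; apply: (@irr_sorted_eq _ (fun e f => incl e < incl f)).
- by move=> ? ? ?; exact: lt_trans.
- by move=> ?; rewrite ltxx.
- exact: line_sorted.
- by [].
move=> e; apply/mem_line/idP => [[x nx ->]|eG].
  by case: (nuP x) => [[_ n0]|[]//]; rewrite n0 in nx.
have [k [c [k0 cc ee ke]]] := coprime_decomposition (Gn0 _ eG).
have [e1 e2] := Gle _ eG.
have c1 : (c.1 <= N)%N.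
  by rewrite (leq_trans _ nN1)// (leq_trans _ e1)// ee leq_pmull.
have c2 : (c.2 <= N)%N.
  by rewrite (leq_trans _ nN2)// (leq_trans _ e2)// ee leq_pmull.
have [x xE] := pvec_exists cc c1 c2.
have ex : e \in sel x by rewrite mem_filter eG ee xE/= andbT mulnAC.
exists x; case: (nuP x) => [[s0 _]|[nx xG]]; rewrite ?s0// in ex *.
apply: Ginj => //; rewrite {1}ee /edge xE.
exact: (incl_mul _ _ c).
Qed.

End multiplicities.
End lines.

(** * Sums over polygonal lines and generating functions *)

Section sums_over_lines.
Variable R : realType.
Implicit Types (n : nat * nat) (r : R) (p : R * R).

Lemma fsbig_finType (T : finType) (P : pred T) (S : Type) (idx : S)
    (op : Monoid.com_law idx) (F : T -> S) :
  \big[op/idx]_(x \in [set x | P x]) F x = \big[op/idx]_(x | P x) F x.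
Proof.
rewrite (_ : [set x | P x] = [set` [seq x <- index_enum T | P x]]).
  by rewrite -fsbig_seq ?filter_uniq ?index_enum_uniq// big_filter.
by apply/seteqP; split=> x /=; rewrite mem_filter mem_index_enum andbT.
Qed.

(** Replaces sums over sets of lines by sums over a finite type, where products
    expand and summations exchange. *)
Lemma sum_Pi n N K (A : set polyline) (f : polyline -> R) :
  (n.1 <= N)%N -> (n.2 <= N)%N -> (n.1 <= K)%N -> (n.2 <= K)%N ->
  \sum_(G \in Pi_lines R n `&` A) f G =
  \sum_(nu : mults N K | (total nu == n) && `[<A (line R nu)>]) f (line R nu).
Proof.
move=> N1 N2 K1 K2.
rewrite (reindex_fsbig (@line R N K)
  [set nu | (total nu == n) && `[<A (line R nu)>]]); last first.
  split=> [nu /andP[/eqP nuE /asboolP nuA]|x y _ _|G [GP GA]].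
  - by split => //; split; [exact: line_convex|rewrite sum_line].
  - exact: line_inj.
  - have [nu nuE] := line_surj N1 N2 K1 K2 GP; exists nu => //.
    rewrite /= -(sum_line R nu) nuE; case: GP => _ ->; rewrite eqxx/=.
    exact/asboolP.
exact: fsbig_finType.
Qed.

Lemma esum_finType (T : finType) (f : T -> R) : (forall x, 0 <= f x) ->
  \esum_(x in [set: T]) (f x)%:E = (\sum_x f x)%:E.
Proof.
move=> f0; rewrite esum_fset; [|exact: finite_finset|by move=> x _; rewrite lee_fin].
rewrite -sumEFin -(fsbig_finType xpredT); apply: eq_fsbigl.
by apply/seteqP; split.
Qed.

Lemma esum_pvec N (f : nat * nat -> R) (C : set (nat * nat)) : (forall x, 0 <= f x) ->
  \esum_(y in C `&` range (@pvec N)) (f y)%:E =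
  (\sum_(x : prim N | `[<C (pvec x)>]) f (pvec x))%:E.
Proof.
move=> f0; rewrite big_mkcond -esum_finType/=; last by move=> x; case: ifP.
rewrite esum_mkcondl esum_image; last by move=> x y _ _; exact: pvec_inj.
apply: eq_esum => x _.
have -> : (pvec x \in C) = `[<C (pvec x)>] by apply/idP/asboolP; rewrite inE.
by case: asboolP.
Qed.

Lemma neglog_le (w : R) : 0 <= w < 1 -> neglog w <= w / (1 - w).
Proof.
move=> /andP[w0 w1]; have d0 : 0 < 1 - w by rewrite subr_gt0.
rewrite /neglog -lnV ?posrE//.
rewrite [X in ln X](_ : _ = 1 + w / (1 - w)); last by field; rewrite gt_eqF.
by apply: le_ln1Dx; rewrite (lt_le_trans (ltrN10 _))// divr_ge0// ltW.
Qed.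

(** Comparison with the exponential sum over the quadrant: p . x is at least
    min(p.1, p.2) on nonzero lattice points, which keeps 1 - exp(- p . x) away
    from 0. *)
Lemma logsum_fin C p : 0 < p.1 -> 0 < p.2 -> logsum C p \is a fin_num.
Proof.
move=> p1 p2; rewrite ge0_fin_numE ?logsum_ge0//.
pose q := Num.min p.1 p.2.
have q0 : 0 < q by rewrite lt_min p1 p2.
have d0 : 0 < 1 - expR (- q) by rewrite subr_gt0 expR_lt1 oppr_lt0.
have le x : primitive x -> neglog (expR (- dotp p x)) <= (1 - expR (- q))^-1 * expR (- dotp p x).
  move=> /primitive_neq0 x0; have xq : q <= dotp p x.
    move: x0; case: x => a b; rewrite xpair_eqE negb_and -!lt0n /dotp/= => ab.
    have qp1 : q <= p.1 by rewrite ge_min lexx.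
    have qp2 : q <= p.2 by rewrite ge_min lexx orbT.
    have q1 : q * a%:R <= p.1 * a%:R by rewrite ler_wpM2r.
    have q2 : q * b%:R <= p.2 * b%:R by rewrite ler_wpM2r.
    apply: le_trans (lerD q1 q2); rewrite -mulrDr ler_peMr ?(ltW q0)// -natrD ler1n.
    by rewrite addn_gt0.
  have e : expR (- dotp p x) <= expR (- q) by rewrite ler_expR lerN2.
  have w01 : 0 <= expR (- dotp p x) < 1.
    by rewrite expR_ge0/= (le_lt_trans e)// expR_lt1 oppr_lt0.
  apply: le_trans (neglog_le w01) _; rewrite mulrC ler_wpM2r ?expR_ge0//.
  by rewrite lef_pV2 ?posrE ?lerB// subr_gt0; case/andP: w01.
apply: (@le_lt_trans _ _
  (\esum_(x in setT) ((1 - expR (- q))^-1 * expR (- dotp p x))%:E)%E).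
  apply: (@le_trans _ _ (\esum_(x in C `&` primitive) ((1 - expR (- q))^-1 * expR (- dotp p x))%:E)%E).
    by apply: le_esum => x [_ /le]; rewrite lee_fin.
  exact: subset_esum.
rewrite (esum_EFinZl _ _ (esum_quadrant p1 p2)) ?ltry//.
by rewrite invr_ge0 ltW.
Qed.

Lemma neglog_sum_le N C p : 0 < p.1 -> 0 < p.2 ->
  \sum_(x : prim N | `[<C (pvec x)>]) neglog (expR (- dotp p (pvec x)))
    <= fine (logsum C p).
Proof.
move=> p1 p2; rewrite -lee_fin fineK ?logsum_fin//.
rewrite -(esum_pvec _ (f := fun y => neglog (expR (- dotp p y)))).
  apply: subset_esum => x [Cx [y _ yx]]; split => //.
  by rewrite -yx; exact: (pvec_coprime y).
by move=> x; rewrite neglog_ge0 ?expR_ge0.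
Qed.

(** A sum of nonnegative terms is nearly attained on a finite set of primitive
    vectors, and such a set lies in a box. *)
Lemma neglog_sum_ge p (delta : R) M : 0 < p.1 -> 0 < p.2 -> 0 < delta ->
  exists2 N, (M <= N)%N & fine (logsum setT p) - delta <=
    \sum_(x : prim N) neglog (expR (- dotp p (pvec x))).
Proof.
move=> p1 p2 d0.
have d0' : (0 < delta%:E)%E by rewrite lte_fin.
have [_ [X [finX XP] <-] h] := ub_ereal_sup_adherent d0' (logsum_fin setT p1 p2).
have /finite_seqP[s Xs] := finX.
exists (maxn M (\max_(x <- s) maxn x.1 x.2)); first exact: leq_maxl.
set N := maxn _ _.
rewrite -lee_fin EFinB fineK ?logsum_fin//; apply: le_trans (ltW h) _.
have f0 x : 0 <= neglog (expR (- dotp p x)) by rewrite neglog_ge0 ?expR_ge0.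
have -> : \sum_(x : prim N) neglog (expR (- dotp p (pvec x))) =
    \sum_(x : prim N | `[<setT (pvec x)>]) neglog (expR (- dotp p (pvec x))).
  by apply: eq_bigl => x; apply/esym/asboolP.
rewrite -(esum_pvec _ setT f0) -esum_fset//; last by move=> x _; rewrite lee_fin.
apply: subset_esum => -[a b] Xx; split=> //.
have [_ cab] := XP _ Xx.
have abN : (maxn a b <= N)%N.
  rewrite leq_max; apply/orP; right.
  by apply: (@leq_bigmax_seq _ s xpredT (fun x => maxn x.1 x.2) (a, b)); rewrite // -/([set` s] _) -Xs.
have [||x xE] := pvec_exists (c := (a, b)) (N := N) cab.
- exact: leq_trans (leq_maxl a b) abN.
- exact: leq_trans (leq_maxr a b) abN.
by exists x.
Qed.

End sums_over_lines.

Section generating_functions.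
Variables (R : realType) (r : R).
Hypothesis r0 : 0 < r.

Section box.
Variables N K : nat.
Implicit Types (nu : mults N K) (l : nat * nat -> R) (x : prim N).

Definition mweight nu : R := \prod_x bcoef r (nu x).

Definition cost l nu : R := \sum_x (nu x)%:R * l (pvec x).

Lemma mweight_gt0 nu : 0 < mweight nu.
Proof. by apply: prodr_gt0 => x _; exact: bcoef_gt0. Qed.

Lemma mweight_ge0 nu : 0 <= mweight nu.
Proof. exact/ltW/mweight_gt0. Qed.

(** Choosing a term in each factor of the product is choosing a multiplicity
    for each direction. *)
Lemma generating_function l :
  \sum_nu mweight nu * expR (- cost l nu) =
  \prod_(x : prim N) binomial_sum r K.+1 (expR (- l (pvec x))).
Proof.
rewrite /binomial_sum bigA_distr_bigA; apply: eq_bigr => nu _.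
rewrite /mweight /cost -sumrN expR_sum -big_split; apply: eq_bigr => x _ /=.
by rewrite -mulrN expRM_natl.
Qed.

Lemma generating_function_le l : (forall x, 0 < l (pvec x)) ->
  \sum_nu mweight nu * expR (- cost l nu) <=
  expR (r * \sum_(x : prim N) neglog (expR (- l (pvec x)))).
Proof.
move=> l0; rewrite generating_function mulr_sumr expR_sum.
apply: ler_prod => x _; rewrite binomial_sum_ge0 ?expR_ge0//=.
by rewrite binomial_sum_le// expR_ge0 expR_lt1 oppr_lt0 l0.
Qed.

(** The exponential Chebyshev inequality: on P the cost for l exceeds the cost
    for l' by at least g, which gives the factor exp(- g); extending the sum
    beyond P then gives the generating function for l'. *)
Lemma chernoff_tilted (P : pred (mults N K)) l l' g : (forall x, 0 < l' (pvec x)) ->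
  (forall nu, P nu -> cost l' nu + g <= cost l nu) ->
  \sum_(nu | P nu) mweight nu * expR (- cost l nu) <=
  expR (- g + r * \sum_(x : prim N) neglog (expR (- l' (pvec x)))).
Proof.
move=> l0 ll; rewrite expRD -ler_pdivrMl ?expR_gt0// -expRN opprK.
apply: le_trans (generating_function_le l0); rewrite mulr_sumr big_mkcond/=.
apply: ler_sum => nu _; case: ifPn => [Pnu|_]; last first.
  by rewrite mulr_ge0 ?mweight_ge0 ?expR_ge0.
rewrite mulrCA ler_pM2l ?mweight_gt0// -expRD ler_expR.
by have := ll nu Pnu; lra.
Qed.

Lemma chernoff (P : pred (mults N K)) l c : (forall x, 0 < l (pvec x)) ->
  (forall nu, P nu -> cost l nu <= c) ->
  \sum_(nu | P nu) mweight nu <=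
  expR (c + r * \sum_(x : prim N) neglog (expR (- l (pvec x)))).
Proof.
move=> l0 lc.
have c0 nu : cost (fun=> 0) nu = 0 by rewrite /cost big1// => x _; rewrite mulr0.
have := @chernoff_tilted P (fun=> 0) l (- c) l0; rewrite opprK.
under eq_bigr do rewrite c0 oppr0 expR0 mulr1.
by apply=> nu /lc; rewrite c0 subr_le0.
Qed.

Lemma cost_dotp (p : R * R) nu :
  cost (dotp p) nu = p.1 * (total nu).1%:R + p.2 * (total nu).2%:R.
Proof.
rewrite /cost /total/= !natr_sum !mulr_sumr -big_split; apply: eq_bigr => x _ /=.
by rewrite /dotp !natrM; ring.
Qed.

(** Adding j copies of one primitive vector loses at most a factor linear in
    the final multiplicity: k b_k is nondecreasing in k. *)
Lemma bcoef_addn k j : Num.min 1 r * bcoef r k <= (k + j).+1%:R * bcoef r (k + j).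
Proof.
have m0 : 0 < Num.min 1 r by rewrite lt_min ltr01 r0.
have m1 : Num.min 1 r <= 1 by rewrite ge_min lexx.
have mr : Num.min 1 r <= r by rewrite ge_min lexx orbT.
case: j => [|j].
  rewrite addn0 ler_wpM2r ?bcoef_ge0//; apply: le_trans m1 _.
  by rewrite ler1n.
have key i : Num.min 1 r * bcoef r k <= (k + i).+1%:R * bcoef r (k + i).+1.
  elim: i => [|i ih].
    by rewrite addn0 bcoefS ler_wpM2r ?bcoef_ge0//; apply: le_trans mr _; rewrite lerDl.
  apply: le_trans ih _; rewrite addnS (bcoefS r (k + i).+1).
  by rewrite ler_wpM2r ?bcoef_ge0// lerDr ltW.
rewrite addnS; apply: le_trans (key j) _.
by rewrite ler_wpM2r ?bcoef_ge0// ler_nat.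
Qed.

Definition shift x0 j nu : mults N K := [ffun x => inord (nu x + (x == x0) * j)].

Lemma shiftE x0 j nu x : (nu x0 + j <= K)%N ->
  shift x0 j nu x = (nu x + (x == x0) * j)%N :> nat.
Proof.
move=> h; rewrite ffunE inordK// ltnS; case: eqP => [->|_]; first by rewrite mul1n.
by rewrite addn0 -ltnS ltn_ord.
Qed.

Lemma total_shift x0 j nu : (nu x0 + j <= K)%N ->
  total (shift x0 j nu) =
  ((total nu).1 + j * (pvec x0).1, (total nu).2 + j * (pvec x0).2)%N.
Proof.
move=> h; have E (f : prim N -> nat) :
    (\sum_x shift x0 j nu x * f x = \sum_x nu x * f x + j * f x0)%N.
  under eq_bigr do rewrite shiftE// mulnDl.
  rewrite big_split/=; congr addn.
  rewrite (bigD1 x0)//= eqxx mul1n big1 ?addn0// => x /negbTE->.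
  by rewrite !mul0n.
by rewrite /total !E.
Qed.

Lemma mweight_shift x0 j B nu : (nu x0 + j <= B)%N -> (B <= K)%N ->
  mweight nu <= B.+1%:R / Num.min 1 r * mweight (shift x0 j nu).
Proof.
move=> jB BK; have jK := leq_trans jB BK.
have m0 : 0 < Num.min 1 r by rewrite lt_min ltr01 r0.
rewrite /mweight (bigD1 x0)//= [in leRHS](bigD1 x0)//= mulrA.
have -> : \prod_(i | i != x0) bcoef r (shift x0 j nu i) =
    \prod_(i | i != x0) bcoef r (nu i).
  by apply: eq_bigr => x /negbTE xx0; rewrite shiftE// xx0 addn0.
apply: ler_wpM2r; first by apply: prodr_ge0 => x _; exact: bcoef_ge0.
rewrite shiftE// eqxx mul1n mulrAC ler_pdivlMr// mulrC.
apply: le_trans (bcoef_addn _ j) _.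
by rewrite ler_wpM2r ?bcoef_ge0// ler_nat ltnS.
Qed.

Lemma shift_inj x0 j nu nu' : (nu x0 + j <= K)%N -> (nu' x0 + j <= K)%N ->
  shift x0 j nu = shift x0 j nu' -> nu = nu'.
Proof.
move=> h h' e; apply/ffunP => x; apply: val_inj => /=.
by apply/eqP; rewrite -(eqn_add2r ((x == x0) * j)) -!shiftE// e.
Qed.

Lemma shift_sum x0 j B (P P' : pred (mults N K)) : (B <= K)%N ->
  (forall nu, P nu -> (nu x0 + j <= B)%N /\ P' (shift x0 j nu)) ->
  \sum_(nu | P nu) mweight nu
    <= B.+1%:R / Num.min 1 r * \sum_(nu | P' nu) mweight nu.
Proof.
move=> BK PP'; have m0 : 0 < Num.min 1 r by rewrite lt_min ltr01 r0.
apply: (@le_trans _ _ (\sum_(nu | P nu) B.+1%:R / Num.min 1 r * mweight (shift x0 j nu))).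
  by apply: ler_sum => nu /PP'[h _]; exact: mweight_shift.
rewrite -mulr_sumr; apply: ler_wpM2l; first by rewrite divr_ge0// ltW.
pose sP := [set nu in P]%SET.
have inj : {in sP &, injective (shift x0 j)}.
  move=> nu nu'; rewrite !inE => /PP'[h _] /PP'[h' _].
  by apply: shift_inj; exact: leq_trans BK.
have -> : \sum_(nu | P nu) mweight (shift x0 j nu) =
    \sum_(nu in [set shift x0 j nu | nu in sP]%SET) mweight nu.
  by rewrite big_imset//; apply: eq_bigl => nu; rewrite inE.
rewrite [leLHS]big_mkcond [leRHS]big_mkcond/=; apply: ler_sum => nu _.
case: ifPn => [/imsetP[nu']|_]; last by case: ifP => // _; exact: mweight_ge0.
by rewrite inE => /PP'[_ h] ->; rewrite h.
Qed.

End box.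

Section box_sums.
Variables N K : nat.

Lemma mult_le_total (nu : mults N K) x :
  (nu x * (pvec x).1 <= (total nu).1)%N /\ (nu x * (pvec x).2 <= (total nu).2)%N.
Proof. by rewrite /total/=; split; rewrite (bigD1 x)//= leq_addr. Qed.

(** Lengthening the horizontal and the vertical edge turns a line ending at m
    into one ending at n, at polynomial cost. *)
Lemma total_sum_le (m n : nat * nat) : (0 < N)%N -> (n.1 <= K)%N -> (n.2 <= K)%N ->
  (m.1 <= n.1)%N -> (m.2 <= n.2)%N ->
  \sum_(nu : mults N K | total nu == m) mweight nu <=
  n.1.+1%:R / Num.min 1 r * (n.2.+1%:R / Num.min 1 r *
  \sum_(nu : mults N K | total nu == n) mweight nu).
Proof.
move=> N0 nK1 nK2 mn1 mn2; have m0 : 0 < Num.min 1 r by rewrite lt_min ltr01 r0.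
have [x1 x1E] := pvec_exists (c := (1, 0)%N) isT N0 (leq0n N).
have [x2 x2E] := pvec_exists (c := (0, 1)%N) isT (leq0n N) N0.
apply: (@le_trans _ _ (n.1.+1%:R / Num.min 1 r *
    \sum_(nu : mults N K | total nu == (n.1, m.2)) mweight nu)).
  apply: (@shift_sum _ _ x1 (n.1 - m.1)) => // nu /eqP nuE.
  have [+ _] := mult_le_total nu x1; rewrite x1E nuE muln1 => h.
  have h2 : (nu x1 + (n.1 - m.1) <= n.1)%N by rewrite -{2}(subnKC mn1) leq_add2r.
  split => //; rewrite total_shift ?(leq_trans h2)// nuE x1E muln1 muln0 addn0.
  by rewrite subnKC.
apply: ler_wpM2l; first by rewrite divr_ge0// ltW.
apply: (@shift_sum _ _ x2 (n.2 - m.2)) => // nu /eqP nuE.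
have [_] := mult_le_total nu x2; rewrite x2E nuE muln1 => h.
have h2 : (nu x2 + (n.2 - m.2) <= n.2)%N by rewrite -{2}(subnKC mn2) leq_add2r.
split => //; rewrite total_shift ?(leq_trans h2)// nuE x2E muln1 muln0 addn0/=.
by rewrite subnKC// -surjective_pairing.
Qed.

(** There are only (n.1 + 1) (n.2 + 1) endpoints to which total_sum_le applies. *)
Lemma box_sum_le (n : nat * nat) : (0 < N)%N -> (n.1 <= K)%N -> (n.2 <= K)%N ->
  \sum_(nu : mults N K | ((total nu).1 <= n.1)%N && ((total nu).2 <= n.2)%N) mweight nu <=
  (n.1.+1%:R * n.2.+1%:R / Num.min 1 r) ^+ 2 *
    \sum_(nu : mults N K | total nu == n) mweight nu.
Proof.
move=> N0 nK1 nK2; have m0 : 0 < Num.min 1 r by rewrite lt_min ltr01 r0.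
pose g (nu : mults N K) : 'I_n.1.+1 * 'I_n.2.+1 :=
  (inord (total nu).1, inord (total nu).2).
rewrite (partition_big g xpredT)//=.
pose Z := \sum_(nu : mults N K | total nu == n) mweight nu.
apply: (@le_trans _ _ (\sum_(ij : 'I_n.1.+1 * 'I_n.2.+1)
    (n.1.+1%:R / Num.min 1 r * (n.2.+1%:R / Num.min 1 r * Z)))).
  apply: ler_sum => -[i j] _.
  have i1 : (i <= n.1)%N by rewrite -ltnS.
  have j2 : (j <= n.2)%N by rewrite -ltnS.
  have := @total_sum_le (nat_of_ord i, nat_of_ord j) n N0 nK1 nK2 i1 j2.
  rewrite -/Z; move: (_ / _ * (_ / _ * Z)) => b; apply: le_trans.
  rewrite big_mkcond [leRHS]big_mkcond/=; apply: ler_sum => nu _.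
  case: ifPn => [/andP[/andP[t1 t2] /eqP[e1 e2]]|_].
    by rewrite ifT// -e1 -e2 /= !inordK ?ltnS//; case: (total nu).
  by case: ifP => // _; exact: mweight_ge0.
rewrite sumr_const card_prod !card_ord -[leLHS]mulr_natr natrM.
rewrite -/Z le_eqVlt; apply/orP; left; apply/eqP.
move: (n.1.+1%:R) (n.2.+1%:R) => a b.
by field; rewrite gt_eqF.
Qed.

End box_sums.

Lemma cvg_prod_seq (I : finType) (u : I -> nat -> R) (a : I -> R) :
  (forall i, u i k @[k --> \oo] --> a i) ->
  (\prod_i u i k) @[k --> \oo] --> \prod_i a i.
Proof.
move=> ua; elim: (index_enum I) => [|i s ih].
  under eq_fun do rewrite big_nil.
  by rewrite big_nil; exact: cvg_cst.
under eq_fun do rewrite big_cons.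
by rewrite big_cons; exact: cvgM (ua i) ih.
Qed.

(** With enough directions and multiplicities the finite generating function
    captures half of the infinite product. *)
Lemma generating_function_ge (p : R * R) M : 0 < p.1 -> 0 < p.2 ->
  exists N K, [/\ (M <= N)%N, (M <= K)%N &
    2^-1 * expR (r * fine (logsum setT p)) <=
    \sum_(nu : mults N K) mweight nu * expR (- cost (dotp p) nu)].
Proof.
move=> p1 p2.
have d0 : 0 < (4 * r)^-1 by rewrite invr_gt0 mulr_gt0.
have [N MN hN] := neglog_sum_ge M p1 p2 d0.
set S := \sum_(_ : _) _ in hN.
have : (fun k => \prod_(x : prim N) binomial_sum r k (expR (- dotp p (pvec x))))
    @ \oo --> expR (r * S).
  rewrite /S mulr_sumr expR_sum; apply: cvg_prod_seq => x.
  apply: binomial_sum_cvg => //; rewrite expR_ge0 expR_lt1 oppr_lt0.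
  exact: dotp_gt0 (pvec_neq0 x).
(* One third is lost in truncating the series and one quarter in truncating the
   product, by exp(- 1/4) >= 3/4; then (2/3) (3/4) = 1/2. *)
have e3 : 0 < expR (r * S) / 3 by rewrite divr_gt0 ?expR_gt0.
move=> /cvgrPdist_le/(_ _ e3)[K _ hK].
exists N, (maxn M K); split; rewrite ?leq_maxl//.
rewrite generating_function.
have := hK (maxn M K).+1 (leq_trans (leq_maxr M K) (leqnSn _)).
rewrite /= ler_norml => /andP[_ h].
have h1 : 2 / 3 * expR (r * S) <= \prod_(x : prim N) binomial_sum r (maxn M K).+1 (expR (- dotp p (pvec x))).
  by move: h; lra.
apply: le_trans h1.
have h2 : expR (r * fine (logsum setT p)) * (3 / 4) <= expR (r * S).
  apply: (@le_trans _ _ (expR (r * fine (logsum setT p)) * expR (- 4^-1))).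
    by rewrite ler_pM2l ?expR_gt0//; have := expR_ge1Dx (- 4^-1 : R); lra.
  rewrite -expRD ler_expR; have := ler_wpM2l (ltW r0) hN.
  rewrite mulrBr; have -> : r * (4 * r)^-1 = 4^-1 by field; rewrite gt_eqF.
  by [].
lra.
Qed.

End generating_functions.

(** * The exponential rate of the total weight *)

Section sector.
Variables (R : realType) (c1 c2 : R).
Implicit Types (n : nat * nat).

#[local] Instance to_infty_filter : Filter (to_infty c1 c2).
Proof. by apply: within_filter. Qed.

Lemma near_sector : \forall n \near to_infty c1 c2, c1 <= n.2%:R / n.1%:R <= c2.
Proof. exact: withinT. Qed.

Lemma near_large M : \forall n \near to_infty c1 c2, (M <= n.1)%N /\ (M <= n.2)%N.
Proof.
apply: cvg_within; exists ([set k | (M <= k)%N], [set k | (M <= k)%N]).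
  by split; exists M.
by move=> [a b].
Qed.

(** An explicit threshold, from which properties near infinity can be read along
    a sequence. *)
Lemma near_sectorP (P : nat * nat -> Prop) : (\forall n \near to_infty c1 c2, P n) ->
  exists M, forall n, (M <= n.1)%N -> (M <= n.2)%N -> c1 <= n.2%:R / n.1%:R <= c2 -> P n.
Proof.
move=> [[A B] [/= [M1 _ h1] [M2 _ h2]] h]; exists (maxn M1 M2) => -[a b] /= Ma Mb.
apply: (h (a, b)); split => /=.
  by apply: h1 => /=; exact: leq_trans (leq_maxl _ _) Ma.
by apply: h2 => /=; exact: leq_trans (leq_maxr _ _) Mb.
Qed.

End sector.

Section rate.
Variables (R : realType) (c1 c2 r L : R).
Hypothesis c1_gt0 : 0 < c1.
Hypothesis c12 : c1 <= c2.
Hypothesis r0 : 0 < r.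
Hypothesis L0 : 0 < L.
Implicit Types (n : nat * nat).

#[local] Existing Instance to_infty_filter.

(** The common scale of all exponents, the cube root of r L n1 n2. *)
Definition exponent n : R := expR (ln (r * L * n.1%:R * n.2%:R) / 3).

Local Notation y := exponent.

Lemma exponent_gt0 n : 0 < y n. Proof. exact: expR_gt0. Qed.

Lemma exponentX3 n : (0 < n.1)%N -> (0 < n.2)%N ->
  y n ^+ 3 = r * L * n.1%:R * n.2%:R.
Proof.
move=> n1 n2; rewrite /exponent -expRM_natl mulrC divfK// lnK// posrE.
by rewrite !mulr_gt0 ?ltr0n.
Qed.

Lemma near_positive : \forall n \near to_infty c1 c2, (0 < n.1)%N /\ (0 < n.2)%N.
Proof. exact: near_large. Qed.

Lemma near_sector_mul : \forall n \near to_infty c1 c2,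
  c1 * n.1%:R <= n.2%:R /\ n.2%:R <= c2 * n.1%:R.
Proof.
have := near_positive; apply: filterS2 (near_sector c1 c2) => n /andP[h1 h2] [n1 _].
by move: h1 h2; rewrite ler_pdivlMr ?ltr0n// ler_pdivrMr ?ltr0n.
Qed.

Lemma near_natr_large (B : R) : \forall n \near to_infty c1 c2,
  B <= n.1%:R /\ B <= n.2%:R.
Proof.
apply: filterS (near_large c1 c2 (Num.truncn B).+1) => n [n1 n2].
have h : B < (Num.truncn B).+1%:R by exact: truncnS_gt.
by split; apply: le_trans (ltW h) _; rewrite ler_nat.
Qed.

Lemma exponent_ge (B : R) : \forall n \near to_infty c1 c2, B <= y n.
Proof.
near=> n; have [n1 n2] : (0 < n.1)%N /\ (0 < n.2)%N by near: n; exact: near_positive.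
have [h1 h2] : Num.max 1 (`|B| ^+ 3 / (r * L)) <= n.1%:R /\
   Num.max 1 (`|B| ^+ 3 / (r * L)) <= n.2%:R by near: n; exact: near_natr_large.
apply: le_trans (ler_norm B) _.
rewrite -(@ler_pXn2r _ 3) ?nnegrE ?(ltW (exponent_gt0 n))//.
rewrite exponentX3//.
move: h1 h2; rewrite !ge_max => /andP[a1 a2] /andP[b1 b2].
apply: (@le_trans _ _ (r * L * n.1%:R)).
  by rewrite mulrC -ler_pdivrMr ?mulr_gt0.
by rewrite ler_peMr// !mulr_ge0// ltW.
Unshelve. all: by end_near. Qed.

Lemma exponent_small (h : R) : 0 < h -> \forall n \near to_infty c1 c2,
  y n / n.1%:R <= h /\ y n / n.2%:R <= h.
Proof.
move=> h0; near=> n.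
have [n1 n2] : (0 < n.1)%N /\ (0 < n.2)%N by near: n; exact: near_positive.
have [s1 s2] : c1 * n.1%:R <= n.2%:R /\ n.2%:R <= c2 * n.1%:R.
  by near: n; exact: near_sector_mul.
have h3 : 0 < h ^+ 3 by rewrite exprn_gt0.
have [h1 h2] : Num.max (r * L * c2 / h ^+ 3) (r * L / c1 / h ^+ 3) <= n.1%:R /\
   Num.max (r * L * c2 / h ^+ 3) (r * L / c1 / h ^+ 3) <= n.2%:R.
  by near: n; exact: near_natr_large.
have p1 : (0 : R) < n.1%:R by rewrite ltr0n.
have p2 : (0 : R) < n.2%:R by rewrite ltr0n.
have yp := ltW (exponent_gt0 n).
move: h1 h2; rewrite !ge_max => /andP[a1 a2] /andP[b1 b2].
suff [u1 u2] : (y n / n.1%:R) ^+ 3 <= h ^+ 3 /\ (y n / n.2%:R) ^+ 3 <= h ^+ 3.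
  by split; rewrite -(@ler_pXn2r _ 3) ?nnegrE ?divr_ge0 ?(ltW h0) ?(ltW (exponent_gt0 n)).
rewrite !exprMn !exprVn exponentX3// !ler_pdivrMr ?exprn_gt0//; split.
  have e : r * L * c2 <= h ^+ 3 * n.1%:R by rewrite -ler_pdivrMl// mulrC.
  apply: (@le_trans _ _ (r * L * n.1%:R * (c2 * n.1%:R))).
    by rewrite ler_wpM2l// !mulr_ge0// ltW.
  have -> : r * L * n.1%:R * (c2 * n.1%:R) = r * L * c2 * n.1%:R ^+ 2 by ring.
  have -> : h ^+ 3 * n.1%:R ^+ 3 = h ^+ 3 * n.1%:R * n.1%:R ^+ 2 by ring.
  by rewrite ler_wpM2r// sqr_ge0.
have e : r * L / c1 <= h ^+ 3 * n.2%:R by rewrite -ler_pdivrMl// mulrC.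
apply: (@le_trans _ _ (r * L * (n.2%:R / c1) * n.2%:R)).
  rewrite ler_wpM2r ?(ltW p2)// ler_wpM2l ?mulr_ge0 ?(ltW r0) ?(ltW L0)//.
  by rewrite ler_pdivlMr// mulrC.
have -> : r * L * (n.2%:R / c1) * n.2%:R = r * L / c1 * n.2%:R ^+ 2 by ring.
have -> : h ^+ 3 * n.2%:R ^+ 3 = h ^+ 3 * n.2%:R * n.2%:R ^+ 2 by ring.
by rewrite ler_wpM2r// sqr_ge0.
Unshelve. all: by end_near. Qed.

Hypothesis logsum_L : logsum_constant L.

(** In this parameter every line ending at n has the cost (a1 + a2) y. *)
Definition tilt (a1 a2 : R) n : R * R := (a1 * (y n / n.1%:R), a2 * (y n / n.2%:R)).

(** For p = tilt a1 a2 n the product p.1 p.2 is a1 a2 y^2 / (n.1 n.2), which is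
    a1 a2 r L / y by the choice of y, so r L V / (p.1 p.2) is y V / (a1 a2). *)
Lemma near_logsum (eta : R) : 0 < eta -> \forall n \near to_infty c1 c2,
  forall (a1 a2 : R) C V, 1 / 2 <= a1 <= 2 -> 1 / 2 <= a2 <= 2 -> has_density C V ->
  `|r * fine (logsum C (tilt a1 a2 n)) - y n * (V (tilt a1 a2 n) / (a1 * a2))|
    <= eta * y n.
Proof.
move=> eta0; pose c := Num.max (4 * c2) (4 / c1).
have c20 : 0 < c2 by apply: lt_le_trans c12.
have c0 : 0 < c by rewrite lt_max mulr_gt0.
have e0 : 0 < eta * L / 4 by rewrite divr_gt0 ?mulr_gt0.
have [h0 h00 H] := logsum_L c0 e0.
have h4 : 0 < h0 / 4 by rewrite divr_gt0.
near=> n.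
have [n1 n2] : (0 < n.1)%N /\ (0 < n.2)%N by near: n; exact: near_positive.
have [s1 s2] : c1 * n.1%:R <= n.2%:R /\ n.2%:R <= c2 * n.1%:R.
  by near: n; exact: near_sector_mul.
have [y1 y2] : y n / n.1%:R <= h0 / 4 /\ y n / n.2%:R <= h0 / 4.
  by near: n; exact: (exponent_small h4).
move=> a1 a2 C V /andP[a11 a12] /andP[a21 a22] CV.
have p1 : (0 : R) < n.1%:R by rewrite ltr0n.
have p2 : (0 : R) < n.2%:R by rewrite ltr0n.
have y0 := exponent_gt0 n; have y3 := exponentX3 n1 n2.
have a10 : 0 < a1 by lra.
have a20 : 0 < a2 by lra.
set b1 := y n / n.1%:R in y1 *; set b2 := y n / n.2%:R in y2 *.
have b10 : 0 < b1 by rewrite divr_gt0.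
have b20 : 0 < b2 by rewrite divr_gt0.
have b12 : b1 <= c2 * b2.
  by rewrite mulrCA ler_pM2l// ler_pdivlMr// ler_pdivrMl// mulrC.
have b21 : c1 * b2 <= b1.
  by rewrite mulrCA ler_pM2l// ler_pdivrMr// ler_pdivlMl// mulrC.
have bb : b1 * b2 = r * L / y n.
  have -> : b1 * b2 = y n ^+ 2 / (n.1%:R * n.2%:R).
    by rewrite /b1 /b2; field; rewrite !gt_eqF.
  have -> : r * L = y n ^+ 3 / (n.1%:R * n.2%:R) by rewrite y3; field; rewrite !gt_eqF.
  by field; rewrite !gt_eqF.
have a12p : 1 / 4 <= a1 * a2.
  have -> : 1 / 4 = (1 / 2) * (1 / 2) :> R by field.
  by rewrite ler_pM//; lra.
have := H C V CV (tilt a1 a2 n); rewrite /tilt /= -/b1 -/b2.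
have q1 : 0 < a1 * b1 < h0 by rewrite mulr_gt0//=; nra.
have q2 : 0 < a2 * b2 < h0 by rewrite mulr_gt0//=; nra.
have c4 : 4 * c2 <= c by rewrite le_max lexx.
have c4' : 4 / c1 <= c by rewrite le_max lexx orbT.
have r1 : a1 * b1 <= c * (a2 * b2).
  apply: (@le_trans _ _ (4 * c2 * (a2 * b2))); last by rewrite ler_wpM2r// mulr_ge0// ltW.
  apply: (@le_trans _ _ (2 * (c2 * b2))); first by rewrite ler_pM// ltW.
  have -> : 4 * c2 * (a2 * b2) = 4 * a2 * (c2 * b2) by ring.
  by rewrite ler_wpM2r ?mulr_ge0 ?(ltW c20) ?(ltW b20)//; lra.
have r2 : a2 * b2 <= c * (a1 * b1).
  apply: (@le_trans _ _ (4 / c1 * (a1 * b1))); last by rewrite ler_wpM2r// mulr_ge0// ltW.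
  have b2c : b2 <= b1 / c1 by rewrite ler_pdivlMr// mulrC.
  apply: (@le_trans _ _ (2 * (b1 / c1))); first by rewrite ler_pM// ltW.
  have -> : 4 / c1 * (a1 * b1) = 4 * a1 * (b1 / c1) by ring.
  by rewrite ler_wpM2r ?divr_ge0 ?(ltW b10) ?(ltW c1_gt0)//; lra.
move=> /(_ q1 q2 r1 r2); set F := fine _; set v := V _ => HF.
pose k := y n / (a1 * a2 * L).
have k0 : 0 < k by rewrite divr_gt0 ?mulr_gt0.
have a120 : 0 < a1 * a2 by rewrite mulr_gt0.
have -> : r * F - y n * (v / (a1 * a2)) = k * (a1 * b1 * (a2 * b2) * F - L * v).
  have -> : a1 * b1 * (a2 * b2) = a1 * a2 * (b1 * b2) by ring.
  by rewrite bb /k; field; rewrite !gt_eqF.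
rewrite normrM (gtr0_norm k0).
apply: (@le_trans _ _ (k * (eta * L / 4))); first by rewrite ler_pM2l.
have -> : k * (eta * L / 4) = eta * y n * (1 / 4 / (a1 * a2)).
  by rewrite /k; field; rewrite !gt_eqF.
rewrite ler_piMr ?mulr_ge0 ?(ltW eta0) ?(ltW y0)//.
by rewrite ler_pdivrMr// [leRHS]mul1r.
Unshelve. all: by end_near. Qed.

(** As n.1 n.2 is a constant multiple of y^3, the polynomial is O(y^6), and the
    seventh term of the exponential series exceeds it. *)
Lemma near_poly (eta A : R) : 0 < eta ->
  \forall n \near to_infty c1 c2,
    A * (n.1.+1%:R * n.2.+1%:R) ^+ 2 <= expR (eta * y n).
Proof.
move=> eta0; pose B := `|A| * (4 / (r * L)) ^+ 2.
near=> n.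
have [n1 n2] : (0 < n.1)%N /\ (0 < n.2)%N by near: n; exact: near_positive.
have yB : Num.max 1 (B * 7`!%:R / eta ^+ 7) <= y n by near: n; exact: exponent_ge.
move: yB; rewrite ge_max => /andP[y1 yB].
have y0 := exponent_gt0 n; have y3 := exponentX3 n1 n2.
apply: (@le_trans _ _ (B * y n ^+ 6)).
  have -> : B * y n ^+ 6 = `|A| * (4 * n.1%:R * n.2%:R) ^+ 2.
    have -> : y n ^+ 6 = (y n ^+ 3) ^+ 2 by rewrite -exprM.
    by rewrite y3 /B; field; rewrite !gt_eqF.
  apply: (@le_trans _ _ (`|A| * (n.1.+1%:R * n.2.+1%:R) ^+ 2)).
    by rewrite ler_wpM2r ?sqr_ge0 ?ler_norm.
  rewrite ler_wpM2l// lerXn2r ?nnegrE ?mulr_ge0//.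
  have -> : 4 * n.1%:R * n.2%:R = (2 * n.1%:R) * (2 * n.2%:R) :> R by ring.
  by apply: ler_pM => //; rewrite -natrM ler_nat mul2n -addnn -addn1 leq_add2l.
apply: le_trans (expR_ge1Dxn 6 _); last by rewrite mulr_ge0// ltW.
apply: (@le_trans _ _ ((eta * y n) ^+ 7 / 7`!%:R)); last by rewrite lerDr.
rewrite ler_pdivlMr ?ltr0n ?fact_gt0//.
have e : B * 7`!%:R <= y n * eta ^+ 7 by rewrite -ler_pdivrMr ?exprn_gt0.
have -> : (eta * y n) ^+ 7 = y n * eta ^+ 7 * y n ^+ 6 by ring.
by rewrite mulrAC ler_wpM2r// exprn_ge0// ltW.
Unshelve. all: by end_near. Qed.

End rate.

Section total_weight.
Variables (R : realType) (c1 c2 r L : R).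
Hypothesis c1_gt0 : 0 < c1.
Hypothesis c12 : c1 <= c2.
Hypothesis r0 : 0 < r.
Hypothesis L0 : 0 < L.
Hypothesis logsum_L : logsum_constant L.
Implicit Types (n : nat * nat).

#[local] Existing Instance to_infty_filter.

Local Notation y := (exponent r L).
Local Notation tilt := (tilt r L).

Definition total_weight n : R := \sum_(G \in Pi_lines R n) bweight r G.

Lemma total_weightE n N K :
  (n.1 <= N)%N -> (n.2 <= N)%N -> (n.1 <= K)%N -> (n.2 <= K)%N ->
  total_weight n = \sum_(nu : mults N K | total nu == n) mweight r nu.
Proof.
move=> N1 N2 K1 K2; rewrite /total_weight -[Pi_lines R n]setIT (sum_Pi _ _ N1 N2 K1 K2).
apply: eq_big => nu; last by rewrite bweight_line.
by have -> : `[<[set: polyline] (line R nu)>] = true by [apply/asboolP]; rewrite andbT.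
Qed.

Lemma neglog_sumT_le N (p : R * R) : 0 < p.1 -> 0 < p.2 ->
  \sum_(x : prim N) neglog (expR (- dotp p (pvec x))) <= fine (logsum setT p).
Proof.
move=> p1 p2; apply: le_trans (neglog_sum_le N setT p1 p2).
rewrite le_eqVlt; apply/orP; left; apply/eqP; apply: eq_bigl => x.
by apply/esym/asboolP.
Qed.

Let expRN4 : expR (- 4) <= 1 / 16 :> R.
Proof.
rewrite expRN div1r lef_pV2 ?posrE ?expR_gt0//.
have -> : (4 : R) = 4%:R * 1 by rewrite mulr1.
rewrite expRM_natl (_ : 16 = 2 ^+ 4 :> R); last by ring.
rewrite lerXn2r ?nnegrE ?expR_ge0//.
by have := expR_ge1Dx (1 : R); lra.
Qed.

(** Lowering one factor of the tilt from 1 + d to 1 gains d Y where that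
    coordinate exceeds Y, and raises the logarithm of the generating function by
    only d Y / (1 + d)^2.  The difference is at least d^2 Y / 2, which pays for
    two errors d^2 Y / 8 and for the constant 4. *)
Let tilt_up (d Y : R) : 0 < d -> d <= 1 / 10 -> 16 / d ^+ 2 <= Y ->
  - (d * Y) + (Y * (1 / (1 * (1 + d))) + d ^+ 2 / 8 * Y) + 4
    <= Y * (1 / ((1 + d) * (1 + d))) - d ^+ 2 / 8 * Y.
Proof.
move=> d0 d1; rewrite ler_pdivrMr ?exprn_gt0// => dY.
have Y0 : 0 < Y by rewrite -(pmulr_lgt0 _ (exprn_gt0 2 d0)); lra.
pose A := 1 / (1 + d).
have Ad : A * (1 + d) = 1 by rewrite divfK// gt_eqF; lra.
have A0 : 0 < A by rewrite divr_gt0//; lra.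
have A1 : A <= 1 - d / 2 by rewrite ler_pdivrMr; nra.
have -> : 1 / (1 * (1 + d)) = A by rewrite (mul1r (1 + d)).
have -> : 1 / ((1 + d) * (1 + d)) = A * A by rewrite /A; field; rewrite gt_eqF//; lra.
have h : d ^+ 2 / 2 <= d + A * A - A.
  have -> : d + A * A - A = d * (1 - A * A).
    have : A = A * A * (1 + d) by rewrite -mulrA Ad mulr1.
    lra.
  have : A * A <= A * 1 by rewrite ler_pM2l//; lra.
  by move=> h; rewrite expr2 -mulrA ler_pM2l//; lra.
by have := ler_wpM2l (ltW Y0) h; lra.
Qed.

(** Raising one factor from 1 + d to 1 + 2 d lowers the logarithm of the
    generating function by d Y / ((1 + d)^2 (1 + 2 d)) >= d (1 - 4 d) Y, and
    costs d (1 - 5 d) Y where that coordinate is below (1 - 5 d) Y. *)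
Let tilt_down (d Y : R) : 0 < d -> d <= 1 / 10 -> 16 / d ^+ 2 <= Y ->
  d * (1 - 5 * d) * Y + (Y * (1 / ((1 + 2 * d) * (1 + d))) + d ^+ 2 / 8 * Y) + 4
    <= Y * (1 / ((1 + d) * (1 + d))) - d ^+ 2 / 8 * Y.
Proof.
move=> d0 d1; rewrite ler_pdivrMr ?exprn_gt0// => dY.
have Y0 : 0 < Y by rewrite -(pmulr_lgt0 _ (exprn_gt0 2 d0)); lra.
pose A := 1 / (1 + d); pose B := 1 / (1 + 2 * d).
have Ad : A * (1 + d) = 1 by rewrite divfK// gt_eqF; lra.
have Bd : B * (1 + 2 * d) = 1 by rewrite divfK// gt_eqF; lra.
have A0 : 0 < A by rewrite divr_gt0//; lra.
have B0 : 0 < B by rewrite divr_gt0//; lra.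
have A1 : 1 - d <= A by rewrite ler_pdivlMr; nra.
have B1 : 1 - 2 * d <= B by rewrite ler_pdivlMr; nra.
have -> : 1 / ((1 + 2 * d) * (1 + d)) = B * A.
  by rewrite /A /B; field; rewrite !gt_eqF//; lra.
have -> : 1 / ((1 + d) * (1 + d)) = A * A by rewrite /A; field; rewrite gt_eqF//; lra.
have h1 : A * A - B * A = d * (A * A * B).
  transitivity (A * A * (B * (1 + 2 * d)) - B * A * (A * (1 + d))).
    by rewrite Ad Bd !mulr1.
  ring.
have h2 : 1 - 4 * d <= A * A * B.
  apply: (@le_trans _ _ ((1 - d) * (1 - d) * (1 - 2 * d))).
    have : 0 <= d ^+ 2 * (5 - 2 * d) by rewrite mulr_ge0 ?sqr_ge0//; lra.
    by move=> h; rewrite -subr_ge0 (_ : _ - _ = d ^+ 2 * (5 - 2 * d))//; ring.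
  by rewrite !ler_pM ?mulr_ge0//; lra.
have h : d ^+ 2 <= A * A - B * A - d * (1 - 5 * d).
  by have := ler_wpM2l (ltW d0) h2; rewrite -h1; lra.
by have := ler_wpM2l (ltW Y0) h; lra.
Qed.

Let distlW (a b c : R) : `|a - b| <= c -> a <= b + c /\ b - c <= a.
Proof. by rewrite ler_norml => /andP[]; lra. Qed.

Let gain_up (d Y a b : R) : 0 < d -> Y <= a -> 1 * a + b + d * Y <= (1 + d) * a + b.
Proof. by move=> d0 h; have := ler_wpM2l (ltW d0) h; lra. Qed.

Let gain_down (d Y a b : R) : 0 < d -> a <= (1 - 5 * d) * Y ->
  (1 + 2 * d) * a + b + - (d * (1 - 5 * d) * Y) <= (1 + d) * a + b.
Proof. by move=> d0 h; have := ler_wpM2l (ltW d0) h; lra. Qed.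

Let tilt_itv (d : R) : 0 < d -> d <= 1 / 10 ->
  [/\ 1 / 2 <= (1 : R) <= 2, 1 / 2 <= 1 + d <= 2 & 1 / 2 <= 1 + 2 * d <= 2].
Proof. by move=> d0 d1; split; lra. Qed.

Let cover4 (b1 b2 b3 b4 : bool) (v : R) : 0 <= v ->
  v <= (if ~~ [|| b1, b2, b3 | b4] then v else 0) + ((if b1 then v else 0) +
    (if b2 then v else 0) + (if b3 then v else 0) + (if b4 then v else 0)).
Proof. by move=> v0; case: b1 b2 b3 b4 => [] [] [] [] /=; lra. Qed.

Let quarter_left (a s0 s1 s2 s3 s4 e : R) : 2^-1 * e <= a ->
  s1 <= e / 16 -> s2 <= e / 16 -> s3 <= e / 16 -> s4 <= e / 16 ->
  a <= s0 + (s1 + s2 + s3 + s4) -> e / 4 <= s0.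
Proof. by lra. Qed.

(** The right-hand side is at least (3 - 11 d) Y up to O(d^2) Y; 22 leaves room for the
    second order. *)
Let total_exponent (d Y F : R) : 0 < d -> d <= 1 / 10 -> 0 < Y ->
  Y * (1 / ((1 + d) * (1 + d))) - d ^+ 2 / 8 * Y <= F ->
  (3 - 22 * d) * Y <= 2 * ((1 + d) * (1 - 5 * d)) * Y - d * Y + F.
Proof.
move=> d0 d1 Y0 hF.
have h : 1 - 2 * d <= 1 / ((1 + d) * (1 + d)).
  by rewrite ler_pdivlMr ?mulr_gt0//; nra.
have h2 : (3 - 22 * d) <= 2 * ((1 + d) * (1 - 5 * d)) - d + (1 - 2 * d) - d ^+ 2 / 8.
  by nra.
have := ler_wpM2l (ltW Y0) h; have := ler_wpM2l (ltW Y0) h2; lra.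
Qed.

(** Lower bound by concentration: under weights tilted slightly towards short
    lines, the endpoint lies with overwhelming weight in a small box below n,
    and a line ending in the box is completed to one ending at n by horizontal
    and vertical edges at polynomial cost. *)
Lemma near_total_weight_ge (d : R) : 0 < d -> d <= 1 / 10 ->
  \forall n \near to_infty c1 c2, expR ((3 - 22 * d) * y n) <= total_weight n.
Proof.
move=> d0 d1; have e0 : 0 < d ^+ 2 / 8 by rewrite divr_gt0 ?exprn_gt0.
have m0 : 0 < Num.min 1 r by rewrite lt_min ltr01 r0.
near=> n.
have [n1 n2] : (0 < n.1)%N /\ (0 < n.2)%N by near: n; exact: near_positive.
have F : forall (a1 a2 : R) C V, 1 / 2 <= a1 <= 2 -> 1 / 2 <= a2 <= 2 -> has_density C V ->
  `|r * fine (logsum C (tilt a1 a2 n)) - y n * (V (tilt a1 a2 n) / (a1 * a2))|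
    <= d ^+ 2 / 8 * y n by near: n; exact: near_logsum.
have yd : 16 / d ^+ 2 <= y n by near: n; exact: exponent_ge.
have poly : 4 / Num.min 1 r ^+ 2 * (n.1.+1%:R * n.2.+1%:R) ^+ 2 <= expR (d * y n).
  by near: n; exact: near_poly.
have p1 : (0 : R) < n.1%:R by rewrite ltr0n.
have p2 : (0 : R) < n.2%:R by rewrite ltr0n.
have y0 : 0 < y n := exponent_gt0 r L n.
have al1 : 0 < y n / n.1%:R by rewrite divr_gt0.
have al2 : 0 < y n / n.2%:R by rewrite divr_gt0.
have tilt_gt0 (a1 a2 : R) : 0 < a1 -> 0 < a2 -> 0 < (tilt a1 a2 n).1 /\ 0 < (tilt a1 a2 n).2.
  by move=> a10 a20; split; rewrite mulr_gt0.
pose f a1 a2 := r * fine (logsum setT (tilt a1 a2 n)).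
have fE a1 a2 : 1 / 2 <= a1 <= 2 -> 1 / 2 <= a2 <= 2 ->
    `|f a1 a2 - y n * (1 / (a1 * a2))| <= d ^+ 2 / 8 * y n.
  by move=> h1 h2; apply: (F a1 a2 setT (fun=> 1)) => //; exact: has_densityT.
have [t1 t2] := tilt_gt0 (1 + d) (1 + d) (addr_gt0 ltr01 d0) (addr_gt0 ltr01 d0).
have [N [K [MN MK half]]] := generating_function_ge r0 (maxn n.1 n.2) t1 t2.
have [N1 N2] : (n.1 <= N)%N /\ (n.2 <= N)%N by apply/andP; rewrite -geq_max.
have [K1 K2] : (n.1 <= K)%N /\ (n.2 <= K)%N by apply/andP; rewrite -geq_max.
rewrite (total_weightE N1 N2 K1 K2).
pose T1 (nu : mults N K) := y n / n.1%:R * (total nu).1%:R.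
pose T2 (nu : mults N K) := y n / n.2%:R * (total nu).2%:R.
have costE a1 a2 nu : cost (dotp (tilt a1 a2 n)) nu = a1 * T1 nu + a2 * T2 nu.
  by rewrite cost_dotp /= /T1 /T2 !mulrA.
pose w (nu : mults N K) := mweight r nu * expR (- cost (dotp (tilt (1 + d) (1 + d) n)) nu).
have w0 nu : 0 <= w nu by rewrite mulr_ge0 ?expR_ge0 ?mweight_ge0.
(* Summing with the tilt (a1, a2) instead of (1 + d, 1 + d) gains g on P. *)
have tail (P : pred (mults N K)) (a1 a2 g : R) : 0 < a1 -> 0 < a2 ->
    (forall nu, P nu -> a1 * T1 nu + a2 * T2 nu + g <= (1 + d) * T1 nu + (1 + d) * T2 nu) ->
    \sum_(nu | P nu) w nu <= expR (- g + f a1 a2).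
  move=> a10 a20 Pg; have [q1 q2] := tilt_gt0 _ _ a10 a20.
  apply: le_trans (chernoff_tilted r0 (l' := dotp (tilt a1 a2 n)) (g := g) _ _) _.
  - by move=> x; apply: dotp_gt0 => //; exact: pvec_neq0.
  - by move=> nu /Pg; rewrite !costE.
  by rewrite ler_expR lerD2l ler_wpM2l ?(ltW r0)// neglog_sumT_le.
pose E := expR (f (1 + d) (1 + d)).
have [i1 i2 i3] := tilt_itv d0 d1.
have [_ fl] := distlW (fE _ _ i2 i2).
have up := le_trans (tilt_up d0 d1 yd) fl.
have down := le_trans (tilt_down d0 d1 yd) fl.
have E16 x : x + 4 <= f (1 + d) (1 + d) -> expR x <= E / 16.
  rewrite -lerBrDr => h; apply: (@le_trans _ _ (E * expR (- 4))).
    by rewrite /E -expRD ler_expR.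
  by rewrite ler_pM2l ?expR_gt0// -div1r; exact: expRN4.
(* The scaled endpoint (T1, T2) leaves the box [(1 - 5 d) y, y]^2 in four ways,
   each with at most one sixteenth of E; as the whole sum is at least E / 2,
   one quarter of E remains on the box. *)
pose P1 (nu : mults N K) := y n < T1 nu.
pose P2 (nu : mults N K) := y n < T2 nu.
pose P3 (nu : mults N K) := T1 nu < (1 - 5 * d) * y n.
pose P4 (nu : mults N K) := T2 nu < (1 - 5 * d) * y n.
pose P0 (nu : mults N K) := ~~ [|| P1 nu, P2 nu, P3 nu | P4 nu].
have d1_gt0 : 0 < 1 + d by rewrite addr_gt0.
have d2_gt0 : 0 < 1 + 2 * d by rewrite addr_gt0 ?mulr_gt0.
have S1 : \sum_(nu | P1 nu) w nu <= E / 16.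
  apply: le_trans (tail P1 1 (1 + d) (d * y n) _ _ _) _ => //.
    by move=> nu /ltW h; exact: gain_up.
  apply: E16; apply: le_trans up; rewrite lerD2r lerD2l.
  by have [] := distlW (fE _ _ i1 i2).
have S2 : \sum_(nu | P2 nu) w nu <= E / 16.
  apply: le_trans (tail P2 (1 + d) 1 (d * y n) _ _ _) _ => //.
    by move=> nu /ltW h; rewrite [X in X + _]addrC [leRHS]addrC; exact: gain_up.
  apply: E16; apply: le_trans up; rewrite lerD2r lerD2l -(mulrC (1 + d) 1).
  by have [] := distlW (fE _ _ i2 i1).
have S3 : \sum_(nu | P3 nu) w nu <= E / 16.
  apply: le_trans (tail P3 (1 + 2 * d) (1 + d) (- (d * (1 - 5 * d) * y n)) _ _ _) _ => //.
    by move=> nu /ltW h; exact: gain_down.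
  apply: E16; apply: le_trans down; rewrite opprK lerD2r lerD2l.
  by have [] := distlW (fE _ _ i3 i2).
have S4 : \sum_(nu | P4 nu) w nu <= E / 16.
  apply: le_trans (tail P4 (1 + d) (1 + 2 * d) (- (d * (1 - 5 * d) * y n)) _ _ _) _ => //.
    by move=> nu /ltW h; rewrite [X in X + _]addrC [leRHS]addrC; exact: gain_down.
  apply: E16; apply: le_trans down; rewrite opprK lerD2r lerD2l -(mulrC (1 + d) (1 + 2 * d)).
  by have [] := distlW (fE _ _ i2 i3).
have S0 : E / 4 <= \sum_(nu | P0 nu) w nu.
  apply: (quarter_left half S1 S2 S3 S4).
  rewrite (big_mkcond (fun nu => P0 nu)) (big_mkcond (fun nu => P1 nu)).
  rewrite (big_mkcond (fun nu => P2 nu)) (big_mkcond (fun nu => P3 nu)).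
  rewrite (big_mkcond (fun nu => P4 nu)) -!big_split/=.
  by apply: ler_sum => nu _; exact: (cover4 (P1 nu) (P2 nu) (P3 nu) (P4 nu) (w0 nu)).
(* On the box the tilted cost is at least l, so the plain weights exceed the
   tilted ones by the factor exp l. *)
pose l := 2 * ((1 + d) * (1 - 5 * d)) * y n.
pose W0 := \sum_(nu : mults N K | ((total nu).1 <= n.1)%N && ((total nu).2 <= n.2)%N)
  mweight r nu.
have S0W : \sum_(nu | P0 nu) w nu <= expR (- l) * W0.
  rewrite mulr_sumr [leLHS]big_mkcond [leRHS]big_mkcond/=; apply: ler_sum => nu _.
  case: ifPn => [|_]; last first.
    by case: ifP => // _; rewrite mulr_ge0 ?expR_ge0 ?mweight_ge0.
  rewrite /P0 !negb_or /P1 /P2 /P3 /P4 -!leNgt => /and4P[h1 h2 h3 h4].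
  have le1 : ((total nu).1 <= n.1)%N.
    by move: h1; rewrite /T1 mulrAC ler_pdivrMr// ler_pM2l// ler_nat.
  have le2 : ((total nu).2 <= n.2)%N.
    by move: h2; rewrite /T2 mulrAC ler_pdivrMr// ler_pM2l// ler_nat.
  rewrite le1 le2 /w mulrC ler_wpM2r ?mweight_ge0// ler_expR lerN2 costE.
  apply: le_trans (lerD (ler_wpM2l (ltW d1_gt0) h3) (ler_wpM2l (ltW d1_gt0) h4)).
  by rewrite /l le_eqVlt; apply/orP; left; apply/eqP; ring.
have N0 : (0 < N)%N by apply: leq_trans N1.
have := box_sum_le r0 N0 K1 K2; rewrite -/W0.
set Z := \sum_(nu | _) _ => W0Z.
have A1 : E <= expR (- l) * (4 * (n.1.+1%:R * n.2.+1%:R / Num.min 1 r) ^+ 2 * Z).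
  have : E / 4 <= expR (- l) * ((n.1.+1%:R * n.2.+1%:R / Num.min 1 r) ^+ 2 * Z).
    apply: le_trans S0 (le_trans S0W _).
    by rewrite ler_pM2l ?expR_gt0.
  by rewrite ler_pdivrMr// => /le_trans; apply; rewrite le_eqVlt; apply/orP; left; apply/eqP; ring.
have Z0 : 0 <= Z by apply: sumr_ge0 => nu _; exact: mweight_ge0.
have A2 : E <= expR (- l) * (expR (d * y n) * Z).
  apply: le_trans A1 _; rewrite ler_pM2l ?expR_gt0// ler_wpM2r//.
  by apply: le_trans poly; rewrite le_eqVlt; apply/orP; left; apply/eqP; field; rewrite gt_eqF.
have {A2} : expR (l - d * y n) * E <= Z.
  rewrite -(@ler_pM2l _ (expR (- l) * expR (d * y n))) ?mulr_gt0 ?expR_gt0//.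
  have e : expR (- l) * expR (d * y n) * expR (l - d * y n) = 1.
    by rewrite -!expRD (_ : _ + _ = 0) ?expR0//; ring.
  by rewrite mulrA e mul1r -mulrA.
apply: le_trans; rewrite /E -expRD ler_expR.
exact: (total_exponent d0 d1 y0).
Unshelve. all: by end_near. Qed.

End total_weight.

(** * Deviations of the line from the parabola *)

Section deviation.
Variable R : realType.
Implicit Types (n : nat * nat).

(** What a unit of multiplicity of the direction x contributes to a coordinate
    of xi.  A scaled slope at most t is a slope at most tau = t n.2 / n.1. *)
Definition below_part (m : nat) (tau : R) (f : nat * nat -> nat) (x : nat * nat) : R :=
  if tau * x.1%:R < x.2%:R then 0 else (f x)%:R / m%:R.

Lemma xi_line N K (nu : mults N K) n (t : R) : (0 < n.1)%N -> (0 < n.2)%N ->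
  xi n (line R nu) t%:E =
  (cost (below_part n.1 (t * (n.2%:R / n.1%:R)) fst) nu,
   cost (below_part n.2 (t * (n.2%:R / n.1%:R)) snd) nu).
Proof.
move=> n1 n2; rewrite /xi /scaled_edges big_map big_mkcond.
pose F (e : nat * nat) : R * R :=
  if (slope (e.1%:R / n.1%:R : R, e.2%:R / n.2%:R : R)%R <= t%:E)%E
  then (e.1%:R / n.1%:R, e.2%:R / n.2%:R) else 0.
rewrite (_ : \sum_(e <- line R nu) _ = \sum_(e <- line R nu) F e)//.
rewrite (@big_line _ _ _ _ _ _ F); last by rewrite /F /= !mul0r; case: ifP.
have p1 : (0 : R) < n.1%:R by rewrite ltr0n.
have p2 : (0 : R) < n.2%:R by rewrite ltr0n.
have FE x : F (edge nu x) =
    ((nu x)%:R * below_part n.1 (t * (n.2%:R / n.1%:R)) fst (pvec x),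
     (nu x)%:R * below_part n.2 (t * (n.2%:R / n.1%:R)) snd (pvec x)).
  rewrite /F /edge; move: (pvec x) (pvec_neq0 x) (nat_of_ord (nu x)) => [a b] ab k.
  have [k0|k0] := posnP k.
    by rewrite k0 !mul0n /= !mul0r; case: ifP.
  have kp : (0 : R) < k%:R by rewrite ltr0n.
  have -> : (slope ((k * (a, b).1)%:R / n.1%:R : R, (k * (a, b).2)%:R / n.2%:R : R)%R
      <= t%:E)%E = ~~ (t * (n.2%:R / n.1%:R) * a%:R < b%:R).
    rewrite /slope /= -leNgt mulf_eq0 invr_eq0 !pnatr_eq0 muln_eq0.
    rewrite (gtn_eqF k0) (gtn_eqF n1)/= orbF.
    have [a0|a0] := eqVneq a 0%N.
      rewrite a0 mulr0 leNgt ltr0n lt0n; apply/esym/negbTE; rewrite negbK.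
      by apply: contraNneq ab => ->; rewrite a0.
    have xp : (0 : R) < a%:R by rewrite ltr0n lt0n.
    rewrite lee_fin !natrM.
    have -> : k%:R * b%:R / n.2%:R / (k%:R * a%:R / n.1%:R)
       = b%:R / (n.2%:R / n.1%:R * a%:R) :> R.
      by field; rewrite !gt_eqF.
    by rewrite ler_pdivrMr ?mulr_gt0 ?divr_gt0 ?invr_gt0// mulrA.
  rewrite if_neg /below_part /=; case: ifP => _; first by rewrite !mulr0.
  by rewrite !natrM !mulrA.
under eq_bigr do rewrite FE.
rewrite /cost; elim/big_rec3 : _ => // x a b c _ ->.
by [].
Qed.

End deviation.

Section deviation_bound.
Variables (R : realType) (c1 c2 r L : R).
Hypothesis c1_gt0 : 0 < c1.
Hypothesis c12 : c1 <= c2.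
Hypothesis r0 : 0 < r.
Hypothesis L0 : 0 < L.
Hypothesis logsum_L : logsum_constant L.
Implicit Types (n : nat * nat).

#[local] Existing Instance to_infty_filter.

Local Notation y := (exponent r L).
Local Notation tilt := (tilt r L).

Definition deviates (s : R * R) (t b : R) n : set polyline :=
  [set G | b <= s.1 * (xi n G t%:E).1 + s.2 * (xi n G t%:E).2].

Let distlW (a b c : R) : `|a - b| <= c -> a <= b + c.
Proof. by rewrite ler_norml => /andP[]; lra. Qed.

Let tilt_side (s : R) : `|s| <= 1 / 2 -> 1 / 2 <= 1 - s <= 2.
Proof. by rewrite ler_norml => /andP[]; lra. Qed.

Let deviation_exponent (k g d Y v w fa fb : R) : 0 < k -> 0 < Y -> 22 * d <= k / 16 ->
  v + w <= 1 + g + k / 2 ->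
  fa <= Y * (v / (1 * 1)) + k / 32 * Y -> fb <= Y * w + k / 32 * Y ->
  Y * (2 - (g + k)) + (fa + fb) <= - (k / 4 * Y) + (3 - 22 * d) * Y.
Proof.
move=> k0 Y0 dk vw; rewrite mulr1 divr1 => ha hb.
have h1 := ler_wpM2l (ltW Y0) vw; have h2 := ler_wpM2l (ltW Y0) dk.
have h3 : 0 <= Y * k by rewrite mulr_ge0// ltW.
lra.
Qed.

(** The exponential Chebyshev inequality with the weights of the edges below
    slope t multiplied by exp(s . edge), compared with the lower bound for the
    total weight.  Divided by y, the logarithm of the tilted generating function
    is 1 - u from the directions above slope t = u / (1 - u) plus the left-hand
    side of the last hypothesis from those below.  When g is the first order
    prediction of s . xi(t), this hypothesis says that half of the excess k
    covers the second order in s; the errors take k / 16 and 2 k / 32 of the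
    other half, and more than k / 4 is left. *)
Lemma near_deviation (s : R * R) (u k g : R) : 0 < u < 1 -> 0 < k ->
  `|s.1| <= 1 / 2 -> `|s.2| <= 1 / 2 ->
  u / ((1 - s.1) * ((1 - u) * (1 - s.1) + u * (1 - s.2))) <= u + g + k / 2 ->
  \forall n \near to_infty c1 c2,
    \sum_(G \in Pi_lines R n `&` deviates s (u / (1 - u)) (g + k) n) bweight r G
      <= expR (- (k / 4 * y n)) * total_weight r n.
Proof.
move=> /andP[u0 u1] k0 s1 s2 hg.
pose d := Num.min (1 / 10) (k / 352).
have d0 : 0 < d by rewrite lt_min !divr_gt0.
have d1 : d <= 1 / 10 by rewrite ge_min lexx.
have d2 : 22 * d <= k / 16.
  have : d <= k / 352 by rewrite ge_min lexx orbT.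
  by lra.
have k32 : 0 < k / 32 by rewrite divr_gt0.
near=> n.
have [n1 n2] : (0 < n.1)%N /\ (0 < n.2)%N by near: n; exact: near_positive.
have F : forall (a1 a2 : R) C V, 1 / 2 <= a1 <= 2 -> 1 / 2 <= a2 <= 2 -> has_density C V ->
  `|r * fine (logsum C (tilt a1 a2 n)) - y n * (V (tilt a1 a2 n) / (a1 * a2))|
    <= k / 32 * y n by near: n; exact: near_logsum.
have Z : expR ((3 - 22 * d) * y n) <= total_weight r n.
  by near: n; exact: near_total_weight_ge.
have p1 : (0 : R) < n.1%:R by rewrite ltr0n.
have p2 : (0 : R) < n.2%:R by rewrite ltr0n.
have y0 : 0 < y n := exponent_gt0 r L n.
have al1 : 0 < y n / n.1%:R by rewrite divr_gt0.
have al2 : 0 < y n / n.2%:R by rewrite divr_gt0.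
have u1' : 0 < 1 - u by rewrite subr_gt0.
pose N := maxn n.1 n.2.
have N1 : (n.1 <= N)%N by exact: leq_maxl.
have N2 : (n.2 <= N)%N by exact: leq_maxr.
apply: (@le_trans _ _ (expR (- (k / 4 * y n)) * expR ((3 - 22 * d) * y n))); last first.
  by rewrite ler_pM2l ?expR_gt0.
rewrite -expRD (sum_Pi _ _ N1 N2 N1 N2).
under eq_bigr do rewrite bweight_line.
pose t := u / (1 - u); pose tau := t * (n.2%:R / n.1%:R).
have t0 : 0 <= t by rewrite divr_ge0 ?ltW.
have tau0 : 0 <= tau by rewrite /tau mulr_ge0// divr_ge0.
have b1 := tilt_side s1; have b2 := tilt_side s2.
have b10 : 0 < 1 - s.1 by case/andP: b1 => + _; apply: lt_le_trans; rewrite divr_gt0.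
have b20 : 0 < 1 - s.2 by case/andP: b2 => + _; apply: lt_le_trans; rewrite divr_gt0.
have b3 : 1 / 2 <= (1 : R) <= 2 by have := tilt_side (_ : `|0| <= 1 / 2); rewrite subr0; apply; rewrite normr0 divr_ge0.
(* The directions above slope t keep the tilt (1, 1), those below get
   (1 - s.1, 1 - s.2). *)
pose q := tilt 1 1 n; pose q' := tilt (1 - s.1) (1 - s.2) n.
pose l (x : nat * nat) := if tau * x.1%:R < x.2%:R then dotp q x else dotp q' x.
have lE x : l x = dotp q x - s.1 * y n * below_part n.1 tau fst x
    - s.2 * y n * below_part n.2 tau snd x.
  rewrite /l /below_part; case: ifP => _; first by rewrite !mulr0 !subr0.
  by rewrite /dotp /q /q' /tilt /=; field; rewrite !gt_eqF.
have [q1 q2 q1' q2'] : [/\ 0 < q.1, 0 < q.2, 0 < q'.1 & 0 < q'.2].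
  by split; rewrite mulr_gt0.
apply: le_trans (chernoff r0 (l := l) (c := y n * (2 - (g + k))) _ _) _.
- move=> x; rewrite /l; case: ifP => _; exact: dotp_gt0 (pvec_neq0 x).
- move=> nu /andP[/eqP nE /asboolP]; rewrite /deviates /= xi_line//= -/t -/tau => h.
  have -> : cost l nu = cost (dotp q) nu - s.1 * y n * cost (below_part n.1 tau fst) nu
      - s.2 * y n * cost (below_part n.2 tau snd) nu.
    rewrite /cost !mulr_sumr -!sumrB; apply: eq_bigr => x _; rewrite lE; ring.
  rewrite cost_dotp nE /q /= !mul1r !divfK ?gt_eqF//.
  move: (cost (below_part n.1 tau fst) nu) (cost (below_part n.2 tau snd) nu) h => a b h.
  have := ler_wpM2l (ltW y0) h.
  have -> : y n + y n - s.1 * y n * a - s.2 * y n * b = y n * 2 - y n * (s.1 * a + s.2 * b) by ring.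
  by rewrite mulrBr => h'; rewrite lerD2l lerN2.
rewrite ler_expR.
(* The tilted product splits into one over each of the two cones. *)
have sumE : \sum_(x : prim N) neglog (expR (- l (pvec x))) <=
    fine (logsum (above tau) q) + fine (logsum (~` above tau) q').
  rewrite (bigID (fun x => `[<above tau (pvec x)>]))/=; apply: lerD.
    apply: le_trans (neglog_sum_le N (above tau) q1 q2).
    rewrite le_eqVlt; apply/orP; left; apply/eqP; apply: eq_bigr => x /asboolP.
    by rewrite /above /l /= => ->.
  apply: le_trans (neglog_sum_le N (~` above tau) q1' q2').
  rewrite le_eqVlt; apply/orP; left; apply/eqP; apply: eq_big => x.
    by rewrite asbool_neg.
  by move=> /asboolPn; rewrite /above /l /= => /negP/negbTE ->.
apply: le_trans (lerD (lexx _) (ler_wpM2l (ltW r0) sumE)) _.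
rewrite [r * _]mulrDr.
have V (a1 a2 : R) : 0 < a1 -> 0 < a2 -> above_density tau (tilt a1 a2 n) =
    (1 - u) * a1 / ((1 - u) * a1 + u * a2).
  move=> a10 a20; rewrite /above_density /tilt /=.
  have -> : tau * (a2 * (y n / n.2%:R)) = u * a2 / (1 - u) * (y n / n.1%:R).
    by rewrite /tau /t; field; rewrite !gt_eqF.
  move: (y n / n.1%:R) al1 => b b0; field.
  by rewrite !gt_eqF// ?addr_gt0// ?mulr_gt0// ?addr_gt0// ?mulr_gt0.
have D0 : 0 < (1 - u) * (1 - s.1) + u * (1 - s.2) by rewrite addr_gt0 ?mulr_gt0.
have V1 : above_density tau q = 1 - u.
  by rewrite V// !mulr1 subrK divr1.
have V2 : 1 - above_density tau q' = u * (1 - s.2) / ((1 - u) * (1 - s.1) + u * (1 - s.2)).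
  by rewrite V//; field; rewrite gt_eqF.
have Fa := distlW (F 1 1 _ _ b3 b3 (has_density_above tau0)).
have Fb := distlW (F _ _ _ _ b1 b2 (has_density_below tau0)).
move: Fa Fb; rewrite -/q -/q' V1 V2 => Fa Fb.
apply: (deviation_exponent k0 y0 d2 _ Fa Fb).
apply: le_trans (_ : 1 - u + (u + g + k / 2) <= _); last first.
  by rewrite le_eqVlt; apply/orP; left; apply/eqP; ring.
rewrite lerD2l; apply: le_trans hg; rewrite le_eqVlt; apply/orP; left; apply/eqP.
by field; rewrite !gt_eqF.
Unshelve. all: by end_near. Qed.

End deviation_bound.

(** * The limit shape for a fixed parameter *)

Section limit_shape.
Variable R : realType.
Implicit Types (n : nat * nat) (G : polyline) (u s eta : R).

(** The limit curve in the parameter u = t / (1 + t), in which it is polynomial. *)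
Definition parabola u : R * R := (2 * u - u ^+ 2, u ^+ 2).

Lemma g_star_parabola (t : R) : 0 <= t -> g_star t%:E = parabola (t / (1 + t)).
Proof.
move=> t0; have p : 1 + t != 0 by rewrite gt_eqF// ltr_pwDl.
by congr pair; field.
Qed.

Lemma sum_fst (I : Type) (s : seq I) (P : pred I) (F : I -> R * R) :
  (\sum_(i <- s | P i) F i).1 = \sum_(i <- s | P i) (F i).1.
Proof. by apply: (big_morph fst). Qed.

Lemma sum_snd (I : Type) (s : seq I) (P : pred I) (F : I -> R * R) :
  (\sum_(i <- s | P i) F i).2 = \sum_(i <- s | P i) (F i).2.
Proof. by apply: (big_morph snd). Qed.

Lemma scaled_edges_ge0 n G v : v \in scaled_edges R n G -> 0 <= v.1 /\ 0 <= v.2.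
Proof. by move=> /mapP[e _ ->] /=; rewrite !divr_ge0. Qed.

Lemma xi_homo n G (t t' : \bar R) : (t <= t')%E ->
  (xi n G t).1 <= (xi n G t').1 /\ (xi n G t).2 <= (xi n G t').2.
Proof.
move=> tt'; rewrite /xi !sum_fst !sum_snd; split;
  rewrite [leLHS]big_mkcond [leRHS]big_mkcond/= !big_seq; apply: ler_sum => v;
  move=> /scaled_edges_ge0[v1 v2]; case: ifPn => [h|_]; try (by case: ifP);
  by rewrite (le_trans h tt').
Qed.

Lemma xi_ge0 n G (t : \bar R) : 0 <= (xi n G t).1 /\ 0 <= (xi n G t).2.
Proof.
rewrite /xi sum_fst sum_snd.
by split; rewrite big_seq_cond; apply: sumr_ge0 => v /andP[/scaled_edges_ge0[]].
Qed.

Lemma xi_infty n G : (0 < n.1)%N -> (0 < n.2)%N -> Pi_lines R n G ->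
  xi n G (+oo%E : \bar R) = (1, 1).
Proof.
move=> n1 n2 [_ Gn].
have [Gn1 Gn2] : (\sum_(e <- G) e.1 = n.1)%N /\ (\sum_(e <- G) e.2 = n.2)%N.
  by rewrite -Gn sum_pair.
rewrite [LHS]surjective_pairing /xi sum_fst sum_snd.
under eq_bigl do rewrite leey.
under [X in (_, X)]eq_bigl do rewrite leey.
rewrite !big_map /= -!mulr_suml -!natr_sum Gn1 Gn2.
by rewrite !divff// pnatr_eq0 -lt0n.
Qed.

Lemma euclidean_dist_le (x z : R * R) eta : 0 <= eta ->
  `|x.1 - z.1| <= eta / 2 -> `|x.2 - z.2| <= eta / 2 -> euclidean_dist x z <= eta.
Proof.
move=> e0 h1 h2; rewrite /euclidean_dist -[leRHS](ger0_norm e0) -sqrtr_sqr ler_wsqrtr//.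
have sq (a : R) : `|a| <= eta / 2 -> a ^+ 2 <= (eta / 2) ^+ 2.
  by move=> h; rewrite -real_normK ?num_real// lerXn2r ?nnegrE ?divr_ge0.
by have := sq _ h1; have := sq _ h2; have := sqr_ge0 eta; rewrite !expr2; lra.
Qed.

Lemma parabola_lipschitz a b : 0 <= a -> a <= b -> b <= 1 ->
  (parabola b).1 <= (parabola a).1 + 2 * (b - a) /\
  (parabola b).2 <= (parabola a).2 + 2 * (b - a).
Proof. by move=> a0 ab b1; rewrite /parabola/=; split; nra. Qed.

(** The slope t with t / (1 + t) = i / M. *)
Definition grid_slope M (i : nat) : R := i%:R / M%:R / (1 - i%:R / M%:R).

(** Both xi and the limit curve are nondecreasing in each coordinate, so the
    distance is controlled by the values at finitely many slopes. *)
Lemma tangential_dist_grid n G (M : nat) eta eps : (0 < M)%N ->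
  (0 < n.1)%N -> (0 < n.2)%N -> Pi_lines R n G -> 0 <= eta -> eta + 2 / M%:R <= eps / 2 ->
  (forall i, (0 < i < M)%N ->
    `|(xi n G (grid_slope M i)%:E).1 - (parabola (i%:R / M%:R)).1| <= eta /\
    `|(xi n G (grid_slope M i)%:E).2 - (parabola (i%:R / M%:R)).2| <= eta) ->
  (tangential_dist R n G <= eps%:E)%E.
Proof.
move=> M0 n1 n2 GP e0 eM grid.
have Mp : (0 : R) < M%:R by rewrite ltr0n.
have eps0 : 0 <= eps.
  have : 0 <= 2 / M%:R :> R by rewrite divr_ge0.
  by move: eM; lra.
apply: ge_ereal_sup => _ [t t0 <-]; rewrite lee_fin.
case: t t0 => [t||]//= t0; last first.
  rewrite xi_infty// /euclidean_dist !subrr expr0n addr0 sqrtr0//.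
rewrite lee_fin in t0; rewrite -/(g_star t%:E) g_star_parabola//.
set u := t / (1 + t).
have u01 : 0 <= u < 1.
  by rewrite divr_ge0 ?addr_ge0//= ltr_pdivrMr ?mul1r ?ltrDr ?ltr_pwDl.
have /andP[u0 u1] := u01.
pose i := Num.truncn (M%:R * u).
have /andP[i1 i2] : i%:R / M%:R <= u < i.+1%:R / M%:R.
  have := truncn_itv (mulr_ge0 (ltW Mp) u0); rewrite -/i => /andP[h1 h2].
  by rewrite ler_pdivrMr// ltr_pdivlMr// ![u * _]mulrC h1.
have iM : (i < M)%N.
  rewrite -(ltr_nat R) -[ltRHS]mul1r -ltr_pdivrMr//; exact: le_lt_trans u1.
have tp : 0 < 1 + t by rewrite ltr_pwDl.
have tE : t = u / (1 - u).
  rewrite /u; field; rewrite gt_eqF//= (_ : 1 + t - t = 1) ?oner_eq0//.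
  by rewrite addrK.
have slope_homo (a b : R) : 0 <= a -> a <= b -> b < 1 -> a / (1 - a) <= b / (1 - b).
  move=> a0 ab b1; have a1 := le_lt_trans ab b1.
  by rewrite ler_pdivrMr ?subr_gt0// mulrAC ler_pdivlMr ?subr_gt0//; lra.
pose a : R := i%:R / M%:R; pose b : R := i.+1%:R / M%:R.
have a0 : 0 <= a by rewrite divr_ge0.
have ba : b = a + 1 / M%:R by rewrite /a /b -natr1 mulrDl.
have b1 : b <= 1 by rewrite ler_pdivrMr// mul1r ler_nat.
have au : a <= u by [].
have ub : u <= b by exact: ltW.
have low : (parabola a).1 - eta <= (xi n G t%:E).1 /\ (parabola a).2 - eta <= (xi n G t%:E).2.
  have [i0|i0] := posnP i.
    have -> : a = 0 by rewrite /a i0 mul0r.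
    have [x1 x2] := xi_ge0 n G t%:E.
    by rewrite /parabola/= mulr0 expr0n/= subrr sub0r; split;
      [apply: le_trans x1|apply: le_trans x2]; rewrite oppr_le0.
  have [|g1 g2] := grid i; first by rewrite i0.
  have ht : ((grid_slope M i)%:E <= t%:E)%E by rewrite lee_fin tE slope_homo.
  have [x1 x2] := xi_homo n G ht.
  split; [apply: le_trans x1|apply: le_trans x2].
    by move: g1; rewrite -/a ler_norml => /andP[]; lra.
  by move: g2; rewrite -/a ler_norml => /andP[]; lra.
have high : (xi n G t%:E).1 <= (parabola b).1 + eta /\ (xi n G t%:E).2 <= (parabola b).2 + eta.
  have [Mi|Mi] := leqP M i.+1.
    have -> : b = 1.
      by rewrite /b (_ : i.+1 = M) ?divff ?gt_eqF//; apply/eqP; rewrite eqn_leq iM.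
    have [] := xi_homo n G (leey t%:E); rewrite xi_infty//= => x1 x2.
    by rewrite /parabola/= mulr1 expr1n; split; lra.
  have [|g1 g2] := grid i.+1; first by rewrite Mi.
  have b1' : b < 1 by rewrite ltr_pdivrMr// mul1r ltr_nat.
  have ht : (t%:E <= (grid_slope M i.+1)%:E)%E by rewrite lee_fin tE slope_homo.
  have [x1 x2] := xi_homo n G ht.
  split; [apply: le_trans x1 _|apply: le_trans x2 _].
    by move: g1; rewrite -/b ler_norml => /andP[]; lra.
  by move: g2; rewrite -/b ler_norml => /andP[]; lra.
have [l1 l2] := parabola_lipschitz a0 au (ltW u1).
have [h1 h2] := parabola_lipschitz u0 ub b1.
have [low1 low2] := low; have [high1 high2] := high.
have uaM : 2 * (u - a) <= 2 / M%:R by move: ub; rewrite ba; lra.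
have buM : 2 * (b - u) <= 2 / M%:R by move: au; rewrite ba; lra.
apply: euclidean_dist_le => //; rewrite ler_norml; apply/andP; split.
- by move: (parabola u) (parabola a) l1 low1 => U A k1 k2; lra.
- by move: (parabola u) (parabola b) h1 high1 => U A k1 k2; lra.
- by move: (parabola u) (parabola a) l2 low2 => U A k1 k2; lra.
- by move: (parabola u) (parabola b) h2 high2 => U A k1 k2; lra.
Qed.

End limit_shape.

Section fixed_parameter.
Variables (R : realType) (c1 c2 r L : R).
Hypothesis c1_gt0 : 0 < c1.
Hypothesis c12 : c1 <= c2.
Hypothesis r0 : 0 < r.
Hypothesis L0 : 0 < L.
Hypothesis logsum_L : logsum_constant L.
Implicit Types (n : nat * nat).

#[local] Existing Instance to_infty_filter.

Let inv_le (x : R) : `|x| <= 1 / 2 -> 0 <= (1 - x)^-1 <= 1 + x + 2 * x ^+ 2.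
Proof.
rewrite ler_norml => /andP[x1 x2]; have d0 : 0 < 1 - x by lra.
rewrite invr_ge0 (ltW d0)/= -div1r ler_pdivrMr//.
have : 0 <= x ^+ 2 * (1 - 2 * x) by rewrite mulr_ge0 ?sqr_ge0//; lra.
by rewrite !expr2; lra.
Qed.

(** This expansion is where the parabola comes from: tilting the first
    coordinate of the directions below slope t by s changes the exponent u to
    u + s (2 u - u^2) + O(s^2). *)
Let tilt1 (u s : R) : 0 < u < 1 -> `|s| <= 1 / 2 ->
  u / ((1 - s) * ((1 - u) * (1 - s) + u * (1 - 0)))
    <= u + s * (parabola u).1 + 16 * s ^+ 2 / 2.
Proof.
move=> /andP[u0 u1] s12; pose v := 1 - u.
have v01 : 0 <= v <= 1 by rewrite /v; lra.
have /andP[v0 v1] := v01.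
have vs12 : `|v * s| <= 1 / 2.
  by rewrite normrM ger0_norm//; apply: le_trans s12; rewrite ler_piMl.
have -> : u / ((1 - s) * ((1 - u) * (1 - s) + u * (1 - 0))) = u * ((1 - s)^-1 * (1 - v * s)^-1).
  by rewrite -invfM; congr (_ / (_ * _)); rewrite /v; ring.
have /andP[i1 i2] := inv_le s12; have /andP[j1 j2] := inv_le vs12.
apply: (@le_trans _ _ (u * ((1 + s + 2 * s ^+ 2) * (1 + v * s + 2 * (v * s) ^+ 2)))).
  by rewrite ler_pM2l// ler_pM.
pose X := v + 2 + 2 * v ^+ 2 + (2 * v ^+ 2 + 2 * v) * s + 4 * v ^+ 2 * s ^+ 2.
have X8 : X <= 8.
  have s1 : s <= 1 / 2 by move: s12; rewrite ler_norml => /andP[].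
  have s2 : s ^+ 2 <= 1 / 4.
    rewrite -real_normK ?num_real//.
    have : `|s| ^+ 2 <= (1 / 2) ^+ 2 by rewrite lerXn2r ?nnegrE.
    by rewrite !expr2; lra.
  have v2 : v ^+ 2 <= 1 by rewrite expr_le1.
  have v20 : 0 <= v ^+ 2 by rewrite sqr_ge0.
  have : (2 * v ^+ 2 + 2 * v) * s <= (2 * v ^+ 2 + 2 * v) * (1 / 2).
    by rewrite ler_wpM2l// addr_ge0 ?mulr_ge0.
  have : 4 * v ^+ 2 * s ^+ 2 <= 4 * v ^+ 2 * (1 / 4).
    by rewrite ler_wpM2l// mulr_ge0.
  by rewrite /X; lra.
have uX : u * s ^+ 2 * X <= 1 * s ^+ 2 * 8.
  apply: (@le_trans _ _ (u * s ^+ 2 * 8)).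
    by rewrite ler_wpM2l// mulr_ge0 ?sqr_ge0// ltW.
  by rewrite ler_wpM2r// ler_wpM2r ?sqr_ge0// ltW.
have -> : u * ((1 + s + 2 * s ^+ 2) * (1 + v * s + 2 * (v * s) ^+ 2))
   = u + s * (parabola u).1 + u * s ^+ 2 * X.
  by rewrite /X /parabola /v/=; ring.
by rewrite lerD2l; lra.
Qed.

(** The second coordinate: u / (1 - u s) = u + s u^2 + O(s^2). *)
Let tilt2 (u s : R) : 0 < u < 1 -> `|s| <= 1 / 2 ->
  u / ((1 - 0) * ((1 - u) * (1 - 0) + u * (1 - s)))
    <= u + s * (parabola u).2 + 16 * s ^+ 2 / 2.
Proof.
move=> /andP[u0 u1] s12.
have us12 : `|u * s| <= 1 / 2.
  by rewrite normrM ger0_norm ?(ltW u0)//; apply: le_trans s12; rewrite ler_piMl// ltW.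
have -> : u / ((1 - 0) * ((1 - u) * (1 - 0) + u * (1 - s))) = u * (1 - u * s)^-1.
  by congr (_ / _); ring.
have /andP[i1 i2] := inv_le us12.
apply: (@le_trans _ _ (u * (1 + u * s + 2 * (u * s) ^+ 2))); first by rewrite ler_pM2l.
have : u ^+ 3 * s ^+ 2 <= 1 * s ^+ 2.
  by rewrite ler_wpM2r ?sqr_ge0// expr_le1// ltW.
have : 0 <= s ^+ 2 by rewrite sqr_ge0.
have -> : u * (1 + u * s + 2 * (u * s) ^+ 2) = u + s * u ^+ 2 + 2 * (u ^+ 3 * s ^+ 2) by ring.
rewrite /parabola/=; lra.
Qed.

Let y := (exponent r L).

(** The index consists of a grid point, a coordinate and a sign.  The margin
    16 s^2 is twice the bound on the second order term in tilt1 and tilt2, as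
    near_deviation demands. *)
Definition grid_deviation (M : nat) (s : R) (j : 'I_M * bool * bool) n : set polyline :=
  let u : R := j.1.1%:R / M%:R in
  let sg : R := if j.2 then s else - s in
  if j.1.2 then deviates (sg, 0) (u / (1 - u)) (sg * (parabola u).1 + 16 * s ^+ 2) n
  else deviates (0, sg) (u / (1 - u)) (sg * (parabola u).2 + 16 * s ^+ 2) n.

Lemma near_grid_deviation M (s : R) (j : 'I_M * bool * bool) :
  0 < s <= 1 / 2 -> (0 < j.1.1)%N ->
  \forall n \near to_infty c1 c2,
    \sum_(G \in Pi_lines R n `&` grid_deviation s j n) bweight r G
      <= expR (- (4 * s ^+ 2 * y n)) * total_weight r n.
Proof.
move=> /andP[s0 s12] i0; rewrite /grid_deviation.
have M0 : (0 < M)%N by exact: leq_ltn_trans (leq0n _) (ltn_ord j.1.1).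
set u : R := j.1.1%:R / M%:R; set sg : R := if j.2 then s else - s.
have Mp : (0 : R) < M%:R by rewrite ltr0n.
have u01 : 0 < u < 1.
  by rewrite divr_gt0 ?ltr0n//= ltr_pdivrMr// mul1r ltr_nat ltn_ord.
have sg2 : sg ^+ 2 = s ^+ 2 by rewrite /sg; case: ifP => // _; rewrite sqrrN.
have sgn : `|sg| <= 1 / 2.
  by rewrite /sg; case: ifP => _; rewrite ?normrN ger0_norm// ltW.
have n0 : `|0 : R| <= 1 / 2 by rewrite normr0 divr_ge0.
have k0 : 0 < 16 * s ^+ 2 by rewrite mulr_gt0 ?exprn_gt0.
have k4 : 4 * s ^+ 2 = 16 * s ^+ 2 / 4 by field.
rewrite /y k4; case: (j.1.2); apply: near_deviation => //=.
  by have := tilt1 u01 sgn; rewrite sg2.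
by have := tilt2 u01 sgn; rewrite sg2.
Qed.

(** With s = eta / 16 the margin 16 s^2 is s eta, so a line without deviations
    at a grid point is within eta of the parabola there. *)
Lemma far_deviates n (M : nat) (eta eps : R) (G : polyline) : (0 < M)%N ->
  (0 < n.1)%N -> (0 < n.2)%N -> Pi_lines R n G -> 0 < eta -> eta + 2 / M%:R <= eps / 2 ->
  ~ (tangential_dist R n G <= eps%:E)%E ->
  exists2 j : 'I_M * bool * bool, (0 < j.1.1)%N & grid_deviation (eta / 16) j n G.
Proof.
move=> M0 n1 n2 GP eta0 etaM; apply: contra_notP => /forall2NP none.
apply: (tangential_dist_grid M0 n1 n2 GP (ltW eta0) etaM) => i /andP[i0 iM].
pose s := eta / 16.
have s0 : 0 < s by rewrite divr_gt0.
have k : 16 * s ^+ 2 = s * eta by rewrite /s; field.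
have nodev ax sg : ~ grid_deviation s (Ordinal iM, ax, sg) n G.
  by case: (none (Ordinal iM, ax, sg)).
have := nodev true true; have := nodev true false.
have := nodev false true; have := nodev false false.
rewrite /grid_deviation /deviates /= -/(grid_slope R M i) k !mul0r !addr0 !add0r.
move=> /negP; rewrite -ltNge => h1 /negP; rewrite -ltNge => h2.
move=> /negP; rewrite -ltNge => h3 /negP; rewrite -ltNge => h4.
by split; rewrite ler_norml; apply/andP; split; rewrite -(ler_pM2l s0); lra.
Qed.

(** The number of possible deviations is fixed, and each has relative weight at
    most exp(- 4 s^2 y), which tends to 0. *)
Lemma near_far_weight (eps e : R) : 0 < eps -> 0 < e ->
  \forall n \near to_infty c1 c2,
    \sum_(G \in Pi_lines R n `&` [set G | ~ (tangential_dist R n G <= eps%:E)%E])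
      bweight r G <= e * total_weight r n /\ 0 < total_weight r n.
Proof.
move=> eps0 e0; pose eta := Num.min (1 : R) (eps / 4).
have eta0 : 0 < eta by rewrite lt_min ltr01 divr_gt0.
have eta1 : eta <= 1 by rewrite ge_min lexx.
pose M := (Num.truncn (8 / eps)).+1.
have etaM : eta + 2 / M%:R <= eps / 2.
  have h : 8 / eps < M%:R by exact: truncnS_gt.
  have h4 : 2 / M%:R <= eps / 4.
    rewrite ler_pdivrMr ?ltr0n//; move: h; rewrite ltr_pdivrMr// => /ltW.
    by move: (M%:R) => m; lra.
  have : eta <= eps / 4 by rewrite ge_min lexx orbT.
  by lra.
pose s := eta / 16.
have s0 : 0 < s <= 1 / 2 by rewrite divr_gt0//= /s; lra.
pose B : R := #|{: 'I_M * bool * bool}|%:R / (4 * s ^+ 2 * e).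
pose d : R := 1 / 10.
have d0 : 0 < d by rewrite divr_gt0.
have d1 : d <= 1 / 10 by [].
have q0 : 0 < 4 * s ^+ 2 by case/andP: s0 => s0 _; rewrite mulr_gt0 ?exprn_gt0.
near=> n.
have [n1 n2] : (0 < n.1)%N /\ (0 < n.2)%N by near: n; exact: near_positive.
have yB : B <= y n by near: n; exact: exponent_ge.
have tw : expR ((3 - 22 * d) * y n) <= total_weight r n.
  by near: n; exact: near_total_weight_ge.
have tw0 : 0 < total_weight r n by exact: lt_le_trans (expR_gt0 _) tw.
have dev : forall j : 'I_M * bool * bool, (0 < j.1.1)%N ->
    \sum_(G \in Pi_lines R n `&` grid_deviation s j n) bweight r G
      <= expR (- (4 * s ^+ 2 * y n)) * total_weight r n.
  near: n; apply: filter_forall => j.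
  have [j0|j0] := posnP (j.1.1 : nat); first exact: nearW.
  by apply: filterS (near_grid_deviation s0 j0) => n.
split=> //.
pose N := maxn n.1 n.2.
have N1 : (n.1 <= N)%N by exact: leq_maxl.
have N2 : (n.2 <= N)%N by exact: leq_maxr.
apply: (@le_trans _ _ (\sum_(j : 'I_M * bool * bool | (0 < j.1.1)%N)
   \sum_(G \in Pi_lines R n `&` grid_deviation s j n) bweight r G)).
  rewrite (sum_Pi _ _ N1 N2 N1 N2).
  under [leRHS]eq_bigr do rewrite (sum_Pi _ _ N1 N2 N1 N2) big_mkcond.
  rewrite exchange_big/= big_mkcond; apply: ler_sum => nu _.
  have b0 : 0 <= bweight r (line R nu) by rewrite bweight_line mweight_ge0.
  case: ifPn => [/andP[/eqP nE /asboolP far]|_]; last first.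
    by apply: sumr_ge0 => j _; case: ifP.
  have GP : Pi_lines R n (line R nu) by split; [exact: line_convex|rewrite sum_line].
  have [j j0 jd] := far_deviates (isT : (0 < M)%N) n1 n2 GP eta0 etaM far.
  rewrite (bigD1 j)//= nE eqxx asboolT//= lerDl.
  by apply: sumr_ge0 => k _; case: ifP.
apply: (@le_trans _ _ (\sum_(j : 'I_M * bool * bool)
    expR (- (4 * s ^+ 2 * y n)) * total_weight r n)).
  rewrite big_mkcond; apply: ler_sum => j _; case: ifP => [/dev//|_].
  by rewrite mulr_ge0 ?expR_ge0// ltW.
rewrite sumr_const -[leLHS]mulr_natl mulrA ler_wpM2r ?(ltW tw0)//.
rewrite expRN ler_pdivrMr ?expR_gt0//.
apply: (@le_trans _ _ (e * (4 * s ^+ 2 * y n))); last first.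
  by rewrite ler_pM2l//; apply: le_trans (expR_ge1Dx _); rewrite lerDr.
move: yB; rewrite /B ler_pdivrMr ?mulr_gt0//.
by move=> /le_trans; apply; rewrite le_eqVlt; apply/orP; left; apply/eqP; ring.
Unshelve. all: by end_near. Qed.

End fixed_parameter.

(** * Mixing over the parameter *)

Section mixture.
Variable R : realType.
Implicit Types (n : nat * nat) (A : set polyline) (r : R).

Definition Pn_event n A r : R := \sum_(G \in Pi_lines R n `&` A) Pn n r G.

Lemma finite_PiI n A : finite_set (Pi_lines R n `&` A).
Proof. exact/finite_setIl/finite_Pi. Qed.

Lemma bweight_ge0 r G : 0 < r -> 0 <= bweight r G.
Proof. by move=> r0; apply: prodr_ge0 => e _; exact: bcoef_ge0. Qed.

Lemma total_weight_ge0 n r : 0 < r -> 0 <= total_weight r n.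
Proof. by move=> r0; apply: fsumr_ge0 => G _; exact: bweight_ge0. Qed.

Lemma Pn_ge0 n r G : 0 < r -> 0 <= Pn n r G.
Proof.
move=> r0; rewrite /Pn -/(total_weight r n).
by rewrite divr_ge0 ?bweight_ge0 ?total_weight_ge0.
Qed.

Lemma Pn_eventE n A r :
  Pn_event n A r = (\sum_(G \in Pi_lines R n `&` A) bweight r G) / total_weight r n.
Proof. by rewrite /Pn_event mulr_fsuml. Qed.

Lemma total_weightID n A r : total_weight r n =
  \sum_(G \in Pi_lines R n `&` A) bweight r G
  + \sum_(G \in Pi_lines R n `&` ~` A) bweight r G.
Proof. by rewrite /total_weight (fsbigID A)//; exact: finite_Pi. Qed.

Lemma Pn_event_itv n A r : 0 < r -> 0 <= Pn_event n A r <= 1.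
Proof.
move=> r0; rewrite Pn_eventE.
have a0 B : 0 <= \sum_(G \in Pi_lines R n `&` B) bweight r G.
  by apply: fsumr_ge0 => G _; exact: bweight_ge0.
have t0 := total_weight_ge0 n r0.
rewrite divr_ge0//=; have := t0; rewrite le_eqVlt => /predU1P[<-|tp].
  by rewrite invr0 mulr0.
by rewrite ler_pdivrMr// mul1r (total_weightID n A) lerDl.
Qed.

Lemma measurable_bcoef (k : nat) : measurable_fun setT (fun r : R => bcoef r k).
Proof.
apply: measurable_funM; last exact: measurable_cst.
apply: measurable_prod => i _; apply: measurable_funD => //.
Qed.

Lemma measurable_bweight G : measurable_fun setT (fun r : R => bweight r G).
Proof. by apply: measurable_prod => e _; exact: measurable_bcoef. Qed.

Lemma measurable_Pn n G :
  measurable_fun (`]0, +oo[ : set R) (fun r : R => Pn n r G).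
Proof.
apply: measurable_funM.
  by apply: measurable_funTS; exact: measurable_bweight.
(* On nonnegative numbers the inverse is the power -1, a measurable function. *)
apply: (eq_measurable_fun (fun r => powR (total_weight r n) (-1))).
  by move=> r; rewrite inE/= in_itv/= andbT => r0; rewrite powR_inv1// total_weight_ge0.
apply: (measurableT_comp (measurable_powR _)).
apply: measurable_funTS; rewrite /total_weight.
rewrite (_ : (fun r => _) =
    fun r : R => \sum_(G' <- finmap.enum_fset (fset_set (Pi_lines R n))) bweight r G').
  by apply: measurable_sum => G'; exact: measurable_bweight.
by apply/funext => r; rewrite fsbig_finite//; exact: finite_Pi.
Qed.

Lemma measurable_Pn_event n A :
  measurable_fun (`]0, +oo[ : set R) (fun r : R => Pn_event n A r).
Proof.
rewrite (_ : (fun r => _) =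
    fun r : R => \sum_(G <- finmap.enum_fset (fset_set (Pi_lines R n `&` A))) Pn n r G).
  by apply: measurable_sum => G; exact: measurable_Pn.
by apply/funext => r; rewrite /Pn_event fsbig_finite//; exact: finite_PiI.
Qed.

Variable rho : probability (measurableTypeR R) R.

Lemma Pmix_eventE n A : Pmix_event rho n A =
  (\int[rho]_(r in `]0%R, +oo[) (Pn_event n A r)%:E)%E.
Proof.
rewrite /Pmix_event /Pmix -ge0_integral_fsum//.
- by apply: eq_integral => r _; rewrite /Pn_event fsumEFin//; exact: finite_PiI.
- by move=> G; apply/measurable_EFinP; exact: measurable_Pn.
- by move=> G r; rewrite /= in_itv/= andbT => r0; rewrite lee_fin Pn_ge0.
- exact: finite_PiI.
Qed.

End mixture.

Section pointwise.
Variables (R : realType) (c1 c2 eps : R).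
Hypothesis c1_gt0 : 0 < c1.
Hypothesis c12 : c1 <= c2.
Hypothesis eps_gt0 : 0 < eps.

#[local] Existing Instance to_infty_filter.

Definition close_lines (n : nat * nat) : set polyline :=
  [set G | (tangential_dist R n G <= eps%:E)%E].

Lemma near_Pn_event (r e : R) : 0 < r -> 0 < e ->
  \forall n \near to_infty c1 c2, `|1 - Pn_event n (close_lines n) r| <= e.
Proof.
move=> r0 e0; have [L L0 HL] := @logsum_asymptotics R.
apply: filterS (near_far_weight c1_gt0 c12 r0 L0 HL eps_gt0 e0) => n [far tw].
have /andP[P0 P1] := Pn_event_itv n (close_lines n) r0.
rewrite ger0_norm ?subr_ge0// Pn_eventE.
rewrite -{1}(divff (lt0r_neq0 tw)) -mulrBl {1}(total_weightID n (close_lines n)).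
by rewrite addrAC subrr add0r ler_pdivrMr.
Qed.

End pointwise.

Theorem theorem1p2 (R : realType) (rho : probability (measurableTypeR R) R)
    (hrho : rho `]0, +oo[%classic = 1%E)
    (c1 c2 : R) (hc1 : 0 < c1) (hc12 : c1 <= c2)
    (eps : R) (heps : 0 < eps) :
  Pmix_event rho n [set G | (tangential_dist R n G <= eps%:E)%E]
    @[n --> to_infty c1 c2] --> 1%E.
Proof.
pose D : set (measurableTypeR R) := [set` `]0, +oo[].
have mD : measurable D by exact: measurable_itv.
pose f n (r : R) := Pn_event n (close_lines eps n) r.
have f01 n r : D r -> 0 <= f n r <= 1.
  by rewrite /D/= in_itv/= andbT => r0; exact: Pn_event_itv.
have mf n : measurable_fun D (fun r => (f n r)%:E).
  by apply/measurable_EFinP; exact: measurable_Pn_event.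
pose J n := (\int[rho]_(r in D) (f n r)%:E)%E.
have -> : (fun n => Pmix_event rho n [set G | (tangential_dist R n G <= eps%:E)%E]) = J.
  by apply/funext => n; exact: Pmix_eventE.
have I1 : (\int[rho]_(r in D) (cst 1%:E r) = 1)%E.
  by rewrite integral_cst// mul1e; exact: hrho.
have Jfin n : J n \is a fin_num.
  rewrite ge0_fin_numE; last first.
    by apply: integral_ge0 => r /(f01 n)/andP[]; rewrite lee_fin.
  apply: le_lt_trans (ltry 1); rewrite -I1; apply: ge0_le_integral => //.
  - by move=> r /(f01 n)/andP[]; rewrite lee_fin.
  - by move=> r /(f01 n)/andP[_]; rewrite lee_fin.
apply/fine_cvgP; split; first exact: nearW.
(* Dominated convergence speaks of sequences.  If the limit failed, the integral
   would stay away from 1 along a sequence of endpoints in the sector that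
   tends to infinity. *)
apply/cvgrPdist_le => e e0; apply: contrapT => far.
have /choice[u uP] : forall N : nat, exists n : nat * nat,
    [/\ (N <= n.1)%N, (N <= n.2)%N, c1 <= n.2%:R / n.1%:R <= c2 & ~ `|1 - fine (J n)| <= e].
  move=> N; apply: contrapT => none; apply: far.
  apply: filterS2 (near_sector c1 c2) (near_large c1 c2 N) => n sn [n1 n2].
  by apply: contrapT => ne; apply: none; exists n.
have := @dominated_convergence _ _ _ rho D mD (fun k r => (f (u k) r)%:E)
  (cst 1%:E) (cst 1%:E) (fun k => mf (u k)) (measurable_cst _).
have ae1 : {ae rho, forall r, D r -> (f (u k) r)%:E @[k --> \oo] --> cst 1%:E r}.
  apply: aeW => r Dr; apply: cvg_EFin; first exact: nearW.
  apply/cvgrPdist_le => a a0.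
  have r0 : 0 < r by move: Dr; rewrite /D/= in_itv/= andbT.
  have [M hM] := near_sectorP (near_Pn_event hc1 hc12 heps r0 a0).
  exists M => // k /= Mk; have [k1 k2 ks _] := uP k.
  by apply: hM => //; [exact: leq_trans k1|exact: leq_trans k2].
have ae2 : {ae rho, forall r k, D r -> (`|(f (u k) r)%:E| <= cst 1%:E r)%E}.
  apply: aeW => r k Dr; have /andP[h0 h1] := f01 (u k) r Dr.
  by rewrite /= lee_fin ger0_norm.
have i1 : rho.-integrable D (cst 1%:E) by exact: finite_measure_integrable_cst.
move=> /(_ ae1 i1 ae2)[_ _]; rewrite I1 => /fine_cvgP[_].
move=> /cvgrPdist_le/(_ e e0)[k _ /(_ k (leqnn k))/= h].
by have [_ _ _] := uP k; apply.
Qed.
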